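(* Let $T$ be a compact abelian group, $H$ a Hopf $*$-algebra, $\pi\colon H\to\mathbb{C}[T]$ a Hopf $*$-algebra map, and $\beta\colon\hat T\times\hat T\to\mathbb{T}$ a bicharacter. Let $J_1,J_2\colon(\hat T\times\hat T)\times(\hat T\times\hat T)\to\mathbb{T}$ be the $2$-cocycles $$J_1((a,b),(c,d))=\overline{\beta(b,c)},\qquad J_2((a,b),(c,d))=\overline{\beta(b,cd^{-1})}.$$ Then, for every $H$-cocentral closed subgroup $T_0\subset T$, the following maps are well-defined isomorphisms of Hopf $*$-algebras: $${}_{J_1}\big((\mathbb{C}[T]\otimes H)^{\Delta(T_0)}\big)_{J_1^{-1}}\cong\mathbb{C}[T/T_0]\# H_\beta,\qquad a\otimes x\mapsto a\,\pi(x_{(1)})\# x_{(2)},$$ $${}_{J_2}\big(\mathbb{C}[T/T_0]\ltimes H\big)_{J_2^{-1}}\cong\mathbb{C}[T/T_0]\# H_\beta,\qquad a\otimes x\mapsto a\# x.$$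
   Context: Algebras are unital over $\mathbb{C}$; Sweedler notation $\Delta(x)=x_{(1)}\otimes x_{(2)}$ is used; $\mathbb{T}$ is the unit circle. $\mathbb{C}[T]=\mathbb{C}\hat T$ is the group Hopf $*$-algebra of the dual group $\hat T$ (basis $a\in\hat T$, $\Delta(a)=a\otimes a$, $\varepsilon(a)=1$, $S(a)=a^{-1}=a^*$). A bicharacter is a map multiplicative in each variable; it is extended bilinearly to $\mathbb{C}[T]\otimes\mathbb{C}[T]$. Bi-grading: $H=\bigoplus_{a,b\in\hat T}H_{a,b}$, $H_{a,b}=\{x:(\pi\otimes\iota)\Delta(x)=a\otimes x,\ (\iota\otimes\pi)\Delta(x)=x\otimes b\}$. The adjoint coaction $\mathrm{ad}_\pi(x)=x_{(2)}\otimes\pi(S(x_{(1)})x_{(3)})$ satisfies $\mathrm{ad}_\pi(x)=x\otimes a^{-1}b$ for $x\in H_{a,b}$. A closed subgroup $T_0\subset T$ is $H$-cocentral if $H_{a,b}=0$ whenever $a|_{T_0}\ne b|_{T_0}$. We view $\mathbb{C}[T/T_0]\subset\mathbb{C}[T]$ as the span of the $a\in\hat T$ with $a|_{T_0}=1$; then $\mathrm{ad}_\pi(H)\subset H\otimes\mathbb{C}[T/T_0]$. $(\mathbb{C}[T]\otimes H)^{\Delta(T_0)}=\bigoplus_{a,b,c:\,(ab)|_{T_0}=1}a\otimes H_{b,c}$, a Hopf $*$-subalgebra of the tensor product Hopf $*$-algebra $\mathbb{C}[T]\otimes H$. $\mathbb{C}[T/T_0]\ltimes H$ is the tensor product $*$-algebra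 $\mathbb{C}[T/T_0]\otimes H$ with counit $\varepsilon\otimes\varepsilon$ and coproduct $\Delta(a\otimes x)=\sum_d(a\otimes x_{(1)}^{b,d})\otimes(ab^{-1}d\otimes x_{(2)}^{d,c})$ for $a\in\widehat{T/T_0}$, $x\in H_{b,c}$, where $x_{(1)}^{b,d}\otimes x_{(2)}^{d,c}$ is the component of $\Delta(x)$ in $H_{b,d}\otimes H_{d,c}$. It is a Hopf $*$-algebra. Transmutation $H_\beta$: the coalgebra $H$ with coaction $\mathrm{ad}_\pi$ and new product, antipode and involution: for $x\in H_{a,b}$, $y\in H_{c,d}$, $x\cdot_\beta y=\beta(a^{-1}b,c^{-1})xy$, $S_\beta(x)=\beta(a^{-1}b,b)S(x)$, $x^{*_\beta}=\beta(a^{-1}b,a^{-1})x^*$. Bosonization $\mathbb{C}[T/T_0]\# H_\beta$: the vector space $\mathbb{C}[T/T_0]\otimes H$ (elements written $a\# x$) with product $(a\# x)(a'\# x')=\beta(b^{-1}c,a')\,aa'\#(x\cdot_\beta x')$ and involution $(a\# x)^*=\beta(b^{-1}c,a)\,a^{-1}\# x^{*_\beta}$ for $a,a'\in\widehat{T/T_0}$, $x\in H_{b,c}$, $x'\in H$, counit $\varepsilon\#\varepsilon$, coproduct $\Delta(a\# x)=\sum_d(a\# x_{(1)}^{b,d})\otimes(ab^{-1}d\# x_{(2)}^{d,c})$ for $x\in H_{b,c}$, and antipode $S(a\# x)=(1\# S_\beta(x))\,((ab^{-1}c)^{-1}\#1)$ for $x\in H_{b,c}$. Cocycle twist: for a Hopf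 $*$-algebra $L$ and a unitary Hopf $2$-cocycle $J\colon L\otimes L\to\mathbb{C}$ (convolution invertible, $J(x_{(1)},y_{(1)})J(x_{(2)}y_{(2)},z)=J(y_{(1)},z_{(1)})J(x,y_{(2)}z_{(2)})$, $J^{-1}(x,y)=\overline{J(S(x)^*,S(y)^* )}$), ${}_JL_{J^{-1}}$ is the Hopf $*$-algebra with the same coalgebra structure and, with $u(x)=J(x_{(1)},S(x_{(2)}))$, $x\star_Jy=J(x_{(1)},y_{(1)})x_{(2)}y_{(2)}J^{-1}(x_{(3)},y_{(3)})$, $S^J(x)=u(x_{(1)})S(x_{(2)})u^{-1}(x_{(3)})$, $x^{*_J}=S^J(S^{-1}(x^* ))$. The cocycles $J_1$, $J_2$, extended linearly, are regarded as Hopf $2$-cocycles on $(\mathbb{C}[T]\otimes H)^{\Delta(T_0)}$ and on $\mathbb{C}[T/T_0]\ltimes H$, respectively, by pulling back along the Hopf $*$-algebra maps $\iota\otimes\pi$, $a\otimes x\mapsto a\otimes\pi(x)$, from these Hopf algebras into $\mathbb{C}[T]\otimes\mathbb{C}[T]=\mathbb{C}[\hat T\times\hat T]$. *)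

(* Defs.v *)
From HB Require Import structures.
From mathcomp Require Import all_boot all_order all_algebra finmap complex.
From mathcomp Require Import all_classical all_reals all_analysis.
(* The notations of monalg clash with those of mathcomp-analysis. *)
From mathcomp Require monalg.
Export -(notations) monalg.

Set Implicit Arguments.
Unset Strict Implicit.
Unset Printing Implicit Defensive.

Import Order.TTheory GRing.Theory Num.Theory.
Import numFieldNormedType.Exports.

Local Open Scope classical_set_scope.
Local Open Scope ring_scope.
Local Open Scope quotient_scope.

Section Tensor.
Context {K : fieldType}.

Section TensorType.
Variables (V W : lmodType K).
Implicit Types s t r : seq (V * W).

Definition tsum (U : nmodType) (F : V -> W -> U) s : U :=
  \sum_(p <- s) F p.1 p.2.

(* The list [:: (v1, w1); ...; (vn, wn)] stands for v1 (x) w1 + ... + vn (x) wn.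
   By the universal property, two lists represent the same tensor iff no
   bilinear map distinguishes them. *)
Definition tensor_equiv s t : bool :=
  `[< forall (U : lmodType K) (F : V -> W -> U),
        bilinear_for *:%R *:%R F -> tsum F s = tsum F t >].

Lemma tensor_equivP s t :
  reflect (forall (U : lmodType K) (F : V -> W -> U),
             bilinear_for *:%R *:%R F -> tsum F s = tsum F t)
          (tensor_equiv s t).
Proof. exact: asboolP. Qed.

Lemma tensor_equiv_refl : reflexive tensor_equiv.
Proof. by move=> s; apply/tensor_equivP. Qed.

Lemma tensor_equiv_sym : symmetric tensor_equiv.
Proof.
by move=> s t; apply/tensor_equivP/tensor_equivP => st U F bF; rewrite (st U F bF).
Qed.

Lemma tensor_equiv_trans : transitive tensor_equiv.
Proof.
move=> t s r /tensor_equivP st /tensor_equivP tr; apply/tensor_equivP => U F bF.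
by rewrite (st U F bF) (tr U F bF).
Qed.

Canonical tensor_equiv_rel :=
  EquivRel tensor_equiv tensor_equiv_refl tensor_equiv_sym tensor_equiv_trans.

Definition tensor : Type := {eq_quot tensor_equiv}.

HB.instance Definition _ := Choice.on tensor.
HB.instance Definition _ := Quotient.on tensor.

Definition tens (v : V) (w : W) : tensor := \pi_tensor [:: (v, w)].

(* The map induced on the tensor product by F, meaningful when the value does
   not depend on the representative, e.g. for F bilinear. *)
Definition tlift (U : nmodType) (F : V -> W -> U) (u : tensor) : U :=
  tsum F (repr u).

Lemma pi_tensorP s t : tensor_equiv s t -> \pi_tensor s = \pi_tensor t.
Proof. by move=> st; apply/eqquotP. Qed.

Lemma repr_pi_tensor s : tensor_equiv (repr (\pi_tensor s)) s.
Proof. by apply/(@eqquotP _ _ {eq_quot tensor_equiv}); rewrite reprK. Qed.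

Lemma tlift_pi (U : lmodType K) (F : V -> W -> U) s :
  bilinear_for *:%R *:%R F -> tlift F (\pi_tensor s) = tsum F s.
Proof. by move=> bF; have /tensor_equivP := repr_pi_tensor s; exact. Qed.

Lemma tsum_cat (U : nmodType) (F : V -> W -> U) s t :
  tsum F (s ++ t) = tsum F s + tsum F t.
Proof. exact: big_cat. Qed.

Definition tscale_seq (a : K) s := [seq (a *: p.1, p.2) | p <- s].

Lemma tsum_scale (U : lmodType K) (F : V -> W -> U) a s :
  bilinear_for *:%R *:%R F -> tsum F (tscale_seq a s) = a *: tsum F s.
Proof.
move=> bF; rewrite /tsum big_map scaler_sumr; apply: eq_bigr => p _ /=.
exact: (scalable_linear (bF.1 p.2)).
Qed.

Definition tzero : tensor := \pi_tensor [::].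
Definition tadd (u v : tensor) : tensor := \pi_tensor (repr u ++ repr v).
Definition tscale (a : K) (u : tensor) : tensor :=
  \pi_tensor (tscale_seq a (repr u)).
Definition topp (u : tensor) : tensor := tscale (- 1) u.

Lemma tensor_ext (u v : tensor) :
  (forall (U : lmodType K) (F : V -> W -> U),
     bilinear_for *:%R *:%R F -> tlift F u = tlift F v) -> u = v.
Proof.
move=> uv; rewrite -[u]reprK -[v]reprK; apply: pi_tensorP.
by apply/tensor_equivP => U F /uv.
Qed.

Lemma tlift_add (U : lmodType K) (F : V -> W -> U) u v :
  bilinear_for *:%R *:%R F -> tlift F (tadd u v) = tlift F u + tlift F v.
Proof. by move=> bF; rewrite tlift_pi// tsum_cat. Qed.

Lemma tlift_zero (U : lmodType K) (F : V -> W -> U) :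
  bilinear_for *:%R *:%R F -> tlift F tzero = 0.
Proof. by move=> bF; rewrite tlift_pi// /tsum big_nil. Qed.

Lemma tlift_scale (U : lmodType K) (F : V -> W -> U) a u :
  bilinear_for *:%R *:%R F -> tlift F (tscale a u) = a *: tlift F u.
Proof. by move=> bF; rewrite tlift_pi// tsum_scale. Qed.

Lemma taddA : associative tadd.
Proof. by move=> u v w; apply: tensor_ext => U F bF; rewrite !tlift_add// addrA. Qed.

Lemma taddC : commutative tadd.
Proof. by move=> u v; apply: tensor_ext => U F bF; rewrite !tlift_add// addrC. Qed.

Lemma tadd0 : left_id tzero tadd.
Proof.
by move=> u; apply: tensor_ext => U F bF; rewrite tlift_add// tlift_zero// add0r.
Qed.

Lemma taddN : left_inverse tzero topp tadd.
Proof.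
move=> u; apply: tensor_ext => U F bF.
by rewrite tlift_add// tlift_scale// tlift_zero// scaleN1r addNr.
Qed.

HB.instance Definition _ := GRing.isZmodule.Build tensor taddA taddC tadd0 taddN.

Lemma tscaleA a b u : tscale a (tscale b u) = tscale (a * b) u.
Proof. by apply: tensor_ext => U F bF; rewrite !tlift_scale// scalerA. Qed.

Lemma tscale1 : left_id 1 tscale.
Proof. by move=> u; apply: tensor_ext => U F bF; rewrite tlift_scale// scale1r. Qed.

Lemma tscaleDr : right_distributive tscale +%R.
Proof.
move=> a u v; apply: tensor_ext => U F bF.
by rewrite (tlift_add _ _ bF) !tlift_scale// tlift_add// scalerDr.
Qed.

Lemma tscaleDl u : {morph tscale^~ u : a b / a + b}.
Proof.
move=> a b; apply: tensor_ext => U F bF.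
by rewrite tlift_add// !tlift_scale// scalerDl.
Qed.

HB.instance Definition _ :=
  GRing.Zmodule_isLmodule.Build K tensor tscaleA tscale1 tscaleDr tscaleDl.

End TensorType.

Definition tmap (V W V' W' : lmodType K) (f : V -> V') (g : W -> W')
    (u : tensor V W) : tensor V' W' :=
  tlift (fun v w => tens (f v) (g w)) u.

Definition tassoc (V W X : lmodType K) (u : tensor (tensor V W) X) :
    tensor V (tensor W X) :=
  tlift (fun vw x => tlift (fun v w => tens v (tens w x)) vw) u.

End Tensor.

Notation "v ⊗ w" := (tens v w)
  (at level 40, left associativity) : ring_scope.

Section Span.
Context {K : fieldType} {V : lmodType K}.
Variable S : set V.

Definition in_span (v : V) : Prop :=
  exists2 s : seq (K * V), (forall p, p \in s -> S p.2)
                         & v = \sum_(p <- s) p.1 *: p.2.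

Definition span_pred : {pred V} := fun v => `[< in_span v >].

Lemma span_submod_closed : submod_closed span_pred.
Proof.
split; first by apply/asboolP; exists [::] => //; rewrite big_nil.
move=> a u v /asboolP[s Ss ->] /asboolP[t St ->]; apply/asboolP.
exists ([seq (a * p.1, p.2) | p <- s] ++ t).
  move=> p; rewrite mem_cat => /orP[/mapP[q qs ->] /=|]; last exact: St.
  exact: Ss.
rewrite big_cat big_map scaler_sumr; congr (_ + _).
by apply: eq_bigr => p _; rewrite scalerA.
Qed.

Record span : Type := Span { span_val :> V; _ : span_val \in span_pred }.

HB.instance Definition _ := [isSub for span_val].
HB.instance Definition _ := [Choice of span by <:].
HB.instance Definition _ :=
  GRing.SubChoice_isSubLmodule.Build K V span_pred span span_submod_closed.

End Span.

Section Hopf.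
Context {C : numClosedFieldType}.

(* The multiplication is not taken from an algType: the constructions below put
   several products and involutions on one vector space. *)
Record hopf_ops (V : lmodType C) : Type := HopfOps {
  hmul : V -> V -> V;
  hone : V;
  hcomul : V -> tensor V V;
  hcounit : V -> C;
  hanti : V -> V;
  hstar : V -> V }.

Section Sweedler.
Context {V : lmodType C}.
Variable D : hopf_ops V.

(* F(x_(1), x_(2)) and F(x_(1), x_(2), x_(3)), for F multilinear (or
   multi-antilinear). *)
Definition sw2 (U : nmodType) (F : V -> V -> U) (x : V) : U :=
  tlift F (hcomul D x).

Definition sw3 (U : nmodType) (F : V -> V -> V -> U) (x : V) : U :=
  sw2 (fun y x3 => sw2 (fun x1 x2 => F x1 x2 x3) y) x.

End Sweedler.

Definition tensor_ops (V W : lmodType C) (D : hopf_ops V) (E : hopf_ops W) :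
    hopf_ops (tensor V W) := {|
  hmul u v :=
    tlift (fun x y => tlift (fun x' y' => hmul D x x' ⊗ hmul E y y') v) u;
  hone := hone D ⊗ hone E;
  hcomul u := tlift (fun x y =>
    sw2 D (fun x1 x2 => sw2 E (fun y1 y2 => (x1 ⊗ y1) ⊗ (x2 ⊗ y2)) y) x) u;
  hcounit u := tlift (fun x y => hcounit D x * hcounit E y) u;
  hanti u := tmap (hanti D) (hanti E) u;
  hstar u := tmap (hstar D) (hstar E) u |}.

Record is_hopf_star (V : lmodType C) (D : hopf_ops V) : Prop := IsHopfStar {
  hopf_mul_bilinear : bilinear_for *:%R *:%R (hmul D);
  hopf_mulA : associative (hmul D);
  hopf_mul1 : left_id (hone D) (hmul D);
  hopf_1mul : right_id (hone D) (hmul D);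
  hopf_comul_linear : linear (hcomul D);
  hopf_counit_linear : scalar (hcounit D);
  hopf_coassoc : forall x,
    tassoc (tmap (hcomul D) id (hcomul D x)) = tmap id (hcomul D) (hcomul D x);
  hopf_counitl : forall x, sw2 D (fun x1 x2 => hcounit D x1 *: x2) x = x;
  hopf_counitr : forall x, sw2 D (fun x1 x2 => hcounit D x2 *: x1) x = x;
  hopf_comulM : forall x y,
    hcomul D (hmul D x y) = hmul (tensor_ops D D) (hcomul D x) (hcomul D y);
  hopf_comul1 : hcomul D (hone D) = hone D ⊗ hone D;
  hopf_counitM : forall x y, hcounit D (hmul D x y) = hcounit D x * hcounit D y;
  hopf_counit1 : hcounit D (hone D) = 1;
  hopf_anti_linear : linear (hanti D);
  hopf_antil : forall x,
    sw2 D (fun x1 x2 => hmul D (hanti D x1) x2) x = hcounit D x *: hone D;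
  hopf_antir : forall x,
    sw2 D (fun x1 x2 => hmul D x1 (hanti D x2)) x = hcounit D x *: hone D;
  hopf_star_antilinear : forall a x y,
    hstar D (a *: x + y) = a^* *: hstar D x + hstar D y;
  hopf_starK : involutive (hstar D);
  hopf_starM : forall x y, hstar D (hmul D x y) = hmul D (hstar D y) (hstar D x);
  hopf_comul_star : forall x,
    hcomul D (hstar D x) = tmap (hstar D) (hstar D) (hcomul D x) }.

Record hopf_star_hom (V W : lmodType C) (D : hopf_ops V) (E : hopf_ops W)
    (f : V -> W) : Prop := HopfStarHom {
  hopf_hom_src : is_hopf_star D;
  hopf_hom_tgt : is_hopf_star E;
  hopf_hom_linear : linear f;
  hopf_homM : forall x y, f (hmul D x y) = hmul E (f x) (f y);
  hopf_hom1 : f (hone D) = hone E;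
  hopf_hom_comul : forall x, hcomul E (f x) = tmap f f (hcomul D x);
  hopf_hom_counit : forall x, hcounit E (f x) = hcounit D x;
  hopf_hom_anti : forall x, f (hanti D x) = hanti E (f x);
  hopf_hom_star : forall x, f (hstar D x) = hstar E (f x) }.

Definition hopf_star_iso (V W : lmodType C) (D : hopf_ops V) (E : hopf_ops W)
    (f : V -> W) : Prop :=
  hopf_star_hom D E f /\ bijective f.

(* The operations induced on the span W of S by those of D, when W is a Hopf
   *-subalgebra: the values in V are read back in W, and the coproduct of x is
   the (unique) element of W ⊗ W that is sent to D's coproduct of x. *)
Definition span_ops (V : lmodType C) (D : hopf_ops V) (S : set V) :
    hopf_ops (span S) := {|
  hmul x y := insubd 0 (hmul D (val x) (val y));
  hone := insubd 0 (hone D);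
  hcomul x := xget 0 [set u : tensor (span S) (span S) | tmap val val u = hcomul D (val x)];
  hcounit x := hcounit D (val x);
  hanti x := insubd 0 (hanti D (val x));
  hstar x := insubd 0 (hstar D (val x)) |}.

Section Twist.
Context {L : lmodType C}.
Variable D : hopf_ops L.

Definition conv_inverse2 (J K : L -> L -> C) : Prop :=
  forall x y,
    sw2 D (fun x1 x2 => sw2 D (fun y1 y2 => J x1 y1 * K x2 y2) y) x
      = hcounit D x * hcounit D y
    /\ sw2 D (fun x1 x2 => sw2 D (fun y1 y2 => K x1 y1 * J x2 y2) y) x
      = hcounit D x * hcounit D y.

Definition conv_inverse1 (u v : L -> C) : Prop :=
  forall x, sw2 D (fun x1 x2 => u x1 * v x2) x = hcounit D x
         /\ sw2 D (fun x1 x2 => v x1 * u x2) x = hcounit D x.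

Definition conv_inv2 (J : L -> L -> C) : L -> L -> C :=
  xget (fun _ _ => 0) [set K | bilinear_for *%R *%R K /\ conv_inverse2 J K].

Definition conv_inv1 (u : L -> C) : L -> C :=
  xget (fun _ => 0) [set v | scalar v /\ conv_inverse1 u v].

Record unitary_hopf_cocycle (J : L -> L -> C) : Prop := UnitaryHopfCocycle {
  cocycle_hopf : is_hopf_star D;
  cocycle_bilinear : bilinear_for *%R *%R J;
  cocycle_invertible :
    exists2 K : L -> L -> C, bilinear_for *%R *%R K & conv_inverse2 J K;
  cocycleP : forall x y z,
    sw2 D (fun x1 x2 => sw2 D (fun y1 y2 =>
      J x1 y1 * J (hmul D x2 y2) z) y) x
    = sw2 D (fun y1 y2 => sw2 D (fun z1 z2 =>
      J y1 z1 * J x (hmul D y2 z2)) z) y;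
  cocycle_unitary : forall x y,
    conv_inv2 J x y = (J (hstar D (hanti D x)) (hstar D (hanti D y)))^* }.

Definition inv_anti (x : L) : L := xget 0 [set y | hanti D y = x].

Variable J : L -> L -> C.

Definition twist_u (x : L) : C := sw2 D (fun x1 x2 => J x1 (hanti D x2)) x.

Definition twist_anti (x : L) : L :=
  sw3 D (fun x1 x2 x3 => (twist_u x1 * conv_inv1 twist_u x3) *: hanti D x2) x.

Definition twist_ops : hopf_ops L := {|
  hmul x y := sw3 D (fun x1 x2 x3 => sw3 D (fun y1 y2 y3 =>
    (J x1 y1 * conv_inv2 J x3 y3) *: hmul D x2 y2) y) x;
  hone := hone D;
  hcomul := hcomul D;
  hcounit := hcounit D;
  hanti := twist_anti;
  hstar x := twist_anti (inv_anti (hstar D x)) |}.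

End Twist.

Section GroupAlgebra.
Variable G : groupType.

Definition galg : lmodType C := malg G C.

Definition gbase (a : G) : galg := mkmalgU a 1.

Definition glin (U : lmodType C) (F : G -> U) (f : galg) : U :=
  \sum_(a <- msupp f) mcoeff a f *: F a.

Definition gantilin (U : lmodType C) (F : G -> U) (f : galg) : U :=
  \sum_(a <- msupp f) (mcoeff a f)^* *: F a.

Definition galg_ops : hopf_ops galg := {|
  hmul f g := glin (fun a => glin (fun b => gbase (a * b)%g) g) f;
  hone := gbase 1%g;
  hcomul := glin (fun a => gbase a ⊗ gbase a);
  hcounit := glin (fun=> 1 : C^o);
  hanti := glin (fun a => gbase a^-1%g);
  hstar := gantilin (fun a => gbase a^-1%g) |}.

(* The bilinear extension to C[G] ⊗ C[G] = C[G * G] of a function on G * G. *)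
Definition galg2_form (J : G * G -> G * G -> C) (u v : tensor galg galg) : C :=
  tlift (fun f g => tlift (fun f' g' =>
    glin (fun a => glin (fun b => glin (fun c => glin (fun d =>
      J (a, b) (c, d) : C^o) g') f') g) f) v) u.

End GroupAlgebra.

End Hopf.

Section Dual.
Variables (R : realType) (T : topologicalZmodType).

Definition is_character (chi : T -> R[i]) : Prop :=
  [/\ continuous (chi : T -> (R[i] : numFieldType)),
      forall t, `|chi t| = 1
    & forall s t, chi (s + t) = chi s * chi t].

Record dual : Type :=
  Dual { dual_fun :> T -> R[i]; dual_subproof : `[< is_character dual_fun >] }.

HB.instance Definition _ := [isSub for dual_fun].
HB.instance Definition _ := [Choice of dual by <:].

Lemma dualP (a : dual) : is_character a.
Proof. exact/asboolP/dual_subproof. Qed.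

Lemma dual_neq0 (a : dual) t : a t != 0.
Proof. by have [_ na _] := dualP a; rewrite -normr_eq0 na oner_neq0. Qed.

Lemma dual_ext (a b : dual) : (forall t, a t = b t) -> a = b.
Proof. by move=> ab; apply/val_inj/funext. Qed.

Lemma one_character : is_character (fun=> 1).
Proof.
by split=> [|t|s t]; [exact: cst_continuous|rewrite normr1|rewrite mulr1].
Qed.

Lemma mul_character (a b : dual) : is_character (fun t => a t * b t).
Proof.
have [ca na Ma] := dualP a; have [cb nb Mb] := dualP b; split.
- move=> t; apply: cvgM; [exact: ca|exact: cb].
- by move=> t; rewrite normrM na nb mulr1.
- by move=> s t; rewrite Ma Mb mulrACA.
Qed.

Lemma inv_character (a : dual) : is_character (fun t => (a t)^-1).
Proof.
have [ca na Ma] := dualP a; split.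
- by move=> t; apply: cvgV; [exact: dual_neq0|exact: ca].
- by move=> t; rewrite normfV na invr1.
- by move=> s t; rewrite Ma invfM.
Qed.

Definition dual1 : dual := Dual (asboolT one_character).
Definition dualM (a b : dual) : dual := Dual (asboolT (mul_character a b)).
Definition dualV (a : dual) : dual := Dual (asboolT (inv_character a)).

Lemma dualMA : associative dualM.
Proof. by move=> a b c; apply: dual_ext => t /=; rewrite mulrA. Qed.

Lemma dual1M : left_id dual1 dualM.
Proof. by move=> a; apply: dual_ext => t /=; rewrite mul1r. Qed.

Lemma dualM1 : right_id dual1 dualM.
Proof. by move=> a; apply: dual_ext => t /=; rewrite mulr1. Qed.

Lemma dualVM : left_inverse dual1 dualV dualM.
Proof. by move=> a; apply: dual_ext => t /=; rewrite mulVf// dual_neq0. Qed.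

Lemma dualMV : right_inverse dual1 dualV dualM.
Proof. by move=> a; apply: dual_ext => t /=; rewrite mulfV// dual_neq0. Qed.

HB.instance Definition _ :=
  isGroup.Build dual dualMA dual1M dualM1 dualVM dualMV.

Record closed_subgroup (T0 : set T) : Prop := ClosedSubgroup {
  closed_subgroup_closed : closed T0;
  closed_subgroup0 : T0 0;
  closed_subgroupD : forall s t, T0 s -> T0 t -> T0 (s + t);
  closed_subgroupN : forall t, T0 t -> T0 (- t) }.

Record is_bichar (beta : dual -> dual -> R[i]) : Prop := IsBichar {
  bichar_norm : forall a b, `|beta a b| = 1;
  bicharMl : forall a b c, beta (a * b)%g c = beta a c * beta b c;
  bicharMr : forall a b c, beta a (b * c)%g = beta a b * beta a c }.

Section Annihilator.
Variable T0 : set T.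

Definition agree_on (a b : dual) : Prop := forall t, T0 t -> a t = b t.

Definition annih_pred : {pred dual} := fun a => `[< agree_on a 1%g >].

Lemma annih_closed : group_closed annih_pred.
Proof.
split; first exact/asboolP.
move=> a b /asboolP a1 /asboolP b1; apply/asboolP => t T0t /=.
by rewrite a1// b1//= invr1 mulr1.
Qed.

(* The dual of T / T0, as the group of the characters of T trivial on T0. *)
Record qdual : Type :=
  QDual { qdual_val :> dual; qdual_subproof : qdual_val \in annih_pred }.

HB.instance Definition _ := [isSub for qdual_val].
HB.instance Definition _ := [Choice of qdual by <:].
HB.instance Definition _ :=
  SubChoice_isSubGroup.Build dual annih_pred qdual annih_closed.

End Annihilator.
End Dual.

Arguments agree_on {R T} T0 a b.

Section Constructions.
Context {R : realType} {T : topologicalZmodType} {H : lmodType R[i]}.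
Local Notation C := (R[i] : numClosedFieldType).
Local Notation That := (dual R T).
Local Notation CT := (@galg C That).

Variables (DH : hopf_ops (C := C) H) (pi : H -> CT).

Definition bihomogeneous (a b : That) : set H :=
  [set x | tmap pi id (hcomul DH x) = gbase a ⊗ x
        /\ tmap id pi (hcomul DH x) = x ⊗ gbase b].

(* The component of x in H_{a,b}: if x is the sum of the x_{a,b}, then
   pi(x_(1)) ⊗ x_(2) ⊗ pi(x_(3)) is the sum of the a ⊗ x_{a,b} ⊗ b. *)
Definition bicomp (a b : That) (x : H) : H :=
  sw3 DH (fun x1 x2 x3 => (mcoeff a (pi x1) * mcoeff b (pi x3)) *: x2) x.

(* The additive extension to H of maps F a b defined on the H_{a,b}. *)
Definition bilift (U : nmodType) (F : That -> That -> H -> U) (x : H) : U :=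
  \sum_(ab \in [set: That * That]) F ab.1 ab.2 (bicomp ab.1 ab.2 x).

Definition cocentral (T0 : set T) : Prop :=
  forall a b : That, ~ agree_on T0 a b ->
  forall x, bihomogeneous a b x -> x = 0.

Section Transmutation.
Variable beta : That -> That -> R[i].

Definition trmul (x y : H) : H :=
  bilift (fun a b x' => bilift (fun c d y' =>
    beta (a^-1 * b)%g c^-1%g *: hmul DH x' y') y) x.

Definition tranti (x : H) : H :=
  bilift (fun a b x' => beta (a^-1 * b)%g b *: hanti DH x') x.

Definition trstar (x : H) : H :=
  bilift (fun a b x' => beta (a^-1 * b)%g a^-1%g *: hstar DH x') x.

End Transmutation.

Definition diag_gens (T0 : set T) : set (tensor CT H) :=
  [set z | exists a b c : That, exists x : H,
     [/\ agree_on T0 (a * b)%g 1%g, bihomogeneous b c x & z = gbase a ⊗ x]].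

Definition diag_inv (T0 : set T) : lmodType R[i] := span (diag_gens T0).

Definition diag_inv_ops (T0 : set T) : hopf_ops (C := C) (diag_inv T0) :=
  span_ops (tensor_ops (@galg_ops C That) DH) (diag_gens T0).

Section Smash.
Variable T0 : set T.
Local Notation CTT0 := (@galg C (qdual R T0)).
Local Notation CTT0xH := (tensor CTT0 H).

Definition galg_incl : CTT0 -> CT := glin (fun a => gbase (val a)).

(* The basis element a of C[T/T_0] if a is trivial on T_0, and 0 otherwise. *)
Definition qbase (a : That) : CTT0 := oapp (@gbase C _) 0 (insub a).

(* The linear extension of maps given on the a ⊗ x with x in H_{b,c}. *)
Definition smash_lift (U : lmodType R[i])
    (F : qdual R T0 -> That -> That -> H -> U) (u : CTT0xH) : U :=
  tlift (fun f x => glin (fun a => bilift (F a) x) f) u.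

(* In the sum over d, the component of x_(1) in H_{b,d} is 0 unless b and d
   agree on T_0, i.e., unless a b^-1 d is trivial on T_0. *)
Definition smash_comul : CTT0xH -> tensor CTT0xH CTT0xH :=
  smash_lift (fun a b c x => sw2 DH (fun x1 x2 =>
    \sum_(d \in [set: That])
      (gbase a ⊗ bicomp b d x1)
      ⊗ (qbase (val a * b^-1 * d)%g ⊗ bicomp d c x2)) x).

(* The antipode of C[T/T_0] ⋉ H is determined by the other operations: it
   sends a ⊗ x to (a b^-1 c)^-1 ⊗ S(x) for x in H_{b,c}. *)
Definition smash_ops : hopf_ops (C := C) CTT0xH :=
  let D := tensor_ops (@galg_ops C (qdual R T0)) DH in {|
  hmul := hmul D;
  hone := hone D;
  hcomul := smash_comul;
  hcounit := hcounit D;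
  hanti := smash_lift (fun a b c x =>
    qbase (val a * b^-1 * c)^-1%g ⊗ hanti DH x);
  hstar := hstar D |}.

Variable beta : That -> That -> R[i].

Definition boson_mul (u v : CTT0xH) : CTT0xH :=
  smash_lift (fun a b c x =>
    tlift (fun f' x' => glin (fun a' =>
      beta (b^-1 * c)%g (val a') *: (gbase (a * a')%g ⊗ trmul beta x x')) f')
    v) u.

Definition boson_ops : hopf_ops (C := C) CTT0xH := {|
  hmul := boson_mul;
  hone := gbase 1%g ⊗ hone DH;
  hcomul := smash_comul;
  hcounit := tlift (fun f x => hcounit (@galg_ops C _) f * hcounit DH x);
  hanti := smash_lift (fun a b c x =>
    boson_mul (gbase 1%g ⊗ tranti beta x)
              (qbase (val a * b^-1 * c)^-1%g ⊗ hone DH));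
  hstar := tlift (fun f x => gantilin (fun a => bilift (fun b c x' =>
    beta (b^-1 * c)%g (val a) *: (gbase a^-1%g ⊗ trstar beta x')) x) f) |}.

End Smash.

Section Cocycles.
Variable beta : That -> That -> R[i].

Definition J1 (p q : That * That) : R[i] := (beta p.2 q.1)^*.
Definition J2 (p q : That * That) : R[i] := (beta p.2 (q.1 * q.2^-1)%g)^*.

Definition diag_cocycle (T0 : set T) (x y : diag_inv T0) : R[i] :=
  galg2_form (C := C) J1 (tmap id pi (val x)) (tmap id pi (val y)).

Definition smash_cocycle (T0 : set T) (x y : tensor (@galg C (qdual R T0)) H) : R[i] :=
  galg2_form (C := C) J2 (tmap (galg_incl (T0 := T0)) pi x)
                         (tmap (galg_incl (T0 := T0)) pi y).

End Cocycles.

Definition shift_map : tensor CT H -> tensor CT H :=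
  tlift (fun f x =>
    sw2 DH (fun x1 x2 => hmul (@galg_ops C That) f (pi x1) ⊗ x2) x).

End Constructions.

(* Main.v *)
(* A Hopf *-algebra map from L to a group algebra C[G] bigrades L by G, and a
   bicharacter J on G with values in the circle, pulled back to L, satisfies
   J(x, y) = J(p, p') eps(x) eps(y) for x of bidegree (p, q) and y of bidegree
   (p', q').  Hence on homogeneous elements the twisted product, antipode and
   involution differ from the original ones only by scalars, namely by
   J(p, p') / J(q, q'), J(q, q) / J(p, p) and J(p, p) / J(q, q), and every
   Hopf *-algebra axiom of the twist becomes an identity between values of J.

   The map a ⊗ x |-> ab # x (x in H_{b,c}) is an isomorphism from the diagonal
   invariants onto C[T/T_0] ⋉ H before any twisting, and it transports J_2 to
   J_1.  So both twists are twists of one Hopf *-algebra by one bicharacter, and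
   comparing scalars on homogeneous elements shows that the operations of the
   second one are those of the bosonization. *)
Require Import Defs.
From HB Require Import structures.
From mathcomp Require Import all_boot all_order all_algebra finmap complex.
From mathcomp Require Import all_classical all_reals all_analysis.
From mathcomp Require Import ring.

Set Implicit Arguments.
Unset Strict Implicit.
Unset Printing Implicit Defensive.

Import Order.TTheory GRing.Theory Num.Theory.
Import numFieldNormedType.Exports.

Local Open Scope classical_set_scope.
Local Open Scope ring_scope.

(** * Linear maps and tensors *)

(** The coproduct of the diagonal invariants, the convolution inverses and the inverse antipode are
    all chosen elements, so each must be identified by existence and uniqueness. For the coproduct
    both come from a linear retraction of C[T] ⊗ H onto the invariants, which also keeps the
    inclusion injective on tensor squares. For the convolution inverses they come from homogeneous
    elements, on which convolution multiplies by a non-zero scalar. The involution is antilinear,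
    whereas generators determine linear maps; read as a linear map into the conjugate module, it is
    covered by the same extension lemmas. The axioms of C[T/T_0] ⋉ H are pulled back along its
    bijection with the invariants, which inherit theirs from C[T] ⊗ H. Cocentrality enters through
    one dichotomy: a bihomogeneous element is zero, or its two degrees agree on T_0. Hence the
    invariants are stable under coproduct and antipode, and ab^-1 d is a character of T/T_0 whenever
    it accompanies a non-zero term. *)

Section Linearity.
Variable C : numClosedFieldType.
Implicit Types U V W X Y : lmodType C.

Lemma lin0 U V (f : U -> V) : linear f -> f 0 = 0.
Proof.
by move=> lf; have /= := lf (-1) 0 0; rewrite scaler0 addr0 scaleN1r addNr.
Qed.

Lemma linD U V (f : U -> V) : linear f -> {morph f : x y / x + y}.
Proof. by move=> lf x y; rewrite -[x]scale1r lf !scale1r. Qed.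

Lemma linZ U V (f : U -> V) : linear f -> forall a, {morph f : x / a *: x}.
Proof. by move=> lf a x; rewrite -[a *: x]addr0 lf (lin0 lf) addr0. Qed.

Lemma lin_sum U V (f : U -> V) (I : Type) (s : seq I) (E : I -> U) :
  linear f -> f (\sum_(i <- s) E i) = \sum_(i <- s) f (E i).
Proof. by move=> lf; apply: (big_morph f (linD lf) (lin0 lf)). Qed.

Lemma linear_id V : linear (fun v : V => v).
Proof. by []. Qed.

Lemma linear_comp U V W (g : V -> W) (f : U -> V) :
  linear g -> linear f -> linear (fun v => g (f v)).
Proof. by move=> lg lf a x y; rewrite lf lg. Qed.

Lemma linear_add U V (f g : U -> V) :
  linear f -> linear g -> linear (fun v => f v + g v).
Proof. by move=> lf lg a x y; rewrite lf lg scalerDr addrACA. Qed.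

Lemma linear_scale U V (f : U -> V) k :
  linear f -> linear (fun v => k *: f v).
Proof. by move=> lf a x y; rewrite lf scalerDr !scalerA mulrC. Qed.

Lemma linear_scalel U V (f : U -> C^o) (w : V) :
  linear f -> linear (fun v => (f v : C) *: w).
Proof. by move=> lf a x y; rewrite lf scalerDl -scalerA. Qed.

Lemma linear_mull U (f : U -> C^o) (k : C) :
  linear f -> linear (fun v => (f v : C) * k : C^o).
Proof. by move=> lf a x y; rewrite lf mulrDl -[in LHS]mulrA. Qed.

Lemma linear_mulr U (f : U -> C^o) (k : C) :
  linear f -> linear (fun v => k * (f v : C) : C^o).
Proof. by move=> lf a x y; rewrite lf mulrDr mulrCA. Qed.

Lemma linear_sum U V (I : Type) (s : seq I) (f : I -> U -> V) :
  (forall i, linear (f i)) -> linear (fun v => \sum_(i <- s) f i v).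
Proof.
move=> lf a x y; rewrite scaler_sumr -big_split; apply: eq_bigr => i _.
exact: lf.
Qed.

Lemma linear_bil1 U V W X (F : V -> W -> X) (f : U -> V) w :
  bilinear_for *:%R *:%R F -> linear f -> linear (fun v => F (f v) w).
Proof. by move=> bF lf a x y; rewrite lf (bF.1 w). Qed.

Lemma linear_bil2 U V W X (F : V -> W -> X) (f : U -> W) w :
  bilinear_for *:%R *:%R F -> linear f -> linear (fun v => F w (f v)).
Proof. by move=> bF lf a x y; rewrite lf (bF.2 w). Qed.

(** Stands for a linear map on a triple tensor product, so that coassociativity can be applied to
    Sweedler expressions without nested tensors. *)
Record trilin U V W X (F : U -> V -> W -> X) : Prop := Trilin {
  trilin1 : forall y z, linear (fun x => F x y z);
  trilin2 : forall x z, linear (fun y => F x y z);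
  trilin3 : forall x y, linear (fun z => F x y z) }.

Lemma bilin U V W (F : U -> V -> W) :
  (forall v, linear (fun u => F u v)) -> (forall u, linear (fun v => F u v)) ->
  bilinear_for *:%R *:%R F.
Proof. by []. Qed.

End Linearity.

Local Notation bil F := (bilinear_for *:%R *:%R F).

(** * Tensors: universal property, generators and functoriality *)

Section TensorTheory.
Variable C : numClosedFieldType.
Implicit Types U V W X Y : lmodType C.

Lemma eq_tlift V W (U : nmodType) (F G : V -> W -> U) u :
  F =2 G -> tlift F u = tlift G u.
Proof. by move=> FG; apply: eq_bigr => p _; rewrite FG. Qed.

Lemma tlift_linear V W U (F : V -> W -> U) : bil F -> linear (tlift F).
Proof. by move=> bF a u v; rewrite tlift_add// tlift_scale. Qed.

Lemma tlift_tens V W U (F : V -> W -> U) v w : bil F -> tlift F (v ⊗ w) = F v w.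
Proof. by move=> bF; rewrite tlift_pi// /tsum big_seq1. Qed.

Lemma tens_bil V W : bil (fun (v : V) (w : W) => v ⊗ w).
Proof.
apply: bilin => [w|v] a x y; apply: tensor_ext => U F bF;
  by rewrite (tlift_linear bF) !tlift_tens// ?(bF.1 w) ?(bF.2 v).
Qed.

Lemma tensE V W (u : tensor V W) : u = \sum_(p <- repr u) p.1 ⊗ p.2.
Proof.
apply: tensor_ext => U F bF; rewrite (lin_sum _ _ (tlift_linear bF)).
by apply: eq_bigr => p _; rewrite tlift_tens.
Qed.

Lemma tens_ind V W (P : tensor V W -> Prop) :
  P 0 -> (forall v w u, P u -> P (v ⊗ w + u)) -> forall u, P u.
Proof.
move=> P0 PD u; rewrite (tensE u).
by elim: (repr u) => [|p s IH]; rewrite ?big_nil// big_cons; apply: PD.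
Qed.

Lemma tens_linear_ext V W U (f g : tensor V W -> U) :
  linear f -> linear g -> (forall v w, f (v ⊗ w) = g (v ⊗ w)) -> f =1 g.
Proof.
move=> lf lg fg; elim/tens_ind => [|v w u IH]; first by rewrite !lin0.
by rewrite (linD lf) (linD lg) fg IH.
Qed.

Lemma linear_tlift V W U X (F : X -> V -> W -> U) u :
  (forall v w, linear (fun x => F x v w)) -> linear (fun x => tlift (F x) u).
Proof. by move=> lF; apply: linear_sum => p; apply: lF. Qed.

Lemma lin_tlift V W U X (f : U -> X) (F : V -> W -> U) u :
  linear f -> f (tlift F u) = tlift (fun v w => f (F v w)) u.
Proof. exact: lin_sum. Qed.

Lemma tlift_exch V W V' W' (U : nmodType) (F : V -> W -> V' -> W' -> U) u u' :
  tlift (fun v w => tlift (F v w) u') u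
  = tlift (fun v' w' => tlift (fun v w => F v w v' w') u) u'.
Proof. exact: exchange_big. Qed.

Lemma tlift_tmap V W V' W' U (F : V' -> W' -> U) (f : V -> V') (g : W -> W') u :
  bil F -> tlift F (tmap f g u) = tlift (fun v w => F (f v) (g w)) u.
Proof.
move=> bF; rewrite /tmap (lin_tlift _ _ (tlift_linear bF)).
by apply: eq_tlift => v w; rewrite tlift_tens.
Qed.

Lemma tmap_bil V W V' W' (f : V -> V') (g : W -> W') :
  linear f -> linear g -> bil (fun v w => f v ⊗ g w).
Proof.
move=> lf lg; apply: bilin => [w|v].
- exact: (linear_bil1 _ (tens_bil _ _)).
- exact: (linear_bil2 _ (tens_bil _ _)).
Qed.

Lemma tmap_linear V W V' W' (f : V -> V') (g : W -> W') :
  linear f -> linear g -> linear (tmap f g).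
Proof. by move=> lf lg; apply/tlift_linear/tmap_bil. Qed.

Lemma tmap_tens V W V' W' (f : V -> V') (g : W -> W') v w :
  linear f -> linear g -> tmap f g (v ⊗ w) = f v ⊗ g w.
Proof. by move=> lf lg; rewrite /tmap tlift_tens//; apply: tmap_bil. Qed.

Lemma tmap_comp V W V' W' V2 W2 (f : V -> V') (g : W -> W')
    (f' : V' -> V2) (g' : W' -> W2) u :
  linear f' -> linear g' ->
  tmap f' g' (tmap f g u) = tmap (fun v => f' (f v)) (fun w => g' (g w)) u.
Proof. by move=> lf lg; rewrite {1}/tmap tlift_tmap//; apply: tmap_bil. Qed.

Lemma tmap_id V W (u : tensor V W) : tmap id id u = u.
Proof. by rewrite [RHS]tensE. Qed.

Lemma tlift_sum V W U (F : V -> W -> U) (I : Type) (s : seq I) E E' :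
  bil F -> tlift F (\sum_(i <- s) E i ⊗ E' i) = \sum_(i <- s) F (E i) (E' i).
Proof.
move=> bF; rewrite (lin_sum _ _ (tlift_linear bF)).
by apply: eq_bigr => i _; rewrite tlift_tens.
Qed.

Lemma tens0l V W (w : W) : (0 : V) ⊗ w = 0.
Proof. exact: (lin0 ((tens_bil V W).1 w)). Qed.

Lemma tens0r V W (v : V) : v ⊗ (0 : W) = 0.
Proof. exact: (lin0 ((tens_bil V W).2 v)). Qed.

Lemma tensZl V W a (v : V) (w : W) : (a *: v) ⊗ w = a *: (v ⊗ w).
Proof. exact: (linZ ((tens_bil V W).1 w)). Qed.

Lemma tensZr V W a (v : V) (w : W) : v ⊗ (a *: w) = a *: (v ⊗ w).
Proof. exact: (linZ ((tens_bil V W).2 v)). Qed.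

Lemma tassoc_bil V W X (x : X) :
  bil (fun (v : V) (w : W) => v ⊗ (w ⊗ x)).
Proof.
apply: bilin => [w|v]; first exact: (tens_bil _ _).1.
exact: (linear_bil2 _ (tens_bil _ _) ((tens_bil _ _).1 _)).
Qed.

End TensorTheory.

Section ConjugateModule.
Variable C : numClosedFieldType.

(* U with the conjugate scalar multiplication: antilinear maps into U are the
   linear maps into [conjmod U]. *)
Definition conjmod (U : lmodType C) : Type := U.
Variable U : lmodType C.
HB.instance Definition _ := GRing.Zmodule.on (conjmod U).
Definition conjscale (a : C) (u : conjmod U) : conjmod U := a^* *: (u : U).

Fact conjscaleA a b u : conjscale a (conjscale b u) = conjscale (a * b) u.
Proof. by rewrite /conjscale scalerA rmorphM. Qed.
Fact conjscale1 : left_id 1 conjscale.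
Proof. by move=> u; rewrite /conjscale rmorph1 scale1r. Qed.
Fact conjscaleDr : right_distributive conjscale +%R.
Proof. by move=> a u v; rewrite /conjscale scalerDr. Qed.
Fact conjscaleDl u : {morph conjscale^~ u : a b / a + b}.
Proof. by move=> a b; rewrite /conjscale rmorphD scalerDl. Qed.
HB.instance Definition _ := GRing.Zmodule_isLmodule.Build C (conjmod U)
  conjscaleA conjscale1 conjscaleDr conjscaleDl.

End ConjugateModule.

Section Antilinear.
Variable C : numClosedFieldType.
Implicit Types U V W X Y : lmodType C.

Lemma antilinear_comp U V W (g : V -> conjmod W) (f : U -> V) :
  linear g -> linear f -> linear (fun v => g (f v) : conjmod W).
Proof. exact: linear_comp. Qed.

Lemma linear_conj2 U V W (g : V -> conjmod W) (f : U -> conjmod V) :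
  linear g -> linear f -> linear (fun v => g (f v) : W).
Proof.
move=> lg lf a x y; rewrite lf lg; congr (_ + _).
by rewrite /GRing.scale/= /conjscale conjCK.
Qed.

Lemma linear_conj U V (f : U -> V) :
  linear f -> linear (f : conjmod U -> conjmod V).
Proof. by move=> lf a x y; apply: lf. Qed.

Lemma antilinear_comp' U V W (g : V -> W) (f : U -> conjmod V) :
  linear g -> linear f -> linear (fun v => g (f v) : conjmod W).
Proof. by move=> lg lf; apply: (linear_comp (linear_conj lg) lf). Qed.

Lemma tens_conj_bil V W :
  bil (fun (v : conjmod V) (w : conjmod W) => @tens C V W v w : conjmod (tensor V W)).
Proof.
by apply: bilin => [w|v]; apply: linear_conj;
  [exact: (tens_bil V W).1|exact: (tens_bil V W).2].
Qed.

Lemma tmap_conj_bil V W V' W' (f : V -> conjmod V') (g : W -> conjmod W') :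
  linear f -> linear g ->
  bil (fun v w => @tens C V' W' (f v) (g w) : conjmod (tensor V' W')).
Proof.
move=> lf lg; apply: bilin => [w|v].
- exact: (@linear_bil1 _ _ _ _ _ _ f _ (tens_conj_bil V' W') lf).
- exact: (@linear_bil2 _ _ _ _ _ _ g _ (tens_conj_bil V' W') lg).
Qed.

Lemma tmap_conj_linear V W V' W' (f : V -> conjmod V') (g : W -> conjmod W') :
  linear f -> linear g ->
  linear ((tmap (f : V -> V') (g : W -> W')) : tensor V W -> conjmod (tensor V' W')).
Proof. by move=> lf lg; apply: (tlift_linear (tmap_conj_bil lf lg)). Qed.

Lemma tmap_conj_tens V W V' W' (f : V -> conjmod V') (g : W -> conjmod W') v w :
  linear f -> linear g ->
  tmap (f : V -> V') (g : W -> W') (v ⊗ w) = @tens C V' W' (f v) (g w).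
Proof. by move=> lf lg; apply: (tlift_tens v w (tmap_conj_bil lf lg)). Qed.

Lemma tmap_conj_tmap V W V1 W1 V' W' (f : V1 -> conjmod V') (g : W1 -> conjmod W')
    (h : V -> V1) (k : W -> W1) u :
  linear f -> linear g ->
  tmap (f : V1 -> V') (g : W1 -> W') (tmap h k u)
  = tmap (fun v => f (h v) : V') (fun w => g (k w) : W') u.
Proof.
move=> lf lg; rewrite {2}/tmap (lin_tlift _ _ (tmap_conj_linear lf lg)).
by apply: eq_tlift => v w; apply: tmap_conj_tens.
Qed.

End Antilinear.

Lemma linear_sw2 (C : numClosedFieldType) (V U : lmodType C) (D : hopf_ops V)
    (F : V -> V -> U) :
  is_hopf_star D -> bil F -> linear (sw2 D F).
Proof.
move=> hD bF; apply: (linear_comp (tlift_linear bF)).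
exact: (hopf_comul_linear hD).
Qed.

(** * Sweedler calculus *)

(** Proves linearity, bilinearity or trilinearity of Sweedler expressions by recursion on their
    syntax. Facts about opaque maps are looked up in the context, which is why many proofs first put
    such a fact there; goals that no rule fits are left open. *)
Ltac lin := cbv beta; match goal with
  | |- bilinear_for _ _ _ => apply: bilin => ?; lin
  | H : GRing.linear_for _ ?f |- GRing.linear_for _ ?f => exact H
  | |- GRing.linear_for _ (fun v => v) => exact: linear_id
  | |- GRing.linear_for _ id => exact: linear_id
  | |- GRing.linear_for _ (fun v => @?f v + @?g v) =>
      apply: (@linear_add _ _ _ f g); lin
  | |- GRing.linear_for _ (fun v => ?k *: @?f v) =>
      apply: (@linear_scale _ _ _ f); lin
  | |- GRing.linear_for _ (fun v => @?f v *: ?w) =>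
      apply: (@linear_scalel _ _ _ f); lin
  | |- GRing.linear_for _ (fun v => ?k * @?f v) =>
      apply: (@linear_mulr _ _ f); lin
  | |- GRing.linear_for _ (fun v => @?f v * ?k) =>
      apply: (@linear_mull _ _ f); lin
  | |- GRing.linear_for _ (fun v => bigop _ _ _) => apply: linear_sum => ?; lin
  | |- GRing.linear_for _ (fun v => ?k ⊗ @?f v) =>
      apply: (@linear_bil2 _ _ _ _ _ _ f _ (tens_bil _ _)); lin
  | |- GRing.linear_for _ (fun v => @?f v ⊗ ?k) =>
      apply: (@linear_bil1 _ _ _ _ _ _ f _ (tens_bil _ _)); lin
  | |- GRing.linear_for _ (tens _) => exact: (tens_bil _ _).2
  | |- GRing.linear_for _ (fun v => tlift (@?F v) ?u) =>
      apply: (@linear_tlift _ _ _ _ _ F) => ? ?; lin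
  | |- GRing.linear_for _ (fun v => tlift ?F (@?u v)) =>
      apply: (@linear_comp _ _ _ _ (tlift F) u); [apply: tlift_linear|]; lin
  | |- GRing.linear_for _ (tlift ?F) => apply: tlift_linear; lin
  | |- GRing.linear_for _ (fun v => sw2 ?D (@?F v) ?u) =>
      apply: (@linear_tlift _ _ _ _ _ F) => ? ?; lin
  | |- GRing.linear_for _ (fun v => sw2 ?D ?F (@?u v)) =>
      apply: (@linear_comp _ _ _ _ (sw2 D F) u); [apply: linear_sw2|]; lin
  | |- GRing.linear_for _ (sw2 ?D ?F) => apply: linear_sw2; lin
  | |- GRing.linear_for _ (tmap ?f ?g) => apply: tmap_linear; lin
  | |- GRing.linear_for _ (fun v => tmap ?f ?g (@?u v)) =>
      apply: (@linear_comp _ _ _ _ (tmap f g) u); [apply: tmap_linear|]; lin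
  | bF : bilinear_for _ _ ?F |- GRing.linear_for _ (fun v => ?F (@?f v) ?w) =>
      apply: (@linear_bil1 _ _ _ _ _ F f w bF); lin
  | bF : bilinear_for _ _ ?F |- GRing.linear_for _ (fun v => ?F ?w (@?f v)) =>
      apply: (@linear_bil2 _ _ _ _ _ F f w bF); lin
  | bF : bilinear_for _ _ ?F |- GRing.linear_for _ (?F ?w) => exact: bF.2
  | hD : is_hopf_star ?D |- GRing.linear_for _ (fun v => hmul ?D (@?f v) ?w) =>
      apply: (@linear_bil1 _ _ _ _ _ _ f w (hopf_mul_bilinear hD)); lin
  | hD : is_hopf_star ?D |- GRing.linear_for _ (fun v => hmul ?D ?w (@?f v)) =>
      apply: (@linear_bil2 _ _ _ _ _ _ f w (hopf_mul_bilinear hD)); lin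
  | hD : is_hopf_star ?D |- GRing.linear_for _ (hmul ?D ?w) =>
      exact: (hopf_mul_bilinear hD).2
  | hD : is_hopf_star ?D |- GRing.linear_for _ (hcounit ?D) =>
      exact: (hopf_counit_linear hD)
  | hD : is_hopf_star ?D |- GRing.linear_for _ (hanti ?D) =>
      exact: (hopf_anti_linear hD)
  | hD : is_hopf_star ?D |- GRing.linear_for _ (hcomul ?D) =>
      exact: (hopf_comul_linear hD)
  | hD : is_hopf_star ?D |- GRing.linear_for _ (fun v => hcounit ?D (@?f v)) =>
      apply: (@linear_comp _ _ _ _ _ f (hopf_counit_linear hD)); lin
  | hD : is_hopf_star ?D |- GRing.linear_for _ (fun v => hanti ?D (@?f v)) =>
      apply: (@linear_comp _ _ _ _ _ f (hopf_anti_linear hD)); lin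
  | hD : is_hopf_star ?D |- GRing.linear_for _ (fun v => hcomul ?D (@?f v)) =>
      apply: (@linear_comp _ _ _ _ _ f (hopf_comul_linear hD)); lin
  | lf : GRing.linear_for _ ?f |- GRing.linear_for _ (fun v => ?f (@?g v)) =>
      apply: (@linear_comp _ _ _ _ f g lf); lin
  | tF : trilin ?F |- GRing.linear_for _ (fun v => ?F (@?g v) ?y ?z) =>
      apply: (@linear_comp _ _ _ _ (fun x => F x y z) g (trilin1 tF y z)); lin
  | tF : trilin ?F |- GRing.linear_for _ (fun v => ?F ?y (@?g v) ?z) =>
      apply: (@linear_comp _ _ _ _ (fun x => F y x z) g (trilin2 tF y z)); lin
  | tF : trilin ?F |- GRing.linear_for _ (fun v => ?F ?y ?z (@?g v)) =>
      apply: (@linear_comp _ _ _ _ (fun x => F y z x) g (trilin3 tF y z)); lin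
  | tF : trilin ?F |- GRing.linear_for _ (?F ?y ?z) => exact: (trilin3 tF y z)
  | |- trilin _ => split=> ? ?; lin
  | _ => try eassumption
  end.

Section Sweedler.
Variable C : numClosedFieldType.
Implicit Types U V W X Y : lmodType C.

Variables (V : lmodType C) (D : hopf_ops V).

Lemma eq_sw2 (U : nmodType) (F G : V -> V -> U) x :
  F =2 G -> sw2 D F x = sw2 D G x.
Proof. exact: eq_tlift. Qed.

Lemma sw2_sum U (F : V -> V -> U) (I : Type) (s : seq I) E E' x :
  bil F -> hcomul D x = \sum_(i <- s) E i ⊗ E' i ->
  sw2 D F x = \sum_(i <- s) F (E i) (E' i).
Proof. by move=> bF dx; rewrite /sw2 dx tlift_sum. Qed.

Lemma lin_sw2 U X (f : U -> X) (F : V -> V -> U) x :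
  linear f -> f (sw2 D F x) = sw2 D (fun v w => f (F v w)) x.
Proof. exact: lin_tlift. Qed.

Hypothesis hD : is_hopf_star D.

Lemma linear_star : linear (hstar D : V -> conjmod V).
Proof. exact: hopf_star_antilinear hD. Qed.

(** A trilinear F induces a linear map on V ⊗ (V ⊗ V), which is applied to both sides of the
    coassociativity axiom. *)
Lemma sw_coassoc U (F : V -> V -> V -> U) x : trilin F ->
  sw2 D (fun y x3 => sw2 D (fun x1 x2 => F x1 x2 x3) y) x
  = sw2 D (fun x1 y => sw2 D (F x1) y) x.
Proof.
move=> tF; pose P (t : tensor V (tensor V V)) := tlift (fun x1 w => tlift (F x1) w) t.
have bP : bil (fun x1 w => tlift (F x1) w) by lin.
have lP : linear P by apply: tlift_linear.
have := congr1 P (hopf_coassoc hD x); rewrite /tassoc tlift_tmap; last first.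
  by apply: bilin => [z|u]; [apply/tlift_linear/tassoc_bil|lin].
rewrite (lin_tlift _ _ lP) {2}/P tlift_tmap//.
set a := tlift _ _; set b := tlift _ _ => ab.
have -> : sw2 D (fun x1 y => sw2 D (F x1) y) x = b by [].
rewrite -ab; apply: eq_tlift => v w.
rewrite (lin_tlift _ _ lP); apply: eq_tlift => v1 v2.
rewrite /P tlift_tens//; rewrite tlift_tens//; lin.
Qed.

Lemma sw_counitl U (G : V -> U) x :
  linear G -> sw2 D (fun x1 x2 => hcounit D x1 *: G x2) x = G x.
Proof.
move=> lG; rewrite -[in RHS](hopf_counitl hD x) (lin_sw2 _ _ lG).
by apply: eq_sw2 => v w; rewrite (linZ lG).
Qed.

Lemma sw_counitr U (G : V -> U) x :
  linear G -> sw2 D (fun x1 x2 => hcounit D x2 *: G x1) x = G x.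
Proof.
move=> lG; rewrite -[in RHS](hopf_counitr hD x) (lin_sw2 _ _ lG).
by apply: eq_sw2 => v w; rewrite (linZ lG).
Qed.

Lemma sw_antil U (G : V -> U) x : linear G ->
  sw2 D (fun x1 x2 => G (hmul D (hanti D x1) x2)) x = hcounit D x *: G (hone D).
Proof. by move=> lG; rewrite -(lin_sw2 _ _ lG) (hopf_antil hD) (linZ lG). Qed.

Lemma sw_antir U (G : V -> U) x : linear G ->
  sw2 D (fun x1 x2 => G (hmul D x1 (hanti D x2))) x = hcounit D x *: G (hone D).
Proof. by move=> lG; rewrite -(lin_sw2 _ _ lG) (hopf_antir hD) (linZ lG). Qed.

Lemma sw_mul U (F : V -> V -> U) x y : bil F ->
  sw2 D F (hmul D x y)
  = sw2 D (fun x1 x2 => sw2 D (fun y1 y2 => F (hmul D x1 y1) (hmul D x2 y2)) y) x.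
Proof.
move=> bF; rewrite /sw2 (hopf_comulM hD) /= (lin_tlift _ _ (tlift_linear bF)).
apply: eq_tlift => v w; rewrite (lin_tlift _ _ (tlift_linear bF)).
by apply: eq_tlift => v' w'; rewrite tlift_tens.
Qed.

Lemma sw_one U (F : V -> V -> U) : bil F -> sw2 D F (hone D) = F (hone D) (hone D).
Proof. by move=> bF; rewrite /sw2 (hopf_comul1 hD) tlift_tens. Qed.

Lemma sw_star U (F : V -> V -> U) x : bil F ->
  sw2 D F (hstar D x) = sw2 D (fun a b => F (hstar D a) (hstar D b)) x.
Proof.
move=> bF; rewrite /sw2 (hopf_comul_star hD) /tmap (lin_tlift _ _ (tlift_linear bF)).
by apply: eq_tlift => v w; rewrite tlift_tens.
Qed.

Lemma sw2_exch W (E : hopf_ops W) (U : nmodType) (F : V -> V -> W -> W -> U) x y :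
  sw2 D (fun a b => sw2 E (F a b) y) x
  = sw2 E (fun a' b' => sw2 D (fun a b => F a b a' b') x) y.
Proof. exact: tlift_exch. Qed.

(** Apply eps to S(x_(1)) x_(2) = eps(x) 1 and absorb eps(x_(2)) by the counit law. *)
Lemma counit_anti x : hcounit D (hanti D x) = hcounit D x.
Proof.
have := congr1 (hcounit D) (hopf_antil hD x).
rewrite (linZ (hopf_counit_linear hD : linear (hcounit D : V -> C^o))).
rewrite (hopf_counit1 hD) (lin_sw2 _ _ (hopf_counit_linear hD : linear (hcounit D : V -> C^o))).
rewrite /GRing.scale/= mulr1 => <-.
rewrite -[LHS](@sw_counitr C^o (fun x => hcounit D (hanti D x))); last by lin.
by apply: eq_sw2 => v w; rewrite (hopf_counitM hD) mulrC.
Qed.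

Lemma star1 : hstar D (hone D) = hone D.
Proof.
have := hopf_starM hD (hone D) (hstar D (hone D)).
by rewrite (hopf_mul1 hD) (hopf_starK hD) (hopf_mul1 hD).
Qed.

End Sweedler.

Arguments lin_sw2 {C V D U X f} F x.
Arguments eq_sw2 {C V D U F G} x.
Arguments sw2_sum {C V D U F I s E E' x}.

Section Coassociativity.
Variables (C : numClosedFieldType) (V : lmodType C) (D : hopf_ops V).
Hypothesis lc : linear (hcomul D).

(** Converse of [sw_coassoc], tested on the universal trilinear map v1 ⊗ (v2 ⊗ v3). Its only input
    is linearity of the coproduct, so that it can serve inside proofs of [is_hopf_star]. *)
Lemma coassocP x :
  (forall (U : lmodType C) (F : V -> V -> V -> U), trilin F ->
     sw2 D (fun y x3 => sw2 D (fun x1 x2 => F x1 x2 x3) y) x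
     = sw2 D (fun x1 y => sw2 D (F x1) y) x) ->
  tassoc (tmap (hcomul D) id (hcomul D x)) = tmap id (hcomul D) (hcomul D x).
Proof.
move=> h; rewrite /tassoc tlift_tmap; last first.
  by apply: bilin => [z|u]; [apply/tlift_linear/tassoc_bil|lin].
have tF : trilin (fun v1 v2 v3 : V => v1 ⊗ (v2 ⊗ v3)) by lin.
transitivity (sw2 D (fun x1 y => sw2 D (fun x2 x3 => x1 ⊗ (x2 ⊗ x3)) y) x).
  exact: (h _ _ tF).
apply: eq_tlift => v w; rewrite [in RHS](tensE (hcomul D w)).
by rewrite (lin_sum _ _ ((tens_bil _ _).2 _)).
Qed.

End Coassociativity.

(** * The antipode as an anti-coalgebra map, and its inverse through the involution *)

Section AntipodeTheory.
Variables (C : numClosedFieldType) (V : lmodType C) (D : hopf_ops V).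
Hypothesis hD : is_hopf_star D.
Implicit Types U : lmodType C.

Let mA := hopf_mulA hD.

(* Both sides are convolution inverse to the coproduct. *)
Lemma sw_anti U (F : V -> V -> U) x : bil F ->
  sw2 D F (hanti D x) = sw2 D (fun x1 x2 => F (hanti D x2) (hanti D x1)) x.
Proof.
move=> bF.
(* [Q] is F applied to (u ⊗ v) times the convolution of the coproduct with its candidate inverse y ↦
   S(y_(2)) ⊗ S(y_(1)); two antipode cancellations give eps(y) F(u, v). With u ⊗ v the coproduct of
   S(x_(1)) and y = x_(2), this is the left side of the lemma, while cancelling u ⊗ v against the
   coproduct of y_(1) instead gives the right side. *)
pose Q u v y := sw2 D (fun y' y'' => sw2 D (fun y1 y2 => sw2 D (fun y3 y4 =>
  F (hmul D u (hmul D y1 (hanti D y4))) (hmul D v (hmul D y2 (hanti D y3)))) y'') y') y.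
have QE u v y : Q u v y = hcounit D y *: F u v.
  rewrite /Q (@sw_coassoc _ _ _ hD _ (fun y1 y2 y'' => sw2 D (fun y3 y4 =>
    F (hmul D u (hmul D y1 (hanti D y4))) (hmul D v (hmul D y2 (hanti D y3)))) y'')); last by lin.
  transitivity (sw2 D (fun y1 w => F (hmul D u (hmul D y1 (hanti D w))) v) y).
    apply: eq_sw2 => y1 w.
    rewrite -(@sw_coassoc _ _ _ hD _ (fun y2 y3 y4 =>
      F (hmul D u (hmul D y1 (hanti D y4))) (hmul D v (hmul D y2 (hanti D y3))))); last by lin.
    rewrite -[RHS](@sw_counitl _ _ _ hD _ (fun w => F (hmul D u (hmul D y1 (hanti D w))) v)); last by lin.
    apply: eq_sw2 => w' y4.
    rewrite (@sw_antir _ _ _ hD _ (fun z => F (hmul D u (hmul D y1 (hanti D y4))) (hmul D v z))); last by lin.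
    by rewrite (hopf_1mul hD).
  rewrite (@sw_antir _ _ _ hD _ (fun z => F (hmul D u z) v)); last by lin.
  by rewrite (hopf_1mul hD).
transitivity (sw2 D (fun x1 y => sw2 D (fun u v => Q u v y) (hanti D x1)) x).
  rewrite -[LHS](@sw_counitr _ _ _ hD _ (fun x => sw2 D F (hanti D x))); last by lin.
  apply: eq_sw2 => x1 y.
  rewrite (lin_sw2 _ _ (@linear_scale _ _ _ _ (hcounit D y) (@linear_id _ _))).
  by apply: eq_sw2 => u v; rewrite QE.
pose G x1 y' y'' := sw2 D (fun u v => sw2 D (fun y1 y2 => sw2 D (fun y3 y4 =>
  F (hmul D u (hmul D y1 (hanti D y4))) (hmul D v (hmul D y2 (hanti D y3)))) y'') y') (hanti D x1).
have tG : trilin G by rewrite /G; lin.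
transitivity (sw2 D (fun x1 y => sw2 D (G x1) y) x).
  by apply: eq_sw2 => x1 y; rewrite /Q (sw2_exch D D).
rewrite -(sw_coassoc hD)//.
rewrite -[RHS](@sw_counitl _ _ _ hD _ (fun x => sw2 D (fun x1 x2 => F (hanti D x2) (hanti D x1)) x)); last by lin.
apply: eq_sw2 => w y''.
pose K z := sw2 D (fun a b => sw2 D (fun y3 y4 => F (hmul D a (hanti D y4)) (hmul D b (hanti D y3))) y'') z.
have lK : linear K by rewrite /K; lin.
transitivity (sw2 D (fun x1 y' => K (hmul D (hanti D x1) y')) w).
  apply: eq_sw2 => x1 y'; rewrite /K sw_mul//; last by lin.
  apply: eq_sw2 => u v; apply: eq_sw2 => y1 y2; apply: eq_sw2 => y3 y4.
  by rewrite !mA.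
rewrite (sw_antil hD)// /K sw_one//; last by lin.
by congr (_ *: _); apply: eq_sw2 => y3 y4; rewrite !(hopf_mul1 hD).
Qed.

Let ls : linear (hstar D : V -> conjmod V) := linear_star hD.

Lemma starZ a x : hstar D (a *: x) = a^* *: hstar D x.
Proof. exact: (linZ ls). Qed.

(** The functional [e] satisfies the left counit law, and a left counit equals a right one: both
    agree with x ↦ e(x_(1)) eps(x_(2)). *)
Lemma counit_star x : hcounit D (hstar D x) = (hcounit D x)^*.
Proof.
pose e x := (hcounit D (hstar D x))^*.
have lc : linear (hcounit D : V -> C^o) by exact: (hopf_counit_linear hD).
have le : linear (e : V -> C^o).
  by move=> a y z; rewrite /e (ls a) (lc _) rmorphD/= rmorphM/= conjCK.
have eE y : sw2 D (fun y1 y2 => e y1 *: y2) y = y.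
  rewrite -[RHS](hopf_starK hD) -[in RHS](hopf_counitl hD (hstar D y)).
  rewrite sw_star//; last by lin.
  rewrite (lin_sw2 _ _ ls); apply: eq_sw2 => y1 y2.
  by rewrite starZ (hopf_starK hD).
suff : e x = hcounit D x by rewrite /e => <-; rewrite conjCK.
rewrite -[in RHS](eE x) (lin_sw2 _ _ lc).
rewrite -[LHS](@sw_counitr _ _ _ hD C^o e)//.
by apply: eq_sw2 => y1 y2; rewrite (linZ lc) /GRing.scale/= mulrC.
Qed.

Let S' x := hstar D (hanti D (hstar D x)).
Let lS' : linear S'.
Proof.
apply: (linear_conj2 ls); apply: (antilinear_comp' _ ls).
exact: (hopf_anti_linear hD).
Qed.

Lemma sw_star_conj U (F : V -> V -> conjmod U) x : bil F ->
  sw2 D (F : V -> V -> U) (hstar D x)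
  = sw2 D (fun a b => F (hstar D a) (hstar D b) : U) x.
Proof. exact: (@sw_star _ _ _ hD (conjmod U)). Qed.

Lemma sw_anti_conj U (F : V -> V -> conjmod U) x : bil F ->
  sw2 D (F : V -> V -> U) (hanti D x)
  = sw2 D (fun x1 x2 => F (hanti D x2) (hanti D x1) : U) x.
Proof. exact: (@sw_anti (conjmod U)). Qed.

Let sw_S' U (F : V -> V -> U) x : bil F ->
  sw2 D F (S' x) = sw2 D (fun x1 x2 => F (S' x2) (S' x1)) x.
Proof.
move=> bF; rewrite /S' sw_star//.
have bF1 : bil (fun a b => F (hstar D a) (hstar D b) : conjmod U).
  apply: bilin => z.
  - exact: (antilinear_comp' (bF.1 _) ls).
  - exact: (antilinear_comp' (bF.2 _) ls).
rewrite (sw_anti_conj _ bF1).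
rewrite (@sw_star_conj U (fun a b => F (hstar D (hanti D b)) (hstar D (hanti D a))))//.
have la := hopf_anti_linear hD.
apply: bilin => z.
- exact: (linear_comp (bF1.2 _) la).
- exact: (linear_comp (bF1.1 _) la).
Qed.

(* S' reverses the coproduct and satisfies S'(x_(2)) x_(1) = eps(x), so that
   S(S'(x)) = S(S'(x_(3))) S'(x_(2)) x_(1) = x. *)
Lemma anti_starK x : hanti D (S' x) = x.
Proof.
have S'r y : sw2 D (fun x1 x2 => hmul D (S' x2) x1) y = hcounit D y *: hone D.
  rewrite -[RHS](hopf_starK hD) starZ (star1 hD) -counit_star -(hopf_antir hD).
  rewrite (sw_star hD); last by lin.
  rewrite (lin_sw2 _ _ ls); apply: eq_sw2 => y1 y2.
  by rewrite (hopf_starM hD) (hopf_starK hD).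
rewrite -[LHS](@sw_counitl _ _ _ hD _ (fun x => hanti D (S' x))); last by lin.
transitivity (sw2 D (fun x1 w => sw2 D (fun x2 x3 =>
    hmul D (hanti D (S' x3)) (hmul D (S' x2) x1)) w) x); last first.
  rewrite -[RHS](hopf_counitr hD); apply: eq_sw2 => x1 w.
  pose F a b := hmul D (hanti D a) (hmul D b x1).
  have bF : bil F by rewrite /F; lin.
  rewrite -(sw_S' _ bF) /F.
  transitivity (sw2 D (fun a b => hmul D (hmul D (hanti D a) b) x1) (S' w)).
    by apply: eq_sw2 => a b; rewrite mA.
  rewrite (@sw_antil _ _ _ hD _ (fun z => hmul D z x1)); last by lin.
  rewrite (hopf_mul1 hD); congr (_ *: _).
  by rewrite /S' counit_star counit_anti// counit_star conjCK.
rewrite -(@sw_coassoc _ _ _ hD _ (fun x1 x2 x3 =>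
  hmul D (hanti D (S' x3)) (hmul D (S' x2) x1))); last by lin.
apply: eq_sw2 => w x3.
rewrite -(lin_sw2 _ _ ((hopf_mul_bilinear hD).2 _)) S'r.
by rewrite (linZ ((hopf_mul_bilinear hD).2 _)) (hopf_1mul hD).
Qed.

Lemma star_antiK x : hstar D (hanti D (hstar D (hanti D x))) = x.
Proof.
by have := anti_starK (hstar D x); rewrite /S' (hopf_starK hD) => ->; rewrite (hopf_starK hD).
Qed.

(** [anti_starK] provides a preimage under the antipode and [star_antiK] makes it unique, so the
    choice in [inv_anti] is forced. *)
Lemma inv_antiE x : inv_anti D x = hstar D (hanti D (hstar D x)).
Proof.
rewrite /inv_anti; case: xgetP => [y _ /= Sy|/(_ (S' x))]; last by rewrite /= anti_starK.
by rewrite -Sy star_antiK.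
Qed.

End AntipodeTheory.

(** * Pullbacks and tensor products of Hopf *-algebras *)

Section TensorMul.
Variable C : numClosedFieldType.
Variables (V W : lmodType C) (D : hopf_ops V) (E : hopf_ops W).
Hypotheses (bD : bil (hmul D)) (bE : bil (hmul E)).

Let bF x y : bil (fun x' y' => hmul D x x' ⊗ hmul E y y').
Proof. by lin. Qed.

Let bG v : bil (fun x y => tlift (fun x' y' => hmul D x x' ⊗ hmul E y y') v).
Proof. by lin. Qed.

Lemma tensor_mul_bil : bil (hmul (tensor_ops D E)).
Proof. by rewrite /=; lin. Qed.

Lemma tensor_mulE x y x' y' :
  hmul (tensor_ops D E) (x ⊗ y) (x' ⊗ y') = hmul D x x' ⊗ hmul E y y'.
Proof. by rewrite /= !tlift_tens. Qed.

End TensorMul.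

Lemma tensor_mul_tmap (C : numClosedFieldType) (V W V' W' : lmodType C)
    (D : hopf_ops V) (E : hopf_ops W) (D' : hopf_ops V') (E' : hopf_ops W')
    (f : V -> V') (g : W -> W') u v :
  bil (hmul D') -> bil (hmul E') -> linear f -> linear g ->
  (forall x y, f (hmul D x y) = hmul D' (f x) (f y)) ->
  (forall x y, g (hmul E x y) = hmul E' (g x) (g y)) ->
  tmap f g (hmul (tensor_ops D E) u v)
  = hmul (tensor_ops D' E') (tmap f g u) (tmap f g v).
Proof.
move=> bD bE lf lg fM gM; have lfg := tmap_linear lf lg.
rewrite /= tlift_tmap; last by lin.
rewrite (lin_tlift _ _ lfg); apply: eq_tlift => x y.
rewrite tlift_tmap; last by lin.
rewrite (lin_tlift _ _ lfg); apply: eq_tlift => x' y'.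
by rewrite tmap_tens// fM gM.
Qed.

Section Pullback.
Variables (C : numClosedFieldType) (V W : lmodType C).
Variables (D : hopf_ops V) (E : hopf_ops W) (i : V -> W) (r : W -> V).
Hypotheses (li : linear i) (lr : linear r) (iK : cancel i r).
Hypothesis hE : is_hopf_star E.
Hypothesis iM : forall x y, i (hmul D x y) = hmul E (i x) (i y).
Hypothesis i1 : i (hone D) = hone E.
Hypothesis i_comul : forall x, hcomul E (i x) = tmap i i (hcomul D x).
Hypothesis i_counit : forall x, hcounit E (i x) = hcounit D x.
Hypothesis i_anti : forall x, i (hanti D x) = hanti E (i x).
Hypothesis i_star : forall x, i (hstar D x) = hstar E (i x).

Implicit Types U : lmodType C.

Let ii : injective i := can_inj iK.
Let liK : cancel (tmap i i) (tmap r r).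
Proof.
move=> u; rewrite tmap_comp//.
rewrite -[RHS]tmap_id; apply: eq_tlift => x y; by rewrite !iK.
Qed.
Let bE := hopf_mul_bilinear hE.

Let sw_i U (F : W -> W -> U) x : bil F ->
  sw2 E F (i x) = sw2 D (fun a b => F (i a) (i b)) x.
Proof. by move=> bF; rewrite /sw2 i_comul tlift_tmap. Qed.

(** Each axiom is checked after applying i or i ⊗ i. The linear retraction r makes i ⊗ i injective
    and, by precomposition, turns a trilinear test map on V into one on W, which yields
    coassociativity. *)
Lemma is_hopf_star_pullback : is_hopf_star D.
Proof.
have bD : bil (hmul D).
  by apply: bilin => z a x y; apply: ii; rewrite li !iM li ?(bE.1 _ a) ?(bE.2 _ a).
have lc : linear (hcomul D).
  move=> a x y; apply: (can_inj liK); rewrite (tmap_linear li li) -!i_comul li.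
  exact: (hopf_comul_linear hE).
have le : scalar (hcounit D).
  by move=> a x y; rewrite -!i_counit li (hopf_counit_linear hE).
have la : linear (hanti D).
  by move=> a x y; apply: ii; rewrite li !i_anti li (hopf_anti_linear hE).
have lE := hopf_counit_linear hE : linear (hcounit E : W -> C^o).
split => //.
- by move=> x y z; apply: ii; rewrite !iM (hopf_mulA hE).
- by move=> x; apply: ii; rewrite !iM i1 (hopf_mul1 hE).
- by move=> x; apply: ii; rewrite !iM i1 (hopf_1mul hE).
- move=> x; apply: coassocP => // U F tF.
  have tF' : trilin (fun a b c => F (r a) (r b) (r c)) by lin.
  transitivity (sw2 E (fun y c => sw2 E (fun a b => F (r a) (r b) (r c)) y) (i x)).
    rewrite sw_i; last by lin.
    apply: eq_sw2 => y z; rewrite sw_i; last by lin.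
    by apply: eq_sw2 => x1 x2; rewrite !iK.
  rewrite (sw_coassoc hE _ tF') sw_i; last by lin.
  apply: eq_sw2 => y z; rewrite sw_i; last by lin.
  by apply: eq_sw2 => x1 x2; rewrite !iK.
- move=> x; apply: ii; rewrite (lin_sw2 _ _ li) -[RHS](hopf_counitl hE (i x)).
  rewrite sw_i; last by lin.
  by apply: eq_sw2 => y z; rewrite (linZ li) i_counit.
- move=> x; apply: ii; rewrite (lin_sw2 _ _ li) -[RHS](hopf_counitr hE (i x)).
  rewrite sw_i; last by lin.
  by apply: eq_sw2 => y z; rewrite (linZ li) i_counit.
- move=> x y; apply: (can_inj liK); rewrite -i_comul iM (hopf_comulM hE) !i_comul.
  by rewrite -(tensor_mul_tmap _ _ bE bE li li iM iM).
- by apply: (can_inj liK); rewrite -i_comul i1 (hopf_comul1 hE) tmap_tens// i1.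
- by move=> x y; rewrite -!i_counit iM (hopf_counitM hE).
- by rewrite -i_counit i1 (hopf_counit1 hE).
- move=> x; apply: ii; rewrite (lin_sw2 _ _ li) (linZ li) i1 -i_counit.
  rewrite -(hopf_antil hE) sw_i; last by lin.
  by apply: eq_sw2 => y z; rewrite iM i_anti.
- move=> x; apply: ii; rewrite (lin_sw2 _ _ li) (linZ li) i1 -i_counit.
  rewrite -(hopf_antir hE) sw_i; last by lin.
  by apply: eq_sw2 => y z; rewrite iM i_anti.
- by move=> a x y; apply: ii; rewrite li !i_star li (hopf_star_antilinear hE).
- by move=> x; apply: ii; rewrite !i_star (hopf_starK hE).
- by move=> x y; apply: ii; rewrite i_star !iM (hopf_starM hE) !i_star.
- move=> x; apply: (can_inj liK); rewrite -i_comul i_star (hopf_comul_star hE) i_comul.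
  have lsE := linear_star hE.
  rewrite (tmap_comp _ _ _ li li) (tmap_conj_tmap _ _ _ lsE lsE).
  by apply: eq_tlift => a b; rewrite !i_star.
Qed.

End Pullback.

Section TensorHopf.
Variables (C : numClosedFieldType) (V W : lmodType C).
Variables (D : hopf_ops V) (E : hopf_ops W).
Hypotheses (hD : is_hopf_star D) (hE : is_hopf_star E).
Implicit Types U : lmodType C.

Local Notation T := (tensor_ops D E).
Let bD := hopf_mul_bilinear hD.
Let bE := hopf_mul_bilinear hE.
Let bT : bil (hmul T) := tensor_mul_bil bD bE.

Lemma tensor_comul_bil :
  bil (fun x y => sw2 D (fun x1 x2 => sw2 E (fun y1 y2 => (x1 ⊗ y1) ⊗ (x2 ⊗ y2)) y) x).
Proof. by lin. Qed.

Lemma tensor_comul_linear : linear (hcomul T).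
Proof. exact: tlift_linear tensor_comul_bil. Qed.

Lemma tensor_comulE x y : hcomul T (x ⊗ y)
  = sw2 D (fun x1 x2 => sw2 E (fun y1 y2 => (x1 ⊗ y1) ⊗ (x2 ⊗ y2)) y) x.
Proof. exact: tlift_tens tensor_comul_bil. Qed.

Lemma sw2_tensor U (F : tensor V W -> tensor V W -> U) x y : bil F ->
  sw2 T F (x ⊗ y)
  = sw2 D (fun x1 x2 => sw2 E (fun y1 y2 => F (x1 ⊗ y1) (x2 ⊗ y2)) y) x.
Proof.
move=> bF; rewrite {1}/sw2 tensor_comulE (lin_sw2 _ _ (tlift_linear bF)).
apply: eq_sw2 => x1 x2; rewrite (lin_sw2 _ _ (tlift_linear bF)).
by apply: eq_sw2 => y1 y2; rewrite tlift_tens.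
Qed.

Let counit_bil : bil (fun x y => hcounit D x * hcounit E y : C^o).
Proof. by lin. Qed.

Lemma tensor_counit_scalar : scalar (hcounit T).
Proof. exact: (tlift_linear counit_bil). Qed.

Lemma tensor_counitE x y : hcounit T (x ⊗ y) = hcounit D x * hcounit E y.
Proof. exact: (tlift_tens x y counit_bil). Qed.

Lemma tensor_anti_linear : linear (hanti T).
Proof. exact: (tmap_linear (hopf_anti_linear hD) (hopf_anti_linear hE)). Qed.

Lemma tensor_antiE x y : hanti T (x ⊗ y) = hanti D x ⊗ hanti E y.
Proof. exact: (tmap_tens _ _ (hopf_anti_linear hD) (hopf_anti_linear hE)). Qed.

Lemma tensor_star_antilinear : linear (hstar T : tensor V W -> conjmod (tensor V W)).
Proof. exact: (tmap_conj_linear (linear_star hD) (linear_star hE)). Qed.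

Lemma tensor_starE x y : hstar T (x ⊗ y) = hstar D x ⊗ hstar E y.
Proof. exact: (tmap_conj_tens _ _ (linear_star hD) (linear_star hE)). Qed.

Let linear_sw2T U (F : tensor V W -> tensor V W -> U) : bil F -> linear (sw2 T F).
Proof.
by move=> bF; apply: (linear_comp (tlift_linear bF)); apply: tensor_comul_linear.
Qed.

Let tensor_mulMul x y x' y' : hmul T (x ⊗ y) (x' ⊗ y') = hmul D x x' ⊗ hmul E y y'.
Proof. exact: tensor_mulE. Qed.

Lemma tensor_is_hopf_star : is_hopf_star T.
Proof.
have lT := tensor_comul_linear.
have le : linear (hcounit T : tensor V W -> C^o) := tensor_counit_scalar.
have la := tensor_anti_linear.
have ls := tensor_star_antilinear.
have h1D := hopf_mul1 hD; have hD1 := hopf_1mul hD.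
have h1E := hopf_mul1 hE; have hE1 := hopf_1mul hE.
split => //.
- move=> u v w; move: u; apply: tens_linear_ext; [lin|lin|move=> x y].
  move: v; apply: tens_linear_ext; [lin|lin|move=> x' y'].
  move: w; apply: tens_linear_ext; [lin|lin|move=> x2 y2].
  by rewrite !tensor_mulMul (hopf_mulA hD) (hopf_mulA hE).
- apply: tens_linear_ext; [lin|lin|move=> x y].
  by rewrite [hone T]/= tensor_mulMul h1D h1E.
- apply: tens_linear_ext; [lin|lin|move=> x y].
  by rewrite [hone T]/= tensor_mulMul hD1 hE1.
- move=> u; apply: coassocP => // U F tF; move: u.
  apply: tens_linear_ext.
  + by apply: linear_sw2T; apply: bilin => z; [apply: linear_sw2T|]; lin.
  + by apply: linear_sw2T; apply: bilin => z; [|apply: linear_sw2T]; lin.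
  move=> x y.
  (* The intermediate expression is bracketed to the left in D and already to the right in E:
     coassociativity is used in one factor at a time. *)
  transitivity (sw2 D (fun x' x3 => sw2 D (fun x1 x2 => sw2 E (fun y1 y' =>
    sw2 E (fun y2 y3 => F (x1 ⊗ y1) (x2 ⊗ y2) (x3 ⊗ y3)) y') y) x') x).
    rewrite sw2_tensor; last by apply: bilin => z; [apply: linear_sw2T|]; lin.
    apply: eq_sw2 => x' x3.
    transitivity (sw2 E (fun y' y3 => sw2 D (fun x1 x2 => sw2 E (fun y1 y2 =>
      F (x1 ⊗ y1) (x2 ⊗ y2) (x3 ⊗ y3)) y') x') y).
      by apply: eq_sw2 => y' y3; rewrite sw2_tensor//; lin.
    rewrite (sw2_exch E D); apply: eq_sw2 => x1 x2.
    by rewrite (@sw_coassoc _ _ _ hE _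
      (fun y1 y2 y3 => F (x1 ⊗ y1) (x2 ⊗ y2) (x3 ⊗ y3)))//; lin.
  rewrite (@sw_coassoc _ _ _ hD _ (fun x1 x2 x3 => sw2 E (fun y1 y' =>
    sw2 E (fun y2 y3 => F (x1 ⊗ y1) (x2 ⊗ y2) (x3 ⊗ y3)) y') y)); last by lin.
  rewrite sw2_tensor; last by apply: bilin => z; [|apply: linear_sw2T]; lin.
  apply: eq_sw2 => x1 x'; rewrite (sw2_exch D E); apply: eq_sw2 => y1 y'.
  by rewrite sw2_tensor//; lin.
- apply: tens_linear_ext; [apply: linear_sw2T; lin|lin|move=> x y].
  rewrite sw2_tensor; last by lin.
  transitivity (sw2 D (fun x1 x2 => hcounit D x1 *: (x2 ⊗ y)) x); last first.
    by rewrite (sw_counitl hD)//; lin.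
  apply: eq_sw2 => x1 x2.
  rewrite -(@sw_counitl _ _ _ hE _ (fun y => x2 ⊗ y)); last by lin.
  rewrite (lin_sw2 _ _ (@linear_scale _ _ _ _ _ (@linear_id _ _))).
  by apply: eq_sw2 => y1 y2; rewrite tensor_counitE scalerA.
- apply: tens_linear_ext; [apply: linear_sw2T; lin|lin|move=> x y].
  rewrite sw2_tensor; last by lin.
  transitivity (sw2 D (fun x1 x2 => hcounit D x2 *: (x1 ⊗ y)) x); last first.
    by rewrite (sw_counitr hD)//; lin.
  apply: eq_sw2 => x1 x2.
  rewrite -(@sw_counitr _ _ _ hE _ (fun y => x1 ⊗ y)); last by lin.
  rewrite (lin_sw2 _ _ (@linear_scale _ _ _ _ _ (@linear_id _ _))).
  by apply: eq_sw2 => y1 y2; rewrite tensor_counitE scalerA.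
- have bTT := tensor_mul_bil bT bT.
  move=> u v; move: u; apply: tens_linear_ext; [lin|lin|move=> x y].
  move: v; apply: tens_linear_ext; [lin|lin|move=> x' y'].
  rewrite tensor_mulMul !tensor_comulE -/(sw2 D _ _).
  rewrite (sw_mul hD); last by lin.
  rewrite (lin_sw2 _ _ (bTT.1 _)); apply: eq_sw2 => x1 x2.
  rewrite (lin_sw2 _ _ (bTT.1 _)).
  transitivity (sw2 D (fun x1' x2' => sw2 E (fun y1 y2 => sw2 E (fun y1' y2' =>
    (hmul D x1 x1' ⊗ hmul E y1 y1') ⊗ (hmul D x2 x2' ⊗ hmul E y2 y2')) y') y) x').
    by apply: eq_sw2 => x1' x2'; rewrite (sw_mul hE)//; lin.
  rewrite (sw2_exch D E); apply: eq_sw2 => y1 y2.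
  rewrite (lin_sw2 _ _ (bTT.2 _)); apply: eq_sw2 => x1' x2'.
  rewrite (lin_sw2 _ _ (bTT.2 _)); apply: eq_sw2 => y1' y2'.
  by rewrite (tensor_mulE bT bT) !tensor_mulMul.
- rewrite [hone T]/= tensor_comulE (sw_one hD); last by lin.
  by rewrite (sw_one hE); last by lin.
- move=> u v; move: u; apply: (tens_linear_ext (U := C^o)); [lin|lin|move=> x y].
  move: v; apply: (tens_linear_ext (U := C^o)); [lin|lin|move=> x' y'].
  by rewrite tensor_mulMul !tensor_counitE (hopf_counitM hD) (hopf_counitM hE) mulrACA.
- by rewrite [hone T]/= tensor_counitE (hopf_counit1 hD) (hopf_counit1 hE) mulr1.
- apply: tens_linear_ext; [apply: linear_sw2T; lin|lin|move=> x y].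
  rewrite sw2_tensor; last by lin.
  transitivity (sw2 D (fun x1 x2 => hmul D (hanti D x1) x2 ⊗ (hcounit E y *: hone E)) x).
    apply: eq_sw2 => x1 x2.
    rewrite -(@sw_antil _ _ _ hE _ (fun z => z)); last by lin.
    rewrite (lin_sw2 _ _ ((tens_bil _ _).2 _)).
    by apply: eq_sw2 => y1 y2; rewrite tensor_antiE tensor_mulMul.
  rewrite -(lin_sw2 _ _ ((tens_bil _ _).1 _)) (hopf_antil hD) tensZl tensZr scalerA.
  by rewrite tensor_counitE.
- apply: tens_linear_ext; [apply: linear_sw2T; lin|lin|move=> x y].
  rewrite sw2_tensor; last by lin.
  transitivity (sw2 D (fun x1 x2 => hmul D x1 (hanti D x2) ⊗ (hcounit E y *: hone E)) x).
    apply: eq_sw2 => x1 x2.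
    rewrite -(@sw_antir _ _ _ hE _ (fun z => z)); last by lin.
    rewrite (lin_sw2 _ _ ((tens_bil _ _).2 _)).
    by apply: eq_sw2 => y1 y2; rewrite tensor_antiE tensor_mulMul.
  rewrite -(lin_sw2 _ _ ((tens_bil _ _).1 _)) (hopf_antir hD) tensZl tensZr scalerA.
  by rewrite tensor_counitE.
- apply: tens_linear_ext; [exact: (linear_conj2 ls ls)|lin|move=> x y].
  by rewrite !tensor_starE (hopf_starK hD) (hopf_starK hE).
- move=> u v; move: u; apply: (tens_linear_ext (U := conjmod _)).
  + exact: (antilinear_comp ls (bT.1 _)).
  + exact: (antilinear_comp' (bT.2 _) ls).
  move=> x y; move: v; apply: (tens_linear_ext (U := conjmod _)).
  + exact: (antilinear_comp ls (bT.2 _)).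
  + exact: (antilinear_comp' (bT.1 _) ls).
  move=> x' y'; rewrite tensor_mulMul !tensor_starE tensor_mulMul.
  by rewrite (hopf_starM hD) (hopf_starM hE).
- apply: (tens_linear_ext (U := conjmod _)).
  + exact: (antilinear_comp' lT ls).
  + exact: (antilinear_comp (tmap_conj_linear ls ls) lT).
  move=> x y; rewrite tensor_starE !tensor_comulE.
  rewrite (sw_star hD); last by lin.
  have l2 := tmap_conj_linear ls ls.
  rewrite (lin_sw2 _ _ l2); apply: eq_sw2 => x1 x2.
  rewrite (sw_star hE); last by lin.
  rewrite (lin_sw2 _ _ l2); apply: eq_sw2 => y1 y2.
  by rewrite (tmap_conj_tens _ _ ls ls) !tensor_starE.
Qed.

End TensorHopf.

(** * Twisting a bigraded Hopf *-algebra by a bicharacter *)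

Section Bigraded.
Variables (C : numClosedFieldType) (L : lmodType C) (D : hopf_ops L).
Variables (G : groupType) (h : G -> G -> L -> Prop).

(* [h p q x] reads: x is homogeneous of bidegree (p, q).  Directness of the sum
   of the homogeneous subspaces is never needed. *)
Record bigraded : Prop := Bigraded {
  bg_ind : forall P : L -> Prop, P 0 ->
    (forall p q x y, h p q x -> P y -> P (x + y)) -> forall x, P x;
  bg_comul : forall p q x, h p q x -> exists s : seq (G * L * L),
    (forall t, t \in s -> h p t.1.1 t.1.2 /\ h t.1.1 q t.2)
    /\ hcomul D x = \sum_(t <- s) t.1.2 ⊗ t.2;
  bg_one : h 1%g 1%g (hone D);
  bg_mul : forall p q x p' q' y, h p q x -> h p' q' y ->
    h (p * p')%g (q * q')%g (hmul D x y);
  bg_star : forall p q x, h p q x -> h p^-1%g q^-1%g (hstar D x);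
  bg_anti : forall p q x, h p q x -> h q^-1%g p^-1%g (hanti D x);
  bg_counit : forall p q x, h p q x -> p != q -> hcounit D x = 0 }.

Hypothesis hD : is_hopf_star D.
Hypothesis bg : bigraded.
Implicit Types U : lmodType C.

Lemma bg_ext U (f g : L -> U) : linear f -> linear g ->
  (forall p q x, h p q x -> f x = g x) -> f =1 g.
Proof.
move=> lf lg fg; apply: (bg_ind bg); first by rewrite !lin0.
by move=> p q x y hx fgy; rewrite (linD lf) (linD lg) fgy (fg p q x).
Qed.

Lemma bg_sw2 U (F F' : L -> L -> U) p q x : bil F -> bil F' -> h p q x ->
  (forall d y z, h p d y -> h d q z -> F y z = F' y z) ->
  sw2 D F x = sw2 D F' x.
Proof.
move=> bF bF' /(bg_comul bg)[s [hs dx]] FF'.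
rewrite (sw2_sum bF dx) (sw2_sum bF' dx).
by apply: eq_big_seq => t /hs[ht1 ht2]; apply: FF' ht1 ht2.
Qed.

Lemma bg_sw3 U (F F' : L -> L -> L -> U) p q x : trilin F -> trilin F' -> h p q x ->
  (forall d e y z w, h p d y -> h d e z -> h e q w -> F y z w = F' y z w) ->
  sw3 D F x = sw3 D F' x.
Proof.
move=> tF tF' hx FF'; apply: (bg_sw2 _ _ hx); [lin|lin|].
move=> e y z hy hz; apply: (bg_sw2 _ _ hy); [lin|lin|move=> d y1 y2 hy1 hy2].
exact: FF' hy1 hy2 hz.
Qed.

Lemma sw3_counit U (f : L -> U) a x : linear f ->
  sw3 D (fun x1 x2 x3 => (a * (hcounit D x1 * hcounit D x3)) *: f x2) x = a *: f x.
Proof.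
move=> lf; rewrite /sw3.
rewrite -[RHS](@sw_counitr _ _ _ hD _ (fun x => a *: f x)); last by lin.
apply: eq_sw2 => y x3.
rewrite -(@sw_counitl _ _ _ hD _ (fun x => a *: f x)); last by lin.
rewrite (lin_sw2 _ _ (@linear_scale _ _ _ _ _ (@linear_id _ _))).
by apply: eq_sw2 => x1 x2; rewrite !scalerA; congr (_ *: _); ring.
Qed.

(* Off the diagonal the counit vanishes. *)
Lemma bg_counit_eq (f : G -> C) p q x : h p q x ->
  f p * hcounit D x = f q * hcounit D x.
Proof.
move=> hx; have [->//|pq] := eqVneq p q.
by rewrite (bg_counit bg hx pq) !mulr0.
Qed.

(** * The unitary cocycle defined by a bicharacter on the degrees *)

Variables (J : G -> G -> C) (j : L -> L -> C).
Hypothesis JN : forall p q, `|J p q| = 1.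
Hypothesis JMl : forall p p' q, J (p * p')%g q = J p q * J p' q.
Hypothesis JMr : forall p q q', J p (q * q')%g = J p q * J p q'.
Hypothesis bj : bil (j : L -> L -> C^o).
Hypothesis jE : forall p q x p' q' y, h p q x -> h p' q' y ->
  j x y = J p p' * (hcounit D x * hcounit D y).

Lemma bichar_neq0 p q : J p q != 0.
Proof. by rewrite -normr_eq0 JN oner_neq0. Qed.
Let J0 := bichar_neq0.

Lemma bichar1l q : J 1%g q = 1.
Proof. by apply: (mulfI (J0 1%g q)); rewrite -JMl mulg1 mulr1. Qed.

Lemma bichar1r p : J p 1%g = 1.
Proof. by apply: (mulfI (J0 p 1%g)); rewrite -JMr mulg1 mulr1. Qed.

Lemma bicharVl p q : J p^-1%g q = (J p q)^-1.
Proof. by apply: (mulfI (J0 p q)); rewrite -JMl mulgV bichar1l mulfV. Qed.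

Lemma bicharVr p q : J p q^-1%g = (J p q)^-1.
Proof. by apply: (mulfI (J0 p q)); rewrite -JMr mulgV bichar1r mulfV. Qed.

Lemma bichar_conj p q : (J p q)^* = (J p q)^-1.
Proof. by rewrite invC_norm JN expr1n invr1 mul1r. Qed.

Let e := hcounit D.
Let le : linear (e : L -> C^o) := hopf_counit_linear hD.
Let ls := linear_star hD.
Let lS := hopf_anti_linear hD.
Let bM := hopf_mul_bilinear hD.

(* The inverse of j that unitarity prescribes. *)
Let K x y := (j (hstar D (hanti D x)) (hstar D (hanti D y)))^*.

Let lconj : linear (Num.conj : C^o -> conjmod C^o).
Proof. by move=> a x y; rewrite rmorphD/= rmorphM. Qed.

Let bK : bil (K : L -> L -> C^o).
Proof.
have lsS : linear ((fun x => hstar D (hanti D x)) : L -> conjmod L).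
  exact: antilinear_comp ls lS.
apply: bilin => z.
- apply: (linear_conj2 lconj); exact: (antilinear_comp' (bj.1 _) lsS).
- apply: (linear_conj2 lconj); exact: (antilinear_comp' (bj.2 _) lsS).
Qed.

(** For x of bidegree (p, q), taking S and then the involution gives bidegree (q, p), so the value
    comes out in right degrees. [KE] trades these for left degrees, the counit being zero off the
    diagonal. *)
Let KEr p q x p' q' y : h p q x -> h p' q' y -> K x y = (J q q')^-1 * (e x * e y).
Proof.
move=> hx hy; rewrite /K.
rewrite (jE (bg_star bg (bg_anti bg hx)) (bg_star bg (bg_anti bg hy))).
by rewrite !invgK !(counit_star hD) !(counit_anti hD) rmorphM rmorphM/= !conjCK bichar_conj.
Qed.

Let KE p q x p' q' y : h p q x -> h p' q' y -> K x y = (J p p')^-1 * (e x * e y).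
Proof.
move=> hx hy; rewrite (KEr hx hy) mulrA -(bg_counit_eq (fun q => (J q q')^-1) hx).
by rewrite mulrAC -(bg_counit_eq (fun q' => (J p q')^-1) hy) mulrAC mulrA.
Qed.

(** Convolution by [j] on the left is multiplication by the non-zero scalar J p p'. This verifies
    that [K] is an inverse and also forces every inverse to equal it. *)
Let sw_j1 K2 p q x p' q' y : bil (K2 : L -> L -> C^o) -> h p q x -> h p' q' y ->
  sw2 D (fun x1 x2 => sw2 D (fun y1 y2 => j x1 y1 * K2 x2 y2) y) x = J p p' * K2 x y.
Proof.
move=> bK2 hx hy.
transitivity (sw2 D (fun x1 x2 => e x1 *: (J p p' * K2 x2 y : C^o)) x); last first.
  by rewrite (@sw_counitl _ _ _ hD C^o (fun z => J p p' * K2 z y)) //; lin.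
apply: (bg_sw2 (U := C^o) _ _ hx); [lin|lin|move=> d x1 x2 hx1 hx2].
rewrite -(@sw_counitl _ _ _ hD C^o (fun y => J p p' * K2 x2 y)); last by lin.
rewrite (lin_sw2 _ _ (@linear_scale _ _ _ _ _ (@linear_id _ C^o))).
apply: (bg_sw2 (U := C^o) _ _ hy); [lin|lin|move=> d' y1 y2 hy1 hy2].
by rewrite (jE hx1 hy1) /GRing.scale/= /e; ring.
Qed.

Let KP : conv_inverse2 D j K.
Proof.
have bee y : linear (fun x => e x * e y : C^o) by lin.
move=> x y; split.
- move: x; apply: (bg_ext (U := C^o)); [lin|lin|move=> p q x hx].
  move: y; apply: (bg_ext (U := C^o)); [lin|lin|move=> p' q' y hy].
  by rewrite (sw_j1 bK hx hy) (KE hx hy) mulVKf.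
- move: x; apply: (bg_ext (U := C^o)); [lin|lin|move=> p q x hx].
  move: y; apply: (bg_ext (U := C^o)); [lin|lin|move=> p' q' y hy].
  transitivity (sw2 D (fun x1 x2 => e x1 *: (e x2 * e y : C^o)) x); last first.
    by rewrite (@sw_counitl _ _ _ hD C^o (fun z => e z * e y)) //; lin.
  apply: (bg_sw2 (U := C^o) _ _ hx); [lin|lin|move=> d x1 x2 hx1 hx2].
  rewrite -(@sw_counitl _ _ _ hD C^o (fun y => e x2 * e y)); last by lin.
  rewrite (lin_sw2 _ _ (@linear_scale _ _ _ _ _ (@linear_id _ C^o))).
  apply: (bg_sw2 (U := C^o) _ _ hy); [lin|lin|move=> d' y1 y2 hy1 hy2].
  (* The first legs are read in their right degrees d and d', which are the left degrees of the
     second legs, so the two scalars cancel. *)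
  rewrite (KEr hx1 hy1) (jE hx2 hy2) /GRing.scale/= -/e.
  by have := J0 d d'; move=> ?; field.
Qed.

(** Whatever inverse is chosen, its product with J p p' is eps(x) eps(y) on homogeneous elements,
    and so is that of [K]; the scalar cancels. *)
Lemma conv_inv2_bichar : conv_inv2 D j = K.
Proof.
rewrite /conv_inv2; case: xgetP => [K2 _ [bK2 K2P]|/(_ K)]; last first.
  by case; split => //; exact: KP.
apply/funext => x; apply/funext => y.
move: x; apply: (bg_ext (U := C^o)); [exact: (bK2.1 _)|lin|move=> p q x hx].
move: y; apply: (bg_ext (U := C^o)); [exact: (bK2.2 _)|lin|move=> p' q' y hy].
apply: (mulfI (J0 p p')); rewrite -(sw_j1 (K2 := K2) bK2 hx hy) -(sw_j1 (K2 := K) bK hx hy).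
by rewrite (K2P x y).1 (KP x y).1.
Qed.

(** On homogeneous x, y, z both sides of the cocycle identity equal J(p, p') J(p, p2) J(p', p2)
    times the three counits. *)
Lemma bichar_cocycle : unitary_hopf_cocycle D j.
Proof.
split => //.
- by exists K => //; exact: KP.
- move=> x y z.
  move: x; apply: (bg_ext (U := C^o)); [lin|lin|move=> p q x hx].
  move: y; apply: (bg_ext (U := C^o)); [lin|lin|move=> p' q' y hy].
  move: z; apply: (bg_ext (U := C^o)); [lin|lin|move=> p2 q2 z hz].
  transitivity (J p p' * j (hmul D x y) z).
    transitivity (sw2 D (fun x1 x2 => e x1 *: (J p p' * j (hmul D x2 y) z : C^o)) x);
      last by rewrite (@sw_counitl _ _ _ hD C^o (fun x => J p p' * j (hmul D x y) z))//; lin.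
    apply: (bg_sw2 (U := C^o) _ _ hx); [lin|lin|move=> d x1 x2 hx1 hx2].
    rewrite -(@sw_counitl _ _ _ hD C^o (fun y => J p p' * j (hmul D x2 y) z)); last by lin.
    rewrite (lin_sw2 _ _ (@linear_scale _ _ _ _ _ (@linear_id _ C^o))).
    apply: (bg_sw2 (U := C^o) _ _ hy); [lin|lin|move=> d' y1 y2 hy1 hy2].
    by rewrite (jE hx1 hy1) /GRing.scale/= /e; ring.
  transitivity (J p' p2 * j x (hmul D y z)); last first.
    apply/esym.
    transitivity (sw2 D (fun y1 y2 => e y1 *: (J p' p2 * j x (hmul D y2 z) : C^o)) y);
      last by rewrite (@sw_counitl _ _ _ hD C^o (fun y => J p' p2 * j x (hmul D y z)))//; lin.
    apply: (bg_sw2 (U := C^o) _ _ hy); [lin|lin|move=> d x1 x2 hx1 hx2].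
    rewrite -(@sw_counitl _ _ _ hD C^o (fun z => J p' p2 * j x (hmul D x2 z))); last by lin.
    rewrite (lin_sw2 _ _ (@linear_scale _ _ _ _ _ (@linear_id _ C^o))).
    apply: (bg_sw2 (U := C^o) _ _ hz); [lin|lin|move=> d' y1 y2 hy1 hy2].
    by rewrite (jE hx1 hy1) /GRing.scale/= /e; ring.
  rewrite (jE (bg_mul bg hx hy) hz) (jE hx (bg_mul bg hy hz)) !(hopf_counitM hD) JMl JMr.
  by ring.
- by move=> x y; rewrite conv_inv2_bichar.
Qed.

(** * The twisted operations on homogeneous elements, and the axioms they satisfy *)

Local Notation Tw := (twist_ops D j).

Lemma twist_mul_bil : bil (hmul Tw).
Proof. by rewrite /= conv_inv2_bichar /sw3; lin. Qed.

(** The outer legs give [j] in left degrees and its inverse in right degrees; what remains of them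
    is counits, which [sw3_counit] removes. *)
Lemma twist_mulE p q x p' q' y : h p q x -> h p' q' y ->
  hmul Tw x y = (J p p' / J q q') *: hmul D x y.
Proof.
move=> hx hy; rewrite /= conv_inv2_bichar.
rewrite -(@sw3_counit _ (fun x => hmul D x y)); last by lin.
apply: (bg_sw3 _ _ hx) => [||d f x1 x2 x3 hx1 hx2 hx3].
- by split=> ? ?; rewrite /sw3; lin.
- by split=> ? ?; lin.
rewrite -(@sw3_counit _ (hmul D x2)); last by lin.
apply: (bg_sw3 _ _ hy) => [||d' f' y1 y2 y3 hy1 hy2 hy3].
- by split=> ? ?; lin.
- by split=> ? ?; lin.
rewrite (jE hx1 hy1) (KEr hx3 hy3); congr (_ *: _).
by rewrite -/e; ring.
Qed.

Let u := twist_u D j.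

Let lu : linear (u : L -> C^o).
Proof. by rewrite /u /twist_u; lin. Qed.

(** The leg x_(2) ends in degree q, so S(x_(2)) starts in degree q^-1 and the value is J(p, q)^-1
    eps(x); the counit allows q to be replaced by p. *)
Let uE p q x : h p q x -> u x = (J p p)^-1 * e x.
Proof.
move=> hx; rewrite /u /twist_u.
rewrite (bg_counit_eq (fun q => (J p q)^-1) hx).
rewrite -(@sw_counitl _ _ _ hD C^o (fun x => (J p q)^-1 * e x)); last by lin.
apply: (bg_sw2 (U := C^o) _ _ hx); [lin|lin|move=> d x1 x2 hx1 hx2].
rewrite (jE hx1 (bg_anti bg hx2)) (counit_anti hD) bicharVr /GRing.scale/= -/e.
by ring.
Qed.

(** The inverse of [u]. In general it is J^-1(S(x_(1)), x_(2)), which for a bicharacter is J(x_(1),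
    x_(2)). *)
Let v := sw2 D j.

Let lv : linear (v : L -> C^o).
Proof. by apply: (@linear_sw2 _ _ C^o) hD bj. Qed.

Let vE p q x : h p q x -> v x = J p p * e x.
Proof.
move=> hx; rewrite -(@sw_counitl _ _ _ hD C^o (fun x => J p p * e x)); last by lin.
apply: (bg_sw2 (U := C^o) bj _ hx); [lin|move=> d x1 x2 hx1 hx2].
rewrite (jE hx1 hx2) mulrA -(bg_counit_eq (J p) hx1) /GRing.scale/= -/e.
by ring.
Qed.

Let uEr p q x : h p q x -> u x = (J q q)^-1 * e x.
Proof. by move=> hx; rewrite (uE hx) (bg_counit_eq (fun q => (J q q)^-1) hx). Qed.

Let vEr p q x : h p q x -> v x = J q q * e x.
Proof. by move=> hx; rewrite (vE hx) (bg_counit_eq (fun q => J q q) hx). Qed.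

Let vP : conv_inverse1 D u v.
Proof.
move=> x; split; move: x.
- apply: (bg_ext (U := C^o)); [lin|lin|move=> p q x hx].
  rewrite -[RHS](@sw_counitl _ _ _ hD C^o e)//.
  apply: (bg_sw2 (U := C^o) _ _ hx); [lin|lin|move=> d x1 x2 hx1 hx2].
  by rewrite (uEr hx1) (vE hx2) mulrACA mulVf// mul1r.
- apply: (bg_ext (U := C^o)); [lin|lin|move=> p q x hx].
  rewrite -[RHS](@sw_counitl _ _ _ hD C^o e)//.
  apply: (bg_sw2 (U := C^o) _ _ hx); [lin|lin|move=> d x1 x2 hx1 hx2].
  by rewrite (vEr hx1) (uE hx2) mulrACA mulfV// mul1r.
Qed.

Let sw_u v2 p q x : linear (v2 : L -> C^o) -> h p q x ->
  sw2 D (fun x1 x2 => u x1 * v2 x2) x = (J p p)^-1 * v2 x.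
Proof.
move=> lv2 hx.
rewrite -(@sw_counitl _ _ _ hD C^o (fun x => (J p p)^-1 * v2 x)); last by lin.
apply: (bg_sw2 (U := C^o) _ _ hx); [lin|lin|move=> d x1 x2 hx1 hx2].
by rewrite (uE hx1) /GRing.scale/= -/e; ring.
Qed.

Let conv_inv1_bichar : conv_inv1 D u = v.
Proof.
rewrite /conv_inv1; case: xgetP => [v2 _ [lv2 v2P]|/(_ v)]; last by case.
apply/funext; apply: (bg_ext (U := C^o)); [exact: lv2|lin|move=> p q x hx].
apply: (mulfI (invr_neq0 (J0 p p))); rewrite -!(sw_u _ hx)//.
by rewrite (v2P x).1 (vP x).1.
Qed.

Lemma twist_anti_linear : linear (hanti Tw).
Proof. by rewrite /= /twist_anti conv_inv1_bichar /sw3; lin. Qed.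

Lemma twist_antiE p q x : h p q x ->
  hanti Tw x = (J q q / J p p) *: hanti D x.
Proof.
move=> hx; rewrite /= /twist_anti conv_inv1_bichar.
rewrite -(@sw3_counit _ (hanti D)); last by lin.
apply: (bg_sw3 _ _ hx) => [||d f x1 x2 x3 hx1 hx2 hx3].
- by split=> ? ?; lin.
- by split=> ? ?; lin.
by rewrite -/u (uE hx1) (vEr hx3) -/e; congr (_ *: _); ring.
Qed.

Lemma twist_star_antilinear : linear (hstar Tw : L -> conjmod L).
Proof.
apply: (@antilinear_comp' _ _ _ _ (hanti Tw) (fun x => inv_anti D (hstar D x))).
  exact: twist_anti_linear.
(* Since the inverse antipode is the antipode conjugated by the involution, its value at x^* is the
   star of S(x). *)
have -> : (fun x => inv_anti D (hstar D x)) = (fun x => hstar D (hanti D x)).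
  by apply/funext => x; rewrite (inv_antiE hD) (hopf_starK hD).
exact: antilinear_comp ls lS.
Qed.

(** The star of S(x) has bidegree (q, p), so the factor of the twisted antipode appears inverted,
    and the antipode sends that element to x^*. *)
Lemma twist_starE p q x : h p q x ->
  hstar Tw x = (J p p / J q q) *: hstar D x.
Proof.
move=> hx; rewrite [LHS]/= (inv_antiE hD) (hopf_starK hD).
rewrite [LHS](twist_antiE (bg_star bg (bg_anti bg hx))) !invgK; congr (_ *: _).
by have := anti_starK hD (hstar D x); rewrite (hopf_starK hD).
Qed.

Let bTw := twist_mul_bil.
Let lST := twist_anti_linear.
Let lsT := twist_star_antilinear.

Lemma twist_is_hopf_star : is_hopf_star Tw.
Proof.
have lc := hopf_comul_linear hD.
have h1D := hopf_mul1 hD; have hD1 := hopf_1mul hD.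
have lsTZ a x : hstar Tw (a *: x) = a^* *: hstar Tw x by exact: (linZ lsT).
split => //; try by [exact: (hopf_coassoc hD)|exact: (hopf_counitl hD)
  |exact: (hopf_counitr hD)|exact: (hopf_comul1 hD)|exact: (hopf_counit1 hD)].
- move=> x y z.
  move: x; apply: bg_ext; [lin|lin|move=> p q x hx].
  move: y; apply: bg_ext; [lin|lin|move=> p' q' y hy].
  move: z; apply: bg_ext; [lin|lin|move=> p2 q2 z hz].
  rewrite (twist_mulE hx hy) (twist_mulE hy hz).
  rewrite (linZ (bTw.1 _)) (linZ (bTw.2 _)).
  rewrite (twist_mulE hx (bg_mul bg hy hz)) (twist_mulE (bg_mul bg hx hy) hz).
  rewrite !scalerA (hopf_mulA hD) !JMl !JMr !invfM; congr (_ *: _).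
  by ring.
- apply: bg_ext; [lin|lin|move=> p q x hx].
  by rewrite [hone _]/= (twist_mulE (bg_one bg) hx) !bichar1l divr1 scale1r h1D.
- apply: bg_ext; [lin|lin|move=> p q x hx].
  by rewrite [hone _]/= (twist_mulE hx (bg_one bg)) !bichar1r divr1 scale1r hD1.
- have bTT := tensor_mul_bil bTw bTw.
  move=> x y; rewrite [hcomul _]/=.
  move: x; apply: bg_ext; [lin|lin|move=> p q x hx].
  move: y; apply: bg_ext; [lin|lin|move=> p' q' y hy].
  rewrite (twist_mulE hx hy) (linZ lc) (hopf_comulM hD).
  (* Written as Sweedler sums, the two sides are compared leg by leg: the factors J(p, p') / J(d,
     d') and J(d, d') / J(q, q') telescope at the common middle degrees. *)
  change ((J p p' / J q q') *: sw2 D (fun x1 x2 => sw2 D (fun y1 y2 =>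
      hmul D x1 y1 ⊗ hmul D x2 y2) y) x =
    sw2 D (fun x1 x2 => sw2 D (fun y1 y2 => hmul Tw x1 y1 ⊗ hmul Tw x2 y2) y) x).
  rewrite (lin_sw2 _ _ (@linear_scale _ _ _ _ _ (@linear_id _ _))).
  apply: (bg_sw2 _ _ hx); [lin|lin|move=> d x1 x2 hx1 hx2].
  rewrite (lin_sw2 _ _ (@linear_scale _ _ _ _ _ (@linear_id _ _))).
  apply: (bg_sw2 _ _ hy); [lin|lin|move=> d' y1 y2 hy1 hy2].
  rewrite (twist_mulE hx1 hy1) (twist_mulE hx2 hy2) tensZl tensZr scalerA.
  by congr (_ *: _); rewrite mulrA divfK.
- move=> x y; rewrite [hcounit _]/=.
  move: x; apply: (bg_ext (U := C^o)); [lin|lin|move=> p q x hx].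
  move: y; apply: (bg_ext (U := C^o)); [lin|lin|move=> p' q' y hy].
  rewrite (twist_mulE hx hy) -/e (linZ le) {1}/e (hopf_counitM hD) /GRing.scale/=.
  rewrite mulrAC (_ : J p p' * _ = J q q' * (e x * e y)); last first.
    rewrite -/e mulrA (bg_counit_eq (fun p => J p p') hx) -/e.
    by rewrite mulrAC (bg_counit_eq (J q) hy) -/e mulrAC mulrA.
  by rewrite mulrAC mulfV// mul1r.
- change (forall x, sw2 D (fun x1 x2 => hmul Tw (hanti Tw x1) x2) x = e x *: hone D).
  apply: bg_ext; [lin|lin|move=> p q x hx].
  (* The twisted antipode contributes J(d, d) / J(p, p) and the twisted product J(d^-1, d) / J(p^-1,
     q). The middle degree d cancels, and the remaining scalar becomes 1 against eps(x). *)
  transitivity (sw2 D (fun x1 x2 => (J p q / J p p) *: hmul D (hanti D x1) x2) x).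
    apply: (bg_sw2 _ _ hx); [lin|lin|move=> d x1 x2 hx1 hx2].
    rewrite (twist_antiE hx1) (linZ (bTw.1 _)) (twist_mulE (bg_anti bg hx1) hx2) scalerA.
    by rewrite !bicharVl; congr (_ *: _); have := J0 d d; have := J0 p q; have := J0 p p;
      move=> *; field; repeat (apply/andP; split).
  rewrite -(lin_sw2 _ _ (@linear_scale _ _ _ _ _ (@linear_id _ _))) (hopf_antil hD).
  rewrite scalerA -/e -(bg_counit_eq (fun q => J p q / J p p) hx) -/e.
  by rewrite mulfV// mul1r.
- change (forall x, sw2 D (fun x1 x2 => hmul Tw x1 (hanti Tw x2)) x = e x *: hone D).
  apply: bg_ext; [lin|lin|move=> p q x hx].
  transitivity (sw2 D (fun x1 x2 => (J q q / J p q) *: hmul D x1 (hanti D x2)) x).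
    apply: (bg_sw2 _ _ hx); [lin|lin|move=> d x1 x2 hx1 hx2].
    rewrite (twist_antiE hx2) (linZ (bTw.2 _)) (twist_mulE hx1 (bg_anti bg hx2)) scalerA.
    by rewrite !bicharVr; congr (_ *: _); have := J0 d d; have := J0 p q; have := J0 q q;
      move=> *; field; repeat (apply/andP; split).
  rewrite -(lin_sw2 _ _ (@linear_scale _ _ _ _ _ (@linear_id _ _))) (hopf_antir hD).
  rewrite scalerA -/e (bg_counit_eq (fun p => J q q / J p q) hx) -/e.
  by rewrite mulfV// mul1r.
- apply: bg_ext; [exact: (linear_conj2 lsT lsT)|lin|move=> p q x hx].
  rewrite (twist_starE hx) lsTZ.
  rewrite (twist_starE (bg_star bg hx)) scalerA (hopf_starK hD) !bicharVl !bicharVr !invrK.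
  by rewrite rmorphM fmorphV/= !bichar_conj -invfM mulVf ?scale1r// mulf_neq0// invr_neq0.
- move=> x y.
  move: x; apply: (bg_ext (U := conjmod L));
    [exact: antilinear_comp lsT (bTw.1 _)|exact: antilinear_comp' (bTw.2 _) lsT|].
  move=> p q x hx.
  move: y; apply: (bg_ext (U := conjmod L));
    [exact: antilinear_comp lsT (bTw.2 _)|exact: antilinear_comp' (bTw.1 _) lsT|].
  move=> p' q' y hy.
  have [sx sy] := (bg_star bg hx, bg_star bg hy).
  rewrite (twist_mulE hx hy) lsTZ.
  rewrite [in LHS](twist_starE (bg_mul bg hx hy)) (twist_starE hx) (twist_starE hy).
  rewrite (linZ (bTw.1 _)) (linZ (bTw.2 _)) (twist_mulE sy sx) !scalerA (hopf_starM hD).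
  rewrite !bicharVl !bicharVr !invrK rmorphM fmorphV/= !bichar_conj !JMl !JMr.
  apply: (congr1 (fun c : C => c *: (hmul D (hstar D y) (hstar D x) : L))).
  have := J0 p p; have := J0 q q; have := J0 p' p'; have := J0 q' q'.
  have := J0 p p'; have := J0 q q'; have := J0 p' p; have := J0 q' q.
  move=> *; field.
  by repeat (apply/andP; split).
- move=> x; rewrite [hcomul _]/=.
  move: x; apply: (bg_ext (U := conjmod _)).
  + exact: (antilinear_comp' lc lsT).
  + exact: (antilinear_comp (tmap_conj_linear lsT lsT) lc).
  move=> p q x hx; rewrite (twist_starE hx) (linZ lc) (hopf_comul_star hD).
  change ((J p p / J q q) *: sw2 D (fun x1 x2 => hstar D x1 ⊗ hstar D x2) x =
    sw2 D (fun x1 x2 => hstar Tw x1 ⊗ hstar Tw x2) x).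
  rewrite (lin_sw2 _ _ (@linear_scale _ _ _ _ _ (@linear_id _ _))).
  have bss := tmap_conj_bil ls ls.
  apply: (bg_sw2 (U := conjmod _) _ _ hx).
  + by apply: bilin => z; apply: antilinear_comp' (@linear_scale _ _ _ _ _ (@linear_id _ _)) _;
      [exact: bss.1|exact: bss.2].
  + exact: (tmap_conj_bil lsT lsT).
  move=> d x1 x2 hx1 hx2; rewrite (twist_starE hx1) (twist_starE hx2) tensZl tensZr scalerA.
  apply: (congr1 (fun c : C => c *: (hstar D x1 ⊗ hstar D x2 : tensor L L))).
  by rewrite mulrA divfK.
Qed.

End Bigraded.

(** * The bigrading defined by a map to a group algebra *)

Section GroupAlgebraTheory.
Variables (C : numClosedFieldType) (G : groupType).
Implicit Types U V W : lmodType C.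
Local Notation CG := (@galg C G).
Local Notation CT := (@galg_ops C G).

Lemma mcoeff_linear (a : G) : linear (mcoeff a : CG -> C^o).
Proof. by move=> k f g; rewrite mcoeffD mcoeffZ. Qed.

Lemma mcoeff_base (a b : G) : mcoeff a (gbase b : CG) = (b == a)%:R.
Proof. by rewrite mcoeffU. Qed.

(** Terms outside the support vanish, so elements with different supports can be summed over one
    index set; linearity rests on this. *)
Lemma glinEw U (F : G -> U) (d : {fset G}) (f : CG) : (msupp f `<=` d)%fset ->
  glin F f = \sum_(a <- d) mcoeff a f *: F a.
Proof.
move=> le; rewrite /glin [LHS](big_fset_incl _ le)//= => x xd /mcoeff_outdom ->.
by rewrite scale0r.
Qed.

Lemma gantilinEw U (F : G -> U) (d : {fset G}) (f : CG) : (msupp f `<=` d)%fset ->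
  gantilin F f = \sum_(a <- d) (mcoeff a f)^* *: F a.
Proof.
move=> le; rewrite /gantilin [LHS](big_fset_incl _ le)//= => x xd /mcoeff_outdom ->.
by rewrite rmorph0 scale0r.
Qed.

Lemma glin_linear U (F : G -> U) : linear (glin F : CG -> U).
Proof.
move=> k f g; pose d := (msupp f `|` msupp g `|` msupp (k *: f + g))%fset.
have df : (msupp f `<=` d)%fset by rewrite /d -fsetUA fsubsetUl.
have dg : (msupp g `<=` d)%fset by rewrite /d fsetUAC fsubsetUr.
rewrite (glinEw F df) (glinEw F dg) (@glinEw _ F d) ?fsubsetUr//.
rewrite scaler_sumr -big_split; apply: eq_bigr => a _ /=.
by rewrite mcoeffD mcoeffZ scalerDl scalerA.
Qed.

Lemma gantilin_linear U (F : G -> U) : linear (gantilin F : CG -> conjmod U).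
Proof.
move=> k f g; pose d := (msupp f `|` msupp g `|` msupp (k *: f + g))%fset.
have df : (msupp f `<=` d)%fset by rewrite /d -fsetUA fsubsetUl.
have dg : (msupp g `<=` d)%fset by rewrite /d fsetUAC fsubsetUr.
rewrite (gantilinEw F df) (gantilinEw F dg) (@gantilinEw _ F d) ?fsubsetUr//.
change (\sum_(a <- d) (mcoeff a (k *: f + g))^* *: F a =
  k^* *: (\sum_(a <- d) (mcoeff a f)^* *: F a) + \sum_(a <- d) (mcoeff a g)^* *: F a).
rewrite scaler_sumr -big_split; apply: eq_bigr => a _ /=.
by rewrite mcoeffD mcoeffZ rmorphD rmorphM/= scalerDl scalerA.
Qed.

Lemma linear_glin U V (F : G -> V -> U) (f : CG) :
  (forall a, linear (F a)) -> linear (fun x => glin (fun a => F a x) f).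
Proof.
move=> lF k x y; rewrite /glin scaler_sumr -big_split; apply: eq_bigr => a _.
by rewrite lF scalerDr !scalerA mulrC.
Qed.

Lemma linear_gantilin U V (F : G -> V -> conjmod U) (f : CG) :
  (forall a, linear (F a)) ->
  linear ((fun x => gantilin (fun a => F a x : U) f) : V -> conjmod U).
Proof.
move=> lF k x y; rewrite /gantilin.
change (\sum_(a <- msupp f) (mcoeff a f)^* *: (F a (k *: x + y) : U) =
  k^* *: (\sum_(a <- msupp f) (mcoeff a f)^* *: (F a x : U))
  + \sum_(a <- msupp f) (mcoeff a f)^* *: (F a y : U)).
rewrite scaler_sumr -big_split; apply: eq_bigr => a _; rewrite lF.
rewrite [LHS]scalerDr; congr (_ + _).
change ((mcoeff a f)^* *: (k^* *: (F a x : U)) = k^* *: ((mcoeff a f)^* *: (F a x : U))).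
by rewrite !scalerA mulrC.
Qed.

Lemma msupp_base (a : G) : (msupp (gbase a : CG) `<=` [fset a])%fset.
Proof. exact: msuppU_le. Qed.

Lemma glin_base U (F : G -> U) a : glin F (gbase a : CG) = F a.
Proof. by rewrite (glinEw _ (msupp_base a)) big_seq_fset1 mcoeffUU scale1r. Qed.

Lemma gantilin_base U (F : G -> U) a : gantilin F (gbase a : CG) = F a.
Proof.
by rewrite (gantilinEw _ (msupp_base a)) big_seq_fset1 mcoeffUU rmorph1 scale1r.
Qed.

Lemma galgEw (d : {fset G}) (f : CG) : (msupp f `<=` d)%fset ->
  f = \sum_(a <- d) mcoeff a f *: gbase a.
Proof.
move=> le; rewrite [LHS](monalgEw le); apply: eq_bigr => a _.
apply/malgP => b; rewrite mcoeffZ !mcoeffU.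
by case: eqP; rewrite ?mulr1 ?mulr0.
Qed.

Lemma galg_ext U (f g : CG -> U) :
  linear f -> linear g -> (forall a, f (gbase a) = g (gbase a)) -> f =1 g.
Proof.
move=> lf lg fg x; rewrite (galgEw (fsubset_refl (msupp x))) !lin_sum//.
by apply: eq_bigr => a _; rewrite !linZ// fg.
Qed.

Lemma galg_counitEw (d : {fset G}) (f : CG) : (msupp f `<=` d)%fset ->
  hcounit CT f = \sum_(a <- d) mcoeff a f.
Proof.
move=> le; rewrite /= (glinEw _ le); apply: eq_bigr => a _.
by rewrite /GRing.scale/= mulr1.
Qed.

Lemma galg_mulE (a b : G) : hmul CT (gbase a) (gbase b) = gbase (a * b)%g.
Proof. by rewrite /= !glin_base. Qed.
Lemma galg_comulE (a : G) : hcomul CT (gbase a) = gbase a ⊗ gbase a.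
Proof. by rewrite /= !glin_base. Qed.
Lemma galg_counitE (a : G) : hcounit CT (gbase a) = 1.
Proof. by rewrite /= glin_base. Qed.
Lemma galg_antiE (a : G) : hanti CT (gbase a) = gbase a^-1%g.
Proof. by rewrite /= glin_base. Qed.
Lemma galg_starE (a : G) : hstar CT (gbase a) = gbase a^-1%g.
Proof. by rewrite /= gantilin_base. Qed.

Section Form.
Variable J : G * G -> G * G -> C.

Let quad_form (f g f' g' : CG) : C^o :=
  glin (fun a => glin (fun b => glin (fun c => glin (fun d =>
    J (a, b) (c, d) : C^o) g') f') g) f.

Let bil_inner (f g : CG) : bil (quad_form f g).
Proof.
apply: bilin => z; do 2!apply: linear_glin => ?; last apply: linear_glin => ?; exact: glin_linear.
Qed.

Let bil_outer (v : tensor CG CG) : bil (fun f g => tlift (quad_form f g) v).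
Proof.
apply: bilin => z; apply: linear_tlift => f' g'; last apply: linear_glin => ?; exact: glin_linear.
Qed.

Lemma galg2_form_bil : bil (galg2_form J : _ -> _ -> C^o).
Proof.
apply: bilin => [v|u]; first exact: tlift_linear (bil_outer v).
by apply: linear_tlift => f g; exact: tlift_linear (bil_inner f g).
Qed.

Lemma galg2_formE (a b c d : G) :
  galg2_form J (gbase a ⊗ gbase b) (gbase c ⊗ gbase d) = J (a, b) (c, d).
Proof.
rewrite /galg2_form (tlift_tens (U := C^o) _ _ (bil_outer _)).
by rewrite (tlift_tens (U := C^o) _ _ (bil_inner _ _)) /quad_form !glin_base.
Qed.

End Form.

End GroupAlgebraTheory.

Arguments mcoeff_linear {C G} a.

(** * Sums over an infinite index set with finitely many non-zero terms *)

Section FinitelySupportedSums.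
Variable C : numClosedFieldType.

Lemma fsum_seq (V : zmodType) (I : choiceType) (r : seq I) (f : I -> V) :
  uniq r -> (forall i, i \notin r -> f i = 0) ->
  \sum_(i \in [set: I]) f i = \sum_(i <- r) f i.
Proof.
move=> ur fr; rewrite (fsbigE r)//; last by move=> i _; apply: fr.
by apply: eq_bigl => i; apply: mem_set.
Qed.

(** Such a sum defaults to 0 when its support is infinite, which would break additivity. The finite
    set may depend on v: those of x and y together contain the support for kx + y. *)
Lemma linear_fsum (V U : lmodType C) (I : choiceType) (F : I -> V -> U) :
  (forall i, linear (F i)) ->
  (forall v, exists r : seq I, forall i, i \notin r -> F i v = 0) ->
  linear (fun v => \sum_(i \in [set: I]) F i v).
Proof.
move=> lF fF k x y; have [[r1 h1] [r2 h2]] := (fF x, fF y).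
have ur := undup_uniq (r1 ++ r2); set r := undup _ in ur.
have hr i : i \notin r -> F i x = 0 /\ F i y = 0.
  by rewrite mem_undup mem_cat negb_or => /andP[/h1 ? /h2].
rewrite !(fsum_seq ur); try by move=> i /hr[].
  rewrite scaler_sumr -big_split; apply: eq_bigr => i _; exact: lF.
by move=> i /hr[ix iy]; rewrite lF ix iy scaler0 addr0.
Qed.

Lemma fsum_one (V : zmodType) (I : choiceType) (i0 : I) (f : I -> V) :
  (forall i, i != i0 -> f i = 0) -> \sum_(i \in [set: I]) f i = f i0.
Proof.
move=> f0; rewrite (@fsum_seq _ _ [:: i0])// ?big_seq1//.
by move=> i; rewrite inE => /f0.
Qed.

End FinitelySupportedSums.

(** * Homogeneous components with respect to a map to a group algebra *)

Section Bigrading.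
Variables (C : numClosedFieldType) (G : groupType) (H : lmodType C).
Local Notation CG := (@galg C G).
Local Notation DG := (@galg_ops C G).
Variables (DH : hopf_ops H) (pi : H -> CG).
Hypothesis hH : is_hopf_star DH.
Hypothesis hpi : hopf_star_hom DH DG pi.
Implicit Types (U : lmodType C) (a b p q : G).

(* [bihomogeneous], for the group algebra of an arbitrary group. *)
Definition bihom a b (x : H) : Prop :=
  tmap pi id (hcomul DH x) = gbase a ⊗ x /\ tmap id pi (hcomul DH x) = x ⊗ gbase b.

Let lpi : linear pi := hopf_hom_linear hpi.
Let hT : is_hopf_star DG := hopf_hom_tgt hpi.
Let phi a x : C := mcoeff a (pi x).
Let lphi a : linear (phi a : H -> C^o).
Proof. exact: (linear_comp (mcoeff_linear a) lpi). Qed.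

(** With [rproj] below, these are the projections onto left degree a and right degree b:
    convolutions with the coordinate functionals of pi, which are orthogonal idempotents for
    convolution. *)
Let lproj a x := sw2 DH (fun x1 x2 => phi a x1 *: x2) x.
Let rproj b x := sw2 DH (fun x1 x2 => phi b x2 *: x1) x.

Let bphi a : bil (fun x1 x2 : H => phi a x1 *: x2).
Proof. by have := lphi a; move=> ?; lin. Qed.
Let bphi' a : bil (fun x1 x2 : H => phi a x2 *: x1).
Proof. by have := lphi a; move=> ?; lin. Qed.

Let ll a : linear (lproj a).
Proof. exact: linear_sw2 (bphi a). Qed.
Let lr a : linear (rproj a).
Proof. exact: linear_sw2 (bphi' a). Qed.

Let sw_lproj U (F : H -> H -> U) a x : bil F ->
  sw2 DH F (lproj a x) = sw2 DH (fun x1 x2 => F (lproj a x1) x2) x.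
Proof.
move=> bF; have lpa := lphi a; have lsF := linear_sw2 hH bF.
rewrite /lproj (lin_sw2 _ _ lsF).
transitivity (sw2 DH (fun x1 y => sw2 DH (fun x2 x3 => phi a x1 *: F x2 x3) y) x).
  apply: eq_sw2 => x1 y; rewrite (linZ lsF).
  by rewrite (lin_sw2 _ _ (@linear_scale _ _ _ _ _ (@linear_id _ _))).
rewrite -(@sw_coassoc _ _ _ hH _ (fun x1 x2 x3 => phi a x1 *: F x2 x3)); last by lin.
apply: eq_sw2 => y x3; rewrite (lin_sw2 _ _ (bF.1 x3)).
by apply: eq_sw2 => x1 x2; rewrite (linZ (bF.1 x3)).
Qed.

Let sw_rproj U (F : H -> H -> U) a x : bil F ->
  sw2 DH F (rproj a x) = sw2 DH (fun x1 x2 => F x1 (rproj a x2)) x.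
Proof.
move=> bF; have lpa := lphi a; have lsF := linear_sw2 hH bF.
rewrite /rproj (lin_sw2 _ _ lsF).
transitivity (sw2 DH (fun y x3 => sw2 DH (fun x1 x2 => phi a x3 *: F x1 x2) y) x).
  apply: eq_sw2 => y x3; rewrite (linZ lsF).
  by rewrite (lin_sw2 _ _ (@linear_scale _ _ _ _ _ (@linear_id _ _))).
rewrite (@sw_coassoc _ _ _ hH _ (fun x1 x2 x3 => phi a x3 *: F x1 x2)); last by lin.
apply: eq_sw2 => x1 y; rewrite (lin_sw2 _ _ (bF.2 x1)).
by apply: eq_sw2 => x2 x3; rewrite (linZ (bF.2 x1)).
Qed.

(** Both sides put the coordinate functional on the middle leg of the iterated coproduct. This is
    why adjacent legs share their inner degree. *)
Let sw_rlproj U (F : H -> H -> U) a x : bil F ->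
  sw2 DH (fun x1 x2 => F (rproj a x1) x2) x = sw2 DH (fun x1 x2 => F x1 (lproj a x2)) x.
Proof.
move=> bF; have lpa := lphi a.
transitivity (sw2 DH (fun y x3 => sw2 DH (fun x1 x2 => phi a x2 *: F x1 x3) y) x).
  apply: eq_sw2 => y x3; rewrite /rproj (lin_sw2 _ _ (bF.1 x3)).
  by apply: eq_sw2 => x1 x2; rewrite (linZ (bF.1 x3)).
rewrite (@sw_coassoc _ _ _ hH _ (fun x1 x2 x3 => phi a x2 *: F x1 x3)); last by lin.
apply: eq_sw2 => x1 y; rewrite /lproj (lin_sw2 _ _ (bF.2 x1)).
by apply: eq_sw2 => x2 x3; rewrite (linZ (bF.2 x1)).
Qed.

(** Since pi is a coalgebra map, the convolution can be computed in C[G], where basis elements are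
    group-like. *)
Let sw_phi a b x : sw2 DH (fun x1 x2 => phi a x1 * phi b x2) x = (a == b)%:R * phi a x.
Proof.
have ba : bil (fun f g : CG => mcoeff a f * mcoeff b g : C^o).
  by have la := mcoeff_linear (C := C) a; have lb := mcoeff_linear (C := C) b; lin.
transitivity (sw2 DG (fun f g => mcoeff a f * mcoeff b g) (pi x)).
  by rewrite [RHS]/sw2 (hopf_hom_comul hpi) (tlift_tmap (U := C^o)).
rewrite [in RHS]/phi; move: (pi x); have la := mcoeff_linear (C := C) a.
apply: (galg_ext (U := C^o)); [exact: (linear_sw2 (U := C^o))|lin|move=> c].
rewrite /sw2 galg_comulE (tlift_tens (U := C^o))//= !mcoeff_base -!natrM !mulnb.
by congr (_ %:R); have [<-|] := eqVneq c a; rewrite ?andbT ?andbF.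
Qed.

Let phi_lproj a b x : phi a (lproj b x) = (a == b)%:R * phi a x.
Proof.
rewrite /lproj (lin_sw2 _ _ (lphi a)).
transitivity (sw2 DH (fun x1 x2 => phi b x1 * phi a x2) x).
  by apply: eq_sw2 => x1 x2; rewrite (linZ (lphi a)).
by rewrite sw_phi eq_sym; have [->|] := eqVneq a b; rewrite // !mul0r.
Qed.

Let phi_rproj a b x : phi a (rproj b x) = (a == b)%:R * phi a x.
Proof.
rewrite /rproj (lin_sw2 _ _ (lphi a)) -sw_phi.
by apply: eq_sw2 => x1 x2; rewrite (linZ (lphi a)) /GRing.scale/= mulrC.
Qed.

Let lprojK a b x : lproj a (lproj b x) = (a == b)%:R *: lproj a x.
Proof.
rewrite {1}/lproj sw_lproj// [in RHS]/lproj.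
rewrite (lin_sw2 _ _ (@linear_scale _ _ _ _ _ (@linear_id _ _))).
by apply: eq_sw2 => x1 x2; rewrite phi_lproj scalerA.
Qed.

Let rprojK a b x : rproj a (rproj b x) = (a == b)%:R *: rproj a x.
Proof.
rewrite {1}/rproj sw_rproj// [in RHS]/rproj.
rewrite (lin_sw2 _ _ (@linear_scale _ _ _ _ _ (@linear_id _ _))).
by apply: eq_sw2 => x1 x2; rewrite phi_rproj scalerA.
Qed.

Let lrprojC a b x : lproj a (rproj b x) = rproj b (lproj a x).
Proof.
rewrite {1}/lproj sw_rproj//; rewrite [in RHS]/lproj (lin_sw2 _ _ (lr b)).
by apply: eq_sw2 => x1 x2; rewrite (linZ (lr b)).
Qed.

(** Computed from the chosen representative of the coproduct, so possibly larger than the set of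
    left degrees of x; what counts is that it is finite and contains them. *)
Let suppl x : {fset G} :=
  [fset a in flatten [seq (msupp (pi t.1) : seq G) | t <- repr (hcomul DH x)]]%fset.
Let suppr x : {fset G} :=
  [fset a in flatten [seq (msupp (pi t.2) : seq G) | t <- repr (hcomul DH x)]]%fset.

Let in_suppl x t a : t \in repr (hcomul DH x) -> a \in msupp (pi t.1) -> a \in suppl x.
Proof.
move=> ht ta; rewrite !inE /=; apply/flattenP; exists (enum_fset (msupp (pi t.1))) => //.
by apply/mapP; exists t.
Qed.

Let in_suppr x t a : t \in repr (hcomul DH x) -> a \in msupp (pi t.2) -> a \in suppr x.
Proof.
move=> ht ta; rewrite !inE /=; apply/flattenP; exists (enum_fset (msupp (pi t.2))) => //.
by apply/mapP; exists t.
Qed.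

Let suppl0 x a : a \notin suppl x -> lproj a x = 0.
Proof.
move=> ax; rewrite /lproj /sw2 /tlift /tsum big_seq big1// => t ht.
rewrite /phi mcoeff_outdom ?scale0r//; apply: contra ax => ta.
exact: (in_suppl ht ta).
Qed.

Let suppr0 x a : a \notin suppr x -> rproj a x = 0.
Proof.
move=> ax; rewrite /rproj /sw2 /tlift /tsum big_seq big1// => t ht.
rewrite /phi mcoeff_outdom ?scale0r//; apply: contra ax => ta.
exact: (in_suppr ht ta).
Qed.

(** The coefficients of pi(x_(1)) add up to its counit, hence to eps(x_(1)), and the sum is
    eps(x_(1)) x_(2). *)
Let lproj_sum x (d : {fset G}) : (suppl x `<=` d)%fset -> \sum_(a <- d) lproj a x = x.
Proof.
move=> le; rewrite -[RHS](hopf_counitl hH) /lproj /sw2 /tlift /tsum exchange_big/=.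
rewrite [LHS]big_seq [RHS]big_seq; apply: eq_bigr => t ht.
rewrite -scaler_suml -(hopf_hom_counit hpi) (@galg_counitEw _ _ d)//.
apply: fsubset_trans le; apply/fsubsetP => a ta.
exact: (in_suppl ht ta).
Qed.

Let rproj_sum x (d : {fset G}) : (suppr x `<=` d)%fset -> \sum_(a <- d) rproj a x = x.
Proof.
move=> le; rewrite -[RHS](hopf_counitr hH) /rproj /sw2 /tlift /tsum exchange_big/=.
rewrite [LHS]big_seq [RHS]big_seq; apply: eq_bigr => t ht.
rewrite -scaler_suml -(hopf_hom_counit hpi) (@galg_counitEw _ _ d)//.
apply: fsubset_trans le; apply/fsubsetP => a ta.
exact: (in_suppr ht ta).
Qed.

Local Notation hom := bihom.

(** Expanding pi(x_(1)) in the basis gives pi(x_(1)) ⊗ x_(2) = sum_a a ⊗ lproj a x, and similarly on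
    the right; the coaction conditions become conditions on projections. *)
Let homP p q x : hom p q x <->
  (forall a, lproj a x = (a == p)%:R *: x) /\ (forall b, rproj b x = (b == q)%:R *: x).
Proof.
have lid : linear (id : H -> H) by [].
split=> [[hl hr]|[hl hr]]; split.
- move=> a; have la := mcoeff_linear (C := C) a.
  have ba : bil (fun (f : CG) (x : H) => (mcoeff a f : C) *: x) by lin.
  have := congr1 (tlift (fun (f : CG) (x : H) => (mcoeff a f : C) *: x)) hl.
  by rewrite tlift_tmap// tlift_tens// mcoeff_base eq_sym.
- move=> b; have lb := mcoeff_linear (C := C) b.
  have bb : bil (fun (x : H) (f : CG) => (mcoeff b f : C) *: x) by lin.
  have := congr1 (tlift (fun (x : H) (f : CG) => (mcoeff b f : C) *: x)) hr.
  by rewrite tlift_tmap// tlift_tens// mcoeff_base eq_sym.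
(* The degree p is adjoined so that its term can be isolated; the computed support may miss it when
   x = 0. *)
- pose d := (p |` suppl x)%fset.
  transitivity (\sum_(a <- d) gbase a ⊗ lproj a x).
    rewrite /lproj [LHS]/tmap.
    transitivity (\sum_(a <- d) sw2 DH (fun x1 x2 => phi a x1 *: (gbase a ⊗ x2)) x); last first.
      apply: eq_bigr => a _; rewrite (lin_sw2 _ _ ((tens_bil _ _).2 _)).
      by apply: eq_sw2 => x1 x2; rewrite tensZr.
    rewrite /sw2 /tlift /tsum exchange_big/=.
    rewrite [LHS]big_seq [RHS]big_seq; apply: eq_bigr => t ht.
    rewrite [in LHS](@galgEw _ _ d (pi t.1)).
      rewrite (lin_sum _ _ ((tens_bil _ _).1 _)).
      by apply: eq_bigr => a _; rewrite tensZl.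
    apply: fsubset_trans (fsubsetUr _ _); apply/fsubsetP => a ta.
    exact: (in_suppl ht ta).
  rewrite (big_fsetD1 p) ?fset1U1//= hl eqxx scale1r big1_fset ?addr0// => a.
  by rewrite !inE => /andP[/negPf ap _] _; rewrite hl ap scale0r tens0r.
- pose d := (q |` suppr x)%fset.
  transitivity (\sum_(a <- d) rproj a x ⊗ gbase a).
    rewrite /rproj [LHS]/tmap.
    transitivity (\sum_(a <- d) sw2 DH (fun x1 x2 => phi a x2 *: (x1 ⊗ gbase a)) x); last first.
      apply: eq_bigr => a _; rewrite (lin_sw2 _ _ ((tens_bil _ _).1 _)).
      by apply: eq_sw2 => x1 x2; rewrite tensZl.
    rewrite /sw2 /tlift /tsum exchange_big/=.
    rewrite [LHS]big_seq [RHS]big_seq; apply: eq_bigr => t ht.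
    rewrite [in LHS](@galgEw _ _ d (pi t.2)).
      rewrite (lin_sum _ _ ((tens_bil _ _).2 _)).
      by apply: eq_bigr => a _; rewrite tensZr.
    apply: fsubset_trans (fsubsetUr _ _); apply/fsubsetP => a ta.
    exact: (in_suppr ht ta).
  rewrite (big_fsetD1 q) ?fset1U1//= hr eqxx scale1r big1_fset ?addr0// => a.
  by rewrite !inE => /andP[/negPf ap _] _; rewrite hr ap scale0r tens0l.
Qed.

Let hom_proj a b x : hom a b (lproj a (rproj b x)).
Proof.
apply/homP; split=> c.
- by rewrite lprojK; have [->|] := eqVneq c a; rewrite ?scale1r ?scale0r.
- by rewrite -lrprojC rprojK; have [->|] := eqVneq c b; rewrite ?scale1r ?scale0r ?(lin0 (ll a)).
Qed.

(** Insert sum_c rproj c = 1 on the first leg and write each rproj c twice: one copy stays, the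
    other crosses to the second leg as lproj c by [sw_rlproj]. *)
Let hom_comul p q x : hom p q x -> exists s : seq (G * H * H),
  (forall t, t \in s -> hom p t.1.1 t.1.2 /\ hom t.1.1 q t.2)
  /\ hcomul DH x = \sum_(t <- s) t.1.2 ⊗ t.2.
Proof.
move=> hx; have [hl hr] := (homP p q x).1 hx.
pose s0 := repr (hcomul DH x).
pose d : {fset G} :=
  [fset c in flatten [seq (suppr (lproj p t.1) : seq G) | t <- s0]]%fset.
have hd t : t \in s0 -> (suppr (lproj p t.1) `<=` d)%fset.
  move=> ht; apply/fsubsetP => c hc; rewrite [d](lock) -lock inE /=; apply/flattenP.
  by exists (enum_fset (suppr (lproj p t.1))) => //; apply/mapP; exists t.
exists [seq (c, lproj p (rproj c t.1), lproj c (rproj q t.2)) | c <- (d : seq G), t <- s0].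
split=> [t /allpairsP[[c y] [_ _ ->]]|]; first by split; apply: hom_proj.
have bt := @tens_bil C H H.
have xE : x = lproj p (rproj q x) by rewrite hr eqxx scale1r hl eqxx scale1r.
have -> : hcomul DH x = sw2 DH (fun x1 x2 => lproj p x1 ⊗ rproj q x2) x.
  rewrite [LHS](_ : _ = sw2 DH (fun x1 x2 => x1 ⊗ x2) x); last exact: tensE.
  rewrite [in LHS]xE sw_lproj// sw_rproj//.
  by have := ll p; move=> ?; lin.
transitivity (\sum_(c <- (d : seq G)) sw2 DH (fun x1 x2 =>
    lproj p (rproj c x1) ⊗ lproj c (rproj q x2)) x); last first.
  by rewrite big_allpairs_dep/=; apply: eq_bigr => c _.
transitivity (\sum_(c <- (d : seq G)) sw2 DH (fun x1 x2 =>
    lproj p (rproj c x1) ⊗ rproj q x2) x).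
  rewrite /sw2 /tlift /tsum exchange_big/= big_seq [RHS]big_seq.
  apply: eq_bigr => t ht; rewrite -[in LHS](rproj_sum (hd t ht)).
  rewrite (lin_sum _ _ ((tens_bil _ _).1 _)).
  by apply: eq_bigr => c _; rewrite lrprojC.
apply: eq_bigr => c _.
have [lpp lqq lcc lrc] := And4 (ll p) (lr q) (ll c) (lr c).
transitivity (sw2 DH (fun x1 x2 => lproj p (rproj c (rproj c x1)) ⊗ rproj q x2) x).
  by apply: eq_sw2 => x1 x2; rewrite rprojK eqxx scale1r.
rewrite (@sw_rlproj _ (fun x1 x2 => lproj p (rproj c x1) ⊗ rproj q x2)); last by lin.
by apply: eq_sw2 => x1 x2; rewrite -(lrprojC c q).
Qed.

Let lid : linear (id : H -> H). Proof. by []. Qed.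

(** Apply the counit to the H-leg of each coaction identity. Comparing the two values shows that
    eps(x) = 0 when p and q differ. *)
Lemma bihom_pi p q x : hom p q x ->
  pi x = hcounit DH x *: gbase p /\ pi x = hcounit DH x *: gbase q.
Proof.
have lc := hopf_counit_linear hH.
move=> [hl hr]; split.
- have be : bil (fun (f : CG) (x : H) => hcounit DH x *: f) by lin.
  have := congr1 (tlift (fun (f : CG) (x : H) => hcounit DH x *: f)) hl.
  by rewrite tlift_tmap// tlift_tens// => <-; rewrite -[LHS](sw_counitr hH _ lpi).
- have be : bil (fun (x : H) (f : CG) => hcounit DH x *: f) by lin.
  have := congr1 (tlift (fun (x : H) (f : CG) => hcounit DH x *: f)) hr.
  by rewrite tlift_tmap// tlift_tens// => <-; rewrite -[LHS](sw_counitl hH _ lpi).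
Qed.

Lemma bihom_bigraded : bigraded DH hom.
Proof.
have [bM bMT] := (hopf_mul_bilinear hH, hopf_mul_bilinear hT).
have [ls lsT] := (linear_star hH, linear_star hT).
have [la laT] := (hopf_anti_linear hH, hopf_anti_linear hT).
split; last 1 first.
- move=> p q x hx pq; have [e1 e2] := bihom_pi hx.
  have := congr1 (mcoeff p) e1; rewrite e2 !mcoeffZ !mcoeff_base eqxx mulr1.
  by rewrite eq_sym (negPf pq) mulr0.
(* [Q] says that adding y preserves P; it is closed under sums, so x can be assembled from its
   components. *)
- move=> P P0 PD x; pose Q y := forall z, P z -> P (y + z).
  have Qsum (s : seq G) (E : G -> H) : (forall a, Q (E a)) -> Q (\sum_(a <- s) E a).
    move=> QE; elim: s => [|a s IH] z Pz; first by rewrite big_nil add0r.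
    by rewrite big_cons -addrA; apply/QE/IH.
  suff Qx : Q x by rewrite -[x]addr0; apply: Qx.
  rewrite -(rproj_sum (fsubset_refl (suppr x))); apply: (Qsum) => b.
  rewrite -(lproj_sum (fsubset_refl (suppl (rproj b x)))); apply: (Qsum) => a.
  by move=> z Pz; apply: PD Pz; apply: hom_proj.
- exact: hom_comul.
- by split; rewrite (hopf_comul1 hH) tmap_tens// (hopf_hom1 hpi).
- move=> p q x p' q' y [xl xr] [yl yr]; split; rewrite (hopf_comulM hH).
  + rewrite (tensor_mul_tmap _ _ bMT bM lpi lid (hopf_homM hpi))// xl yl.
    by rewrite tensor_mulE// galg_mulE.
  + rewrite (tensor_mul_tmap _ _ bM bMT lid lpi _ (hopf_homM hpi))// xr yr.
    by rewrite tensor_mulE// galg_mulE.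
- have hs : forall y, pi (hstar DH y) = hstar DG (pi y) := hopf_hom_star hpi.
  move=> p q x [xl xr]; split; rewrite (hopf_comul_star hH).
  + rewrite tmap_comp// -galg_starE -(tmap_conj_tens _ _ lsT ls) -xl (tmap_conj_tmap _ _ _ lsT ls).
    by apply: eq_tlift => y z; rewrite hs.
  + rewrite tmap_comp// -galg_starE -(tmap_conj_tens _ _ ls lsT) -xr (tmap_conj_tmap _ _ _ ls lsT).
    by apply: eq_tlift => y z; rewrite hs.
- have ha : forall y, pi (hanti DH y) = hanti DG (pi y) := hopf_hom_anti hpi.
  move=> p q x [xl xr]; split.
  + have bl : bil (fun y f => hanti DG f ⊗ hanti DH y) by lin.
    rewrite -galg_antiE -(tlift_tens x (gbase q) bl) -xr tlift_tmap//.
    transitivity (sw2 DH (fun y z => pi y ⊗ z) (hanti DH x)); first by [].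
    rewrite (sw_anti hH); last by lin.
    by apply: eq_sw2 => y z; rewrite ha.
  + have bl : bil (fun f y => hanti DH y ⊗ hanti DG f) by lin.
    rewrite -galg_antiE -(tlift_tens (gbase p) x bl) -xl tlift_tmap//.
    transitivity (sw2 DH (fun y z => y ⊗ pi z) (hanti DH x)); first by [].
    rewrite (sw_anti hH); last by lin.
    by apply: eq_sw2 => y z; rewrite ha.
Qed.

(* [bicomp], for the group algebra of an arbitrary group. *)
Definition bicompg a b x : H :=
  sw3 DH (fun x1 x2 x3 => (mcoeff a (pi x1) * mcoeff b (pi x3)) *: x2) x.

Let bicompgE a b x : bicompg a b x = rproj b (lproj a x).
Proof.
transitivity (sw2 DH (fun y x3 => phi b x3 *: lproj a y) x).
  apply: eq_sw2 => y x3; rewrite /lproj.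
  rewrite (lin_sw2 _ _ (@linear_scale _ _ _ _ _ (@linear_id _ _))).
  by apply: eq_sw2 => x1 x2; rewrite scalerA mulrC.
rewrite -lrprojC /rproj (lin_sw2 _ _ (ll a)).
by apply: eq_sw2 => x1 x2; rewrite (linZ (ll a)).
Qed.

Lemma bicompg_linear a b : linear (bicompg a b).
Proof. by move=> k x y; rewrite !bicompgE (ll a) (lr b). Qed.

Lemma bicompg_hom p q x a b : hom p q x ->
  bicompg a b x = ((a == p) && (b == q))%:R *: x.
Proof.
move=> /homP[hl hr]; rewrite bicompgE hl (linZ (lr b)) hr scalerA -natrM mulnb.
by [].
Qed.

Lemma bicompg_suppl x : exists r : seq G, forall a b, a \notin r -> bicompg a b x = 0.
Proof.
by exists (suppl x) => a b ar; rewrite bicompgE suppl0// (lin0 (lr b)).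
Qed.

Lemma bicompg_suppr x : exists r : seq G, forall a b, b \notin r -> bicompg a b x = 0.
Proof.
by exists (suppr x) => a b ar; rewrite bicompgE -lrprojC suppr0// (lin0 (ll a)).
Qed.

End Bigrading.

(** * The diagonal invariants, the smash product and the bosonization *)

Section Generators.
Variables (C : numClosedFieldType) (G Q : groupType) (H : lmodType C).
Variables (DH : hopf_ops H) (h : G -> G -> H -> Prop).
Hypothesis bg : bigraded DH h.
Implicit Types U : lmodType C.

Lemma galg_tens_ext U (f g : tensor (@galg C Q) H -> U) :
  linear f -> linear g ->
  (forall a p q x, h p q x -> f (gbase a ⊗ x) = g (gbase a ⊗ x)) -> f =1 g.
Proof.
move=> lf lg fg; apply: tens_linear_ext => // v w; move: v.
apply: galg_ext; [exact: linear_comp lf ((tens_bil _ _).1 w)|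
  exact: linear_comp lg ((tens_bil _ _).1 w)|move=> a].
move: w; apply: (bg_ext bg); [exact: linear_comp lf ((tens_bil _ _).2 _)|
  exact: linear_comp lg ((tens_bil _ _).2 _)|exact: fg].
Qed.

End Generators.

Section Constructions.
Context {R : realType} {T : topologicalZmodType} {H : lmodType R[i]}.
Local Notation C := (R[i] : numClosedFieldType).
Local Notation That := (dual R T).
Local Notation CT := (@galg C That).
Local Notation DT := (@galg_ops C That).
Variables (DH : hopf_ops (C := C) H) (pi : H -> CT).
Hypothesis hH : is_hopf_star DH.
Hypothesis hpi : hopf_star_hom DH DT pi.
Implicit Types (U : lmodType C) (b c p q : That) (x : H).

Local Notation hom := (bihomogeneous DH pi).

Let hT : is_hopf_star DT := hopf_hom_tgt hpi.
Let hTH : is_hopf_star (tensor_ops DT DH) := tensor_is_hopf_star hT hH.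

Lemma bihomogeneous_bigraded : bigraded DH hom.
Proof. exact: bihom_bigraded hH hpi. Qed.
Let bg := bihomogeneous_bigraded.

Lemma bicomp_hom p q x a b : hom p q x ->
  bicomp DH pi a b x = ((a == p) && (b == q))%:R *: x.
Proof. by move=> hx; exact: (bicompg_hom hH hpi a b hx). Qed.

Lemma bicomp_linear a b : linear (bicomp DH pi a b).
Proof. exact: bicompg_linear hH hpi a b. Qed.

Lemma bicomp_suppl x : exists r : seq That, forall a b, a \notin r -> bicomp DH pi a b x = 0.
Proof. exact: bicompg_suppl hH hpi x. Qed.

Lemma bicomp_suppr x : exists r : seq That, forall a b, b \notin r -> bicomp DH pi a b x = 0.
Proof. exact: bicompg_suppr hH hpi x. Qed.

Lemma bilift_hom (U : zmodType) (F : That -> That -> H -> U) p q x :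
  (forall a b, F a b 0 = 0) -> hom p q x -> bilift DH pi F x = F p q x.
Proof.
move=> F0 hx; rewrite /bilift (@fsum_one _ _ (p, q)) /=.
  by rewrite (bicomp_hom _ _ hx) !eqxx scale1r.
move=> [a b] abpq; rewrite (bicomp_hom _ _ hx) /=.
by case: andP => [[/eqP ap /eqP bq]|_]; [rewrite ap bq eqxx in abpq|rewrite scale0r F0].
Qed.

Lemma bilift_linear U (F : That -> That -> H -> U) :
  (forall a b, linear (F a b)) -> linear (bilift DH pi F).
Proof.
move=> lF; apply: (linear_fsum (F := fun ab x => F ab.1 ab.2 (bicomp DH pi ab.1 ab.2 x))).
  by move=> i; apply: linear_comp; [exact: lF|exact: bicomp_linear].
move=> x; have [[r1 h1] [r2 h2]] := (bicomp_suppl x, bicomp_suppr x).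
exists [seq (a, b) | a <- r1, b <- r2] => -[a b] /= abr.
have [ar|ar] := boolP (a \in r1); last by rewrite h1// (lin0 (lF _ _)).
have [br|br] := boolP (b \in r2); last by rewrite h2// (lin0 (lF _ _)).
by case/negP: abr; apply/allpairsP; exists (a, b).
Qed.

Lemma bihomogeneousZ p q k x : hom p q x -> hom p q (k *: x).
Proof.
have [lc lp] := (hopf_comul_linear hH, hopf_hom_linear hpi).
have lid : linear (id : H -> H) by [].
move=> [hl hr]; split; rewrite (linZ lc).
- by rewrite (linZ (tmap_linear lp lid)) hl tensZr.
- by rewrite (linZ (tmap_linear lid lp)) hr tensZl.
Qed.

Lemma dual_mulC (a b : That) : (a * b = b * a)%g.
Proof. by apply: dual_ext => t /=; rewrite mulrC. Qed.

Section Subgroup.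
Variable T0 : set T.
Local Notation CQ := (@galg C (qdual R T0)).
Local Notation X := (tensor CQ H).
Local Notation ann a := (agree_on T0 a 1%g).

Lemma qbase_val (a : qdual R T0) : qbase T0 (val a) = gbase a.
Proof. by rewrite /qbase valK. Qed.

Lemma qbase_ann (a : That) : ann a -> exists2 a0 : qdual R T0, val a0 = a & qbase T0 a = gbase a0.
Proof.
move=> aa; have am : a \in annih_pred (R := R) T0 by apply/asboolP.
by exists (QDual am) => //; rewrite -qbase_val.
Qed.

Lemma qdual_ann (a : qdual R T0) : ann (val a).
Proof. by have /asboolP := valP a. Qed.

Lemma annM (a : That) b : ann a -> ann b -> ann (a * b)%g.
Proof. by move=> aa ab t Tt /=; rewrite aa// ab// mulr1. Qed.

Lemma annV (a : That) : ann a -> ann a^-1%g.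
Proof. by move=> aa t Tt /=; rewrite aa// invr1. Qed.

Lemma annMr (a : That) b c : agree_on T0 b c -> ann (a * b)%g -> ann (a * c)%g.
Proof. by move=> bc aa t Tt /=; rewrite -bc//; apply: aa. Qed.

Section SmashLift.
Variables (U : lmodType C) (F : qdual R T0 -> That -> That -> H -> U).
Hypothesis lF : forall a b c, linear (F a b c).

Let bF : bil (fun f x => glin (fun a => bilift DH pi (F a) x) f).
Proof.
apply: bilin => [x|f]; first exact: glin_linear.
by apply: linear_glin => a; apply: bilift_linear.
Qed.

Lemma smash_lift_linear : linear (smash_lift DH pi F).
Proof. exact: tlift_linear bF. Qed.

Lemma smash_lift_hom a b c x : hom b c x -> smash_lift DH pi F (gbase a ⊗ x) = F a b c x.
Proof.
move=> hx; rewrite /smash_lift tlift_tens// glin_base (bilift_hom _ hx)// => a' b'.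
exact: lin0 (lF _ _ _).
Qed.

End SmashLift.

Lemma smash_ext U (f g : X -> U) : linear f -> linear g ->
  (forall a b c x, hom b c x -> f (gbase a ⊗ x) = g (gbase a ⊗ x)) -> f =1 g.
Proof. exact: (galg_tens_ext bg). Qed.

(* On a ⊗ x with x in H_{b,c}, [Phi] gives ab ⊗ x and [Psi0] gives ab^-1 ⊗ x; the
   diagonal invariants are a retract of C[T] ⊗ H through them. *)
Let Phi : tensor CT H -> X :=
  tlift (fun f x => glin (fun a => bilift DH pi (fun b c x' => qbase T0 (a * b)%g ⊗ x') x) f).

Let bPhi : bil (fun (f : CT) x =>
  glin (fun a => bilift DH pi (fun b c x' => qbase T0 (a * b)%g ⊗ x') x) f).
Proof.
apply: bilin => [x|f]; first exact: glin_linear.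
apply: linear_glin => a; apply: bilift_linear => b c.
exact: (tens_bil _ _).2.
Qed.

Let lPhi : linear Phi := tlift_linear bPhi.

Let PhiE (a : That) b c x : hom b c x -> Phi (gbase a ⊗ x) = qbase T0 (a * b)%g ⊗ x.
Proof.
move=> hx; rewrite /Phi tlift_tens// glin_base.
by apply: (bilift_hom (F := fun b c x' => qbase T0 (a * b)%g ⊗ x') _ hx) => *; rewrite tens0r.
Qed.

Let Psi0 : X -> tensor CT H :=
  smash_lift DH pi (fun a b c x => gbase (val a * b^-1)%g ⊗ x).

Let lPsi0 : linear Psi0.
Proof. by apply: smash_lift_linear => a b c; exact: (tens_bil _ _).2. Qed.

Let Psi0E a b c x : hom b c x -> Psi0 (gbase a ⊗ x) = gbase (val a * b^-1)%g ⊗ x.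
Proof. by apply: smash_lift_hom => {}a {}b {}c; exact: (tens_bil _ _).2. Qed.

Let Psi0K : cancel Psi0 Phi.
Proof.
apply: smash_ext; [exact: linear_comp lPhi lPsi0|by []|move=> a b c x hx].
by rewrite (Psi0E _ hx) (PhiE _ hx) -mulgA mulVg mulg1 qbase_val.
Qed.

Let Psi0_qbase (a : That) b c x : ann a -> hom b c x ->
  Psi0 (qbase T0 a ⊗ x) = gbase (a * b^-1)%g ⊗ x.
Proof. by move=> /qbase_ann[a0 <- ->] hx; rewrite (Psi0E _ hx). Qed.

Let PhiK (a : That) b c x : ann (a * b)%g -> hom b c x ->
  Psi0 (Phi (gbase a ⊗ x)) = gbase a ⊗ x.
Proof.
by move=> ab hx; rewrite (PhiE _ hx) (Psi0_qbase ab hx) -mulgA mulgV mulg1.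
Qed.

(** * The diagonal invariants as a Hopf *-subalgebra of C[T] ⊗ H *)

Local Notation S := (diag_gens DH pi T0).
Local Notation D1 := (diag_inv_ops DH pi T0).
Local Notation V1 := (diag_inv DH pi T0).
Local Notation TH := (tensor_ops DT DH).
Hypothesis hcoc : cocentral DH pi T0.

Let span_closed := span_submod_closed S.

Let span0 : 0 \in span_pred S := span_closed.1.
Let spanD u v : u \in span_pred S -> v \in span_pred S -> u + v \in span_pred S.
Proof. by move=> hu hv; rewrite -[u]scale1r; exact: span_closed.2. Qed.

(** The alternative x = 0 matches what cocentrality delivers, so that both outcomes of
    [cocentral_or] can be fed in. *)
Let span_gen (a : That) b c x : ann (a * b)%g \/ x = 0 -> hom b c x ->
  gbase a ⊗ x \in span_pred S.
Proof.
case=> [ab|->] hx; last by rewrite tens0r.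
apply/asboolP; exists [:: (1, gbase a ⊗ x)]; last by rewrite big_seq1 scale1r.
by move=> p0; rewrite inE => /eqP ->; exists a, b, c, x.
Qed.

(** Scalars are absorbed in the H-factor, so every invariant is a plain sum of generators. *)
Let diag_ind (P : V1 -> Prop) : P 0 ->
  (forall a b c x z y, ann (a * b)%g -> hom b c x -> val z = gbase a ⊗ x ->
    P y -> P (z + y)) -> forall z, P z.
Proof.
move=> P0 PD z; have /asboolP[s Ss zs] := valP z.
have [z' vz' Pz'] : exists2 z' : V1, val z' = \sum_(p0 <- s) p0.1 *: p0.2 & P z'.
  elim: s Ss {zs} => [|[k g] s IH] Ss; first by exists 0; rewrite ?big_nil.
  have [y vy Py] : exists2 z' : V1, val z' = \sum_(p0 <- s) p0.1 *: p0.2 & P z'.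
    by apply: IH => p0 ps; apply: Ss; rewrite inE ps orbT.
  have [a [b [c [x [ab hx gE]]]]] : S g by apply: (Ss (k, g)); rewrite inE eqxx.
  have hkx := bihomogeneousZ k hx.
  pose w : V1 := insubd 0 (gbase a ⊗ (k *: x)).
  have vw : val w = gbase a ⊗ (k *: x).
    by rewrite /w insubdK//; apply: span_gen hkx; left.
  exists (w + y); last exact: (PD _ _ _ _ _ _ ab hkx vw).
  by rewrite big_cons/= gE -tensZr -vw -vy.
suff -> : z = z' by [].
by apply: val_inj; rewrite vz' -zs.
Qed.

Let lval : linear (val : V1 -> tensor CT H).
Proof. by []. Qed.

Let diag_ext U (f g : V1 -> U) : linear f -> linear g ->
  (forall (a : That) b c x z, ann (a * b)%g -> hom b c x -> val z = gbase a ⊗ x ->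
    f z = g z) -> f =1 g.
Proof.
move=> lf lg fg; apply: diag_ind; first by rewrite !lin0.
move=> a b c x z y ab hx vz fgy.
by rewrite (linD lf) (linD lg) fgy (fg _ _ _ _ _ ab hx vz).
Qed.

Let diag_span (f : tensor CT H -> tensor CT H) : f 0 = 0 -> {morph f : u v / u + v} ->
  (forall (a : That) b c x, ann (a * b)%g -> hom b c x ->
    f (gbase a ⊗ x) \in span_pred S) ->
  forall z : V1, f (val z) \in span_pred S.
Proof.
move=> f0 fD fg; apply: diag_ind; first by rewrite f0.
move=> a b c x z y ab hx vz fy; rewrite [val _](_ : _ = val z + val y)// fD vz.
by apply: spanD fy; apply: fg ab hx.
Qed.

(** The elementwise form of cocentrality on which the later arguments rely. *)
Let cocentral_or b c x : hom b c x -> agree_on T0 b c \/ x = 0.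
Proof.
by move=> hx; have [bc|bc] := pselect (agree_on T0 b c);
  [left|right; apply: (hcoc bc hx)].
Qed.

Let bT := hopf_mul_bilinear hTH.
Let lcT := hopf_comul_linear hTH.
Let lsT := linear_star hTH.
Let laT := hopf_anti_linear hTH.
Let leT : linear (hcounit TH : _ -> C^o) := hopf_counit_linear hTH.

Let galgH_mul (a a' : That) x x' :
  hmul TH (gbase a ⊗ x) (gbase a' ⊗ x') = gbase (a * a')%g ⊗ hmul DH x x'.
Proof.
rewrite tensor_mulE ?galg_mulE//; [exact: hopf_mul_bilinear hT|exact: hopf_mul_bilinear hH].
Qed.

Let galgH_anti (a : That) x : hanti TH (gbase a ⊗ x) = gbase a^-1%g ⊗ hanti DH x.
Proof. by rewrite tensor_antiE ?galg_antiE. Qed.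

Let galgH_star (a : That) x : hstar TH (gbase a ⊗ x) = gbase a^-1%g ⊗ hstar DH x.
Proof. by rewrite tensor_starE ?galg_starE. Qed.

Let galgH_counit (a : That) x : hcounit TH (gbase a ⊗ x) = hcounit DH x.
Proof. by rewrite tensor_counitE ?galg_counitE ?mul1r. Qed.

Let galgH_comul (a : That) x : hcomul TH (gbase a ⊗ x)
  = sw2 DH (fun x1 x2 => (gbase a ⊗ x1) ⊗ (gbase a ⊗ x2)) x.
Proof.
rewrite tensor_comulE// {1}/sw2 galg_comulE tlift_tens//; lin.
Qed.

Let val_mul (z w : V1) : val (hmul D1 z w) = hmul TH (val z) (val w).
Proof.
rewrite insubdK//.
have fw0 := lin0 (bT.1 (val w)); have fwD := linD (bT.1 (val w)).
apply: (diag_span fw0 fwD) => a b c x ab hx.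
have fz0 := lin0 (bT.2 (gbase a ⊗ x)); have fzD := linD (bT.2 (gbase a ⊗ x)).
apply: (diag_span fz0 fzD) => a' b' c' x' ab' hx'; rewrite galgH_mul.
apply: span_gen (bg_mul bg hx hx'); left.
rewrite mulgA -[(a * a' * b)%g]mulgA (dual_mulC a' b) mulgA -[(_ * a' * b')%g]mulgA.
exact: annM.
Qed.

Let val_one : val (hone D1) = hone TH.
Proof.
by rewrite insubdK//; apply: span_gen (bg_one bg); left; rewrite mulg1.
Qed.

(** The antipode exchanges the degrees: S(x) has left degree c^-1, so it is ac, not ab, that must be
    trivial on T_0. Cocentrality supplies this unless x = 0. *)
Let val_anti (z : V1) : val (hanti D1 z) = hanti TH (val z).
Proof.
rewrite insubdK//; apply: (diag_span (lin0 laT) (linD laT)) => a b c x ab hx.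
rewrite galgH_anti; apply: span_gen (bg_anti bg hx).
have [bc|->] := cocentral_or hx; [left|right; exact: (lin0 (hopf_anti_linear hH))].
by rewrite -invgM dual_mulC; apply: annV; apply: annMr bc ab.
Qed.

Let val_star (z : V1) : val (hstar D1 z) = hstar TH (val z).
Proof.
rewrite insubdK//; apply: (diag_span (lin0 lsT) (linD lsT)) => a b c x ab hx.
rewrite galgH_star; apply: span_gen (bg_star bg hx); left.
by rewrite -invgM dual_mulC; apply: annV.
Qed.

Let Psi u : V1 := insubd 0 (Psi0 u).

Let val_Psi u : val (Psi u) = Psi0 u.
Proof.
rewrite insubdK//; elim/tens_ind: u; first by rewrite (lin0 lPsi0).
move=> v w u hu; rewrite (linD lPsi0); apply: spanD hu.
rewrite (galgEw (fsubset_refl (msupp v))).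
rewrite (lin_sum _ _ ((tens_bil _ _).1 w)) (lin_sum _ _ lPsi0).
elim: (enum_fset _) => [|a s IH]; first by rewrite big_nil.
rewrite big_cons; apply: spanD IH; rewrite tensZl -tensZr.
move: (_ *: w) => {}w; elim/(bg_ind bg): w => [|p q x y hx hy].
  by rewrite tens0r (lin0 lPsi0).
rewrite (linD ((tens_bil _ _).2 _)) (linD lPsi0); apply: spanD hy.
rewrite (Psi0E _ hx); apply: span_gen hx; left.
by rewrite -mulgA mulVg mulg1; apply: qdual_ann.
Qed.

Let lPsi : linear Psi.
Proof.
move=> k u v; apply: val_inj.
by rewrite val_Psi lPsi0 [RHS](_ : _ = k *: val (Psi u) + val (Psi v))// !val_Psi.
Qed.

Let f (z : V1) : X := Phi (val z).
Let lf : linear f. Proof. exact: linear_comp lPhi lval. Qed.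

Let PsiK : cancel Psi f.
Proof. by move=> u; rewrite /f val_Psi Psi0K. Qed.

Let fK : cancel f Psi.
Proof.
apply: diag_ext; [exact: linear_comp lPsi lf|by []|move=> a b c x z ab hx vz].
by apply: val_inj; rewrite val_Psi /f vz (PhiK ab hx).
Qed.

(** A linear retraction of C[T] ⊗ H onto the invariants, passing through C[T/T_0] ⊗ H. It makes the
    inclusion injective on tensor squares and brings coproducts back into the square of [V1]. *)
Let r u : V1 := Psi (Phi u).
Let lr : linear r. Proof. exact: linear_comp lPsi lPhi. Qed.

Let val_r (a : That) b c x : ann (a * b)%g \/ x = 0 -> hom b c x ->
  val (r (gbase a ⊗ x)) = gbase a ⊗ x.
Proof.
case=> [ab|->] hx; rewrite /r val_Psi; first by rewrite (PhiK ab hx).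
by rewrite tens0r (lin0 lPhi) (lin0 lPsi0).
Qed.

Let valK' : cancel (val : V1 -> _) r := fK.

(** It suffices to exhibit one preimage of the coproduct, and r ⊗ r gives it. The legs are a ⊗ x_(1)
    and a ⊗ x_(2); the second, of left degree d, is invariant because d agrees with b on T_0 or
    x_(1) = 0. *)
Let val_comul (z : V1) : tmap val val (hcomul D1 z) = hcomul TH (val z).
Proof.
suff hz : tmap val val (tmap r r (hcomul TH (val z))) = hcomul TH (val z).
  rewrite [hcomul D1 z](_ : _ =
    xget 0 [set u | tmap val val u = hcomul TH (val z)])//.
  by case: xgetP => [u _ //|/(_ _ hz)].
rewrite (tmap_comp _ _ _ lval lval); move: z.
have lvr : linear (fun u => val (r u)) by exact: linear_comp lval lr.
apply: diag_ext; [exact: linear_comp (tmap_linear lvr lvr) (linear_comp lcT lval)|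
  exact: linear_comp lcT lval|move=> a b c x z ab hx vz].
rewrite vz galgH_comul (lin_sw2 _ _ (tmap_linear lvr lvr)).
have bt : bil (fun x1 x2 : H => (gbase a : CT) ⊗ x1 ⊗ ((gbase a : CT) ⊗ x2)) by lin.
apply: (bg_sw2 bg _ bt hx).
  by have := tmap_linear lvr lvr; move=> ?; lin.
move=> d x1 x2 hx1 hx2; rewrite tmap_tens//.
have [bd|x10] := cocentral_or hx1; last by rewrite x10 !tens0r (lin0 lvr) !tens0l.
rewrite (val_r _ hx1) ?(val_r _ hx2)//; left; [exact: annMr bd ab|exact: ab].
Qed.

Lemma diag_inv_hopf_star_hom : hopf_star_hom D1 TH val.
Proof.
have hD1 : is_hopf_star D1.
  exact: (is_hopf_star_pullback lval lr valK' hTH val_mul val_one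
    (fun z => esym (val_comul z)) (fun=> erefl) val_anti val_star).
exact: (HopfStarHom hD1 hTH lval val_mul val_one
  (fun z => esym (val_comul z)) (fun=> erefl) val_anti val_star).
Qed.
Let hD1 : is_hopf_star D1 := hopf_hom_src diag_inv_hopf_star_hom.

Local Notation G2 := (That * That)%type.

(** The bigrading induced by the map iota ⊗ pi to C[That × That]; the group-like a has equal left
    and right degrees. Admitting x = 0 whatever ab is lets the antipode and the coproduct stay
    within these degrees. *)
Let h1 (p q : G2) (z : V1) : Prop := p.1 = q.1 /\ exists x,
  [/\ hom p.2 q.2 x, val z = gbase p.1 ⊗ x & ann (p.1 * p.2)%g \/ x = 0].

Let h1P (a a' : That) b c z : h1 (a, b) (a', c) z -> a' = a /\ exists x,
  [/\ hom b c x, val z = gbase a ⊗ x & ann (a * b)%g \/ x = 0].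
Proof. by move=> [/= -> h]. Qed.

Let h1_r (a : That) b c x : hom b c x -> ann (a * b)%g \/ x = 0 ->
  h1 (a, b) (a, c) (r (gbase a ⊗ x)).
Proof. by move=> hx ab; split => //; exists x; split => //; exact: val_r hx. Qed.

Let bg1 : bigraded D1 h1.
Proof.
split.
- move=> P P0 PD; apply: diag_ind => // a b c x z y ab hx vz Py.
  by apply: (PD (a, b) (a, c)) Py; split => //; exists x; split => //; left.
- move=> [a b] [a' c] z /h1P[-> [x [hx vz ab]]].
  have lrr := tmap_linear lr lr.
  have cz : hcomul D1 z = tmap r r (hcomul TH (val z)).
    rewrite -val_comul (tmap_comp _ _ _ lr lr) -[LHS]tmap_id.
    by apply: eq_tlift => u v; rewrite !valK'.
  case: ab => [ab|x0]; last first.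
    exists [::]; split => //; rewrite big_nil cz vz x0 tens0r.
    by rewrite (lin0 lcT) (lin0 lrr).
  have [s [hs dx]] := bg_comul bg hx.
  (* Terms whose middle degree d has ad non-trivial on T_0 are left out: by cocentrality their first
     leg is zero. *)
  exists [seq ((a, t.1.1), r (gbase a ⊗ t.1.2), r (gbase a ⊗ t.2)) |
          t <- s & `[<ann (a * t.1.1)%g>]]; split.
    move=> t /mapP[t0]; rewrite mem_filter => /andP[/asboolP at0 /hs[h1t h2t]] -> /=.
    by split; apply: h1_r => //; left.
  rewrite cz vz galgH_comul (lin_sw2 _ _ lrr) (sw2_sum _ dx); last first.
    by apply: bilin => z'; apply: (linear_comp lrr); lin.
  rewrite big_map big_filter [RHS]big_mkcond /= [LHS]big_seq [RHS]big_seq.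
  apply: eq_bigr => t /hs[h1t h2t]; rewrite (tmap_tens _ _ lr lr).
  case: asboolP => // nat.
  have [bd|->] := cocentral_or h1t; first by case: nat; apply: annMr bd ab.
  by rewrite tens0r (lin0 lr) tens0l.
- split => //; exists (hone DH); split; [exact: bg_one bg|exact: val_one|left].
  by rewrite mulg1.
- move=> [a b] [a2 c] z [a' b'] [a2' c'] w /h1P[-> [x [hx vz ab]]] /h1P[-> [x' [hx' vw ab']]].
  split => //; exists (hmul DH x x'); split; first exact: bg_mul bg _ _ _ _ _ _ hx hx'.
  + by rewrite val_mul vz vw galgH_mul.
  + have bH := hopf_mul_bilinear hH.
    case: ab => [ab|->]; last by right; rewrite (lin0 (bH.1 _)).
    case: ab' => [ab'|->]; last by right; rewrite (lin0 (bH.2 _)).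
    left; rewrite /= mulgA -[(a * a' * b)%g]mulgA (dual_mulC a' b) mulgA.
    rewrite -[(_ * a' * b')%g]mulgA; exact: annM.
- move=> [a b] [a' c] z /h1P[-> [x [hx vz ab]]]; split => //.
  exists (hstar DH x); split; first exact: bg_star bg _ _ _ hx.
  + by rewrite val_star vz galgH_star.
  + case: ab => [ab|->]; last by right; exact: (lin0 (linear_star hH)).
    by left; rewrite /= -invgM dual_mulC; apply: annV.
- move=> [a b] [a' c] z /h1P[-> [x [hx vz ab]]]; split => //.
  exists (hanti DH x); split; first exact: bg_anti bg _ _ _ hx.
  + by rewrite val_anti vz galgH_anti.
  + case: ab => [ab|->]; last by right; exact: (lin0 (hopf_anti_linear hH)).
    have [bc|->] := cocentral_or hx; last by right; exact: (lin0 (hopf_anti_linear hH)).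
    by left; rewrite /= -invgM dual_mulC; apply: annV; apply: annMr bc ab.
- move=> [a b] [a' c] z /h1P[-> [x [hx vz ab]]] abac.
  rewrite [LHS](_ : _ = hcounit TH (val z))// vz galgH_counit.
  by apply: (bg_counit bg hx); apply: contra abac => /eqP ->.
Qed.

(** * The Hopf *-algebra C[T/T_0] ⋉ H, by transport of structure *)

Local Notation D2 := (smash_ops DH pi T0).

Let val_inj2 : injective (tmap val val : tensor V1 V1 -> _).
Proof.
apply: (can_inj (g := tmap r r)) => u; rewrite (tmap_comp _ _ _ lr lr).
by rewrite -[RHS]tmap_id; apply: eq_tlift => v w; rewrite !valK'.
Qed.

Local Notation DQ := (@galg_ops C (qdual R T0)).
Local Notation QH := (tensor_ops DQ DH).

Let bQ : bil (hmul DQ).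
Proof.
apply: bilin => z; first exact: glin_linear.
by apply: linear_glin => a; exact: glin_linear.
Qed.
Let bH : bil (hmul DH) := hopf_mul_bilinear hH.
Let bD2 : bil (hmul D2) := tensor_mul_bil bQ bH.

Let smash_mulE (a a' : qdual R T0) x x' :
  hmul D2 (gbase a ⊗ x) (gbase a' ⊗ x') = gbase (a * a')%g ⊗ hmul DH x x'.
Proof. by rewrite [LHS](tensor_mulE bQ bH) galg_mulE. Qed.

Let smash_comul_arg (a : qdual R T0) b c x1 x2 :=
  \sum_(d \in [set: That])
      (gbase a ⊗ bicomp DH pi b d x1)
      ⊗ (qbase T0 (val a * b^-1 * d)%g ⊗ bicomp DH pi d c x2) : tensor X X.

Let smash_comul_arg_bil a b c : bil (smash_comul_arg a b c).
Proof.
have lb := bicomp_linear; apply: bilin => y.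
- apply: linear_fsum => [d|x]; first by have := lb b d; move=> ?; lin.
  have [r0 hr0] := bicomp_suppr x; exists r0 => d dr.
  by rewrite hr0// tens0r tens0l.
- apply: linear_fsum => [d|x]; first by have := lb d c; move=> ?; lin.
  have [r0 hr0] := bicomp_suppl x; exists r0 => d dr.
  by rewrite hr0// !tens0r.
Qed.

Let l_smash_comul_arg (a : qdual R T0) b c : linear (sw2 DH (smash_comul_arg a b c)).
Proof. exact: linear_sw2 hH (smash_comul_arg_bil a b c). Qed.

Let smash_comul_linear : linear (hcomul D2).
Proof. exact: (smash_lift_linear l_smash_comul_arg). Qed.

Let smash_comulE (a : qdual R T0) b c x : hom b c x -> hcomul D2 (gbase a ⊗ x) =
  sw2 DH (smash_comul_arg a b c) x.
Proof. by move=> hx; apply: (smash_lift_hom l_smash_comul_arg a hx). Qed.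

Let smash_comul_argE (a : qdual R T0) b c d x1 x2 : hom b d x1 -> hom d c x2 ->
  smash_comul_arg a b c x1 x2
  = (gbase a ⊗ x1) ⊗ (qbase T0 (val a * b^-1 * d)%g ⊗ x2).
Proof.
move=> h1x h2x; rewrite /smash_comul_arg (@fsum_one _ _ d).
  by rewrite (bicomp_hom _ _ h1x) (bicomp_hom _ _ h2x) !eqxx !scale1r.
by move=> d' dd'; rewrite (bicomp_hom _ _ h1x) (negPf dd') andbF scale0r tens0r tens0l.
Qed.

Let lPP : linear (tmap Psi0 Psi0) := tmap_linear lPsi0 lPsi0.

Let Psi_mul u v : Psi (hmul D2 u v) = hmul D1 (Psi u) (Psi v).
Proof.
apply: val_inj; rewrite val_mul !val_Psi; move: u.
apply: smash_ext; [exact: linear_comp lPsi0 (bD2.1 _)|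
  exact: linear_comp (bT.1 _) lPsi0|move=> a b c x hx].
move: v; apply: smash_ext; [exact: linear_comp lPsi0 (bD2.2 _)|
  exact: linear_comp (bT.2 _) lPsi0|move=> a' b' c' x' hx'].
rewrite smash_mulE (Psi0E _ (bg_mul bg hx hx')) (Psi0E _ hx) (Psi0E _ hx') galgH_mul.
congr (gbase _ ⊗ _); rewrite invgM (dual_mulC b'^-1%g) -![in LHS]mulgA -[RHS]mulgA.
by congr (_ * _)%g; rewrite mulgA (dual_mulC (val a')) -mulgA.
Qed.

Let Psi_one : Psi (hone D2) = hone D1.
Proof.
by apply: val_inj; rewrite val_one val_Psi [LHS](Psi0E _ (bg_one bg)) invg1 mulg1.
Qed.

(** The second leg has left degree d, so [Psi0] turns its factor ab^-1 d into ab^-1, the same as on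
    the first leg: the coproduct becomes that of C[T] ⊗ H. *)
Let Psi_comul u : hcomul D1 (Psi u) = tmap Psi Psi (hcomul D2 u).
Proof.
apply: val_inj2; rewrite val_comul val_Psi (tmap_comp _ _ _ lval lval).
have -> : tmap (fun v => val (Psi v)) (fun v => val (Psi v)) (hcomul D2 u) =
    tmap Psi0 Psi0 (hcomul D2 u).
  by apply: eq_tlift => v w; rewrite !val_Psi.
move: u; apply: smash_ext; [exact: linear_comp lcT lPsi0|
  exact: linear_comp lPP smash_comul_linear|move=> a b c x hx].
rewrite (Psi0E _ hx) galgH_comul (smash_comulE _ hx) (lin_sw2 _ _ lPP).
have ba := smash_comul_arg_bil a b c.
apply: (bg_sw2 bg _ _ hx).
- by lin.
- by apply: bilin => z; apply: (linear_comp lPP); [exact: ba.1|exact: ba.2].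
move=> d x1 x2 hx1 hx2; rewrite (smash_comul_argE _ hx1 hx2) (tmap_tens _ _ lPsi0 lPsi0).
rewrite (Psi0E _ hx1).
have [bd|->] := cocentral_or hx1; last by rewrite !tens0r !tens0l.
rewrite (Psi0_qbase _ hx2) -?mulgA ?mulgV ?mulg1//.
rewrite mulgA; apply: (annMr bd); rewrite -mulgA mulVg mulg1; exact: qdual_ann.
Qed.

Let leD2 : linear (hcounit D2 : X -> C^o).
Proof.
apply: tlift_linear; have l1 := hopf_counit_linear hH : linear (hcounit DH : H -> C^o).
by have l2 := glin_linear (fun=> 1 : C^o) : linear (hcounit DQ : CQ -> C^o); lin.
Qed.

Let smash_counitE (a : qdual R T0) x : hcounit D2 (gbase a ⊗ x) = hcounit DH x.
Proof.
rewrite [LHS](tlift_tens (U := C^o)) ?galg_counitE ?mul1r//.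
have l1 := hopf_counit_linear hH : linear (hcounit DH : H -> C^o).
by have l2 := glin_linear (fun=> 1 : C^o) : linear (hcounit DQ : CQ -> C^o); lin.
Qed.

Let Psi_counit u : hcounit D1 (Psi u) = hcounit D2 u.
Proof.
rewrite [LHS](_ : _ = hcounit TH (val (Psi u)))// val_Psi; move: u.
apply: (smash_ext (U := C^o)); [exact: linear_comp leT lPsi0|exact: leD2|move=> a b c x hx].
by rewrite (Psi0E _ hx) galgH_counit smash_counitE.
Qed.

Let smash_anti_arg_linear (a : qdual R T0) b c :
  linear (fun x => qbase T0 (val a * b^-1 * c)^-1%g ⊗ hanti DH x).
Proof. by lin. Qed.

Let laD2 : linear (hanti D2).
Proof. exact: smash_lift_linear smash_anti_arg_linear. Qed.

Let smash_antiE (a : qdual R T0) b c x : hom b c x ->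
  hanti D2 (gbase a ⊗ x) = qbase T0 (val a * b^-1 * c)^-1%g ⊗ hanti DH x.
Proof. by move=> hx; apply: (smash_lift_hom smash_anti_arg_linear a hx). Qed.

Let ann_shift (a : qdual R T0) b c : agree_on T0 b c -> ann (val a * b^-1 * c)%g.
Proof.
by move=> bc; apply: (annMr bc); rewrite -mulgA mulVg mulg1; exact: qdual_ann.
Qed.

(** S(x) has left degree c^-1, so [Psi0] multiplies (ab^-1 c)^-1 by c, which leaves the inverse of
    ab^-1. *)
Let Psi_anti u : Psi (hanti D2 u) = hanti D1 (Psi u).
Proof.
apply: val_inj; rewrite val_anti !val_Psi; move: u.
apply: smash_ext; [exact: linear_comp lPsi0 laD2|exact: linear_comp laT lPsi0|].
move=> a b c x hx; rewrite (smash_antiE _ hx) (Psi0E _ hx) galgH_anti.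
have [bc|->] := cocentral_or hx; last first.
  by rewrite (lin0 (hopf_anti_linear hH)) !tens0r (lin0 lPsi0).
rewrite (Psi0_qbase (annV (ann_shift a bc)) (bg_anti bg hx)); congr (gbase _ ⊗ _).
by rewrite invgK invgM dual_mulC mulgA mulgV mul1g.
Qed.

Let lsQ : linear (hstar DQ : CQ -> conjmod CQ).
Proof. exact: gantilin_linear. Qed.

Let lsH := linear_star hH.

Let lsD2 : linear (hstar D2 : X -> conjmod X).
Proof. exact: tmap_conj_linear lsQ lsH. Qed.

Let smash_starE (a : qdual R T0) x : hstar D2 (gbase a ⊗ x) = gbase a^-1%g ⊗ hstar DH x.
Proof. by rewrite [LHS](tmap_conj_tens _ _ lsQ lsH) galg_starE. Qed.

Let Psi_star u : Psi (hstar D2 u) = hstar D1 (Psi u).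
Proof.
apply: val_inj; rewrite val_star !val_Psi; move: u.
apply: (smash_ext (U := conjmod _)); [exact: antilinear_comp' lPsi0 lsD2|
  exact: antilinear_comp lsT lPsi0|].
move=> a b c x hx; rewrite smash_starE (Psi0E _ (bg_star bg hx)) (Psi0E _ hx) galgH_star.
by congr (gbase _ ⊗ _); rewrite invgM dual_mulC.
Qed.

(** Pulled back from the invariants along [Psi], with [f] as retraction. *)
Let hD2 : is_hopf_star D2.
Proof.
exact: (is_hopf_star_pullback lPsi lf PsiK hD1 Psi_mul Psi_one
  Psi_comul Psi_counit Psi_anti Psi_star).
Qed.

(* For this grading, transported from the diagonal invariants, [J2] acts as [J1]. *)
Let h2 (p q : G2) u := h1 p q (Psi u).

Let f_comul z : hcomul D2 (f z) = tmap f f (hcomul D1 z).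
Proof.
rewrite -[in RHS](fK z) Psi_comul (tmap_comp _ _ _ lf lf) -[LHS]tmap_id.
by apply: eq_tlift => u v; rewrite !PsiK.
Qed.

Let bg2 : bigraded D2 h2.
Proof.
split.
- move=> P P0 PD u; rewrite -(PsiK u); move: (Psi u).
  apply: (bg_ind bg1); first by rewrite (lin0 lf).
  move=> p q x y hx Py; rewrite (linD lf); apply: PD Py; rewrite /h2 fK; exact: hx.
- move=> p q u /(bg_comul bg1)[s [hs dx]].
  exists [seq (t.1.1, f t.1.2, f t.2) | t <- s]; split.
    by move=> t /mapP[t0 /hs[h1t h2t] ->] /=; rewrite /h2 !fK.
  rewrite big_map -[in LHS](PsiK u) f_comul dx (lin_sum _ _ (tmap_linear lf lf)).
  by apply: eq_bigr => t _; rewrite (tmap_tens _ _ lf lf).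
- by rewrite /h2 Psi_one; exact: bg_one bg1.
- by move=> p q u p' q' v hu hv; rewrite /h2 Psi_mul; exact: bg_mul bg1 _ _ _ _ _ _ hu hv.
- by move=> p q u hu; rewrite /h2 Psi_star; exact: bg_star bg1 _ _ _ hu.
- by move=> p q u hu; rewrite /h2 Psi_anti; exact: bg_anti bg1 _ _ _ hu.
- by move=> p q u hu pq; rewrite -Psi_counit; exact: bg_counit bg1 _ _ _ hu pq.
Qed.

(** * The two cocycles as values of one bicharacter, and their twists *)

Variable beta : That -> That -> R[i].
Hypothesis hbeta : is_bichar beta.

Let bN : forall b c, `|beta b c| = 1 := bichar_norm hbeta.
Let bMl := bicharMl hbeta.
Let bMr := bicharMr hbeta.
Let b0 := bichar_neq0 bN.
Let bVl := bicharVl bN bMl.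
Let bVr := bicharVr bN bMr.
Let b1r := bichar1r bN bMr.
Let bC := bichar_conj bN.

Let J (p q : G2) : C := J1 beta p q.

Let JN (p q : G2) : `|J p q| = 1. Proof. by rewrite /J /J1 norm_conjC; apply: bN. Qed.
Let JMl (p p' q : G2) : J (p * p')%g q = J p q * J p' q.
Proof. by rewrite /J /J1 /= bMl rmorphM. Qed.
Let JMr (p q q' : G2) : J p (q * q')%g = J p q * J p q'.
Proof. by rewrite /J /J1 /= bMr rmorphM. Qed.

Local Notation j1 := (diag_cocycle (DH := DH) (pi := pi) beta (T0 := T0)).
Local Notation j2 := (smash_cocycle pi beta (T0 := T0)).
Let lpi : linear pi := hopf_hom_linear hpi.
Let lidT : linear (id : CT -> CT). Proof. by []. Qed.
Let lincl : linear (galg_incl (T0 := T0) : CQ -> CT). Proof. exact: glin_linear. Qed.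

Let bj1 : bil (j1 : V1 -> V1 -> C^o).
Proof.
have bf := galg2_form_bil (C := C) (J1 beta).
have lv : linear (fun z : V1 => tmap id pi (val z)).
  exact: linear_comp (tmap_linear lidT lpi) lval.
by apply: bilin => z; [exact: linear_comp (bf.1 _) lv|exact: linear_comp (bf.2 _) lv].
Qed.

Let bj2 : bil (j2 : X -> X -> C^o).
Proof.
have bf := galg2_form_bil (C := C) (J2 beta).
have lv := tmap_linear lincl lpi.
by apply: bilin => z; [exact: linear_comp (bf.1 _) lv|exact: linear_comp (bf.2 _) lv].
Qed.

Let h1_pi (a a' : That) b c z : h1 (a, b) (a', c) z ->
  tmap id pi (val z) = hcounit D1 z *: (gbase a ⊗ gbase b).
Proof.
move=> /h1P[_ [x [hx vz _]]]; rewrite [hcounit D1 z](_ : _ = hcounit TH (val z))//.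
rewrite vz galgH_counit (tmap_tens _ _ lidT lpi).
by rewrite (bihom_pi hH hpi hx).1 tensZr.
Qed.

(** In the transported grading an element of left degree (a, b) is ab ⊗ x with x of left degree b,
    and pi(x) = eps(x) b. *)
Let h2_pi (a a' : That) b c u : h2 (a, b) (a', c) u ->
  tmap (galg_incl (T0 := T0)) pi u = hcounit D2 u *: (gbase (a * b)%g ⊗ gbase b).
Proof.
move=> hu; rewrite -Psi_counit; have /h1P[_ [x [hx vz ab]]] := hu.
rewrite -{1}(PsiK u) /f vz (PhiE _ hx).
rewrite [hcounit D1 _](_ : _ = hcounit TH (val (Psi u)))// vz galgH_counit.
case: ab => [/qbase_ann[a0 <- ->]|->]; last first.
  rewrite tens0r (lin0 (tmap_linear lincl lpi)).
  by rewrite (lin0 (hopf_counit_linear hH : linear (hcounit DH : H -> C^o))) scale0r.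
rewrite (tmap_tens _ _ lincl lpi) [galg_incl _]glin_base.
by rewrite (bihom_pi hH hpi hx).1 tensZr.
Qed.

Let j1E (p q : G2) z (p' q' : G2) w : h1 p q z -> h1 p' q' w ->
  j1 z w = J p p' * (hcounit D1 z * hcounit D1 w).
Proof.
case: p q p' q' => [a b] [a2 c] [a' b'] [a2' c'] hz hw.
have bf := galg2_form_bil (C := C) (J1 beta).
rewrite /diag_cocycle (h1_pi hz) (h1_pi hw).
rewrite (linZ (bf.1 _)) (linZ (bf.2 _)) galg2_formE.
by rewrite /GRing.scale /= /J mulrA mulrC.
Qed.

(** By [h2_pi], [J2] is evaluated at (ab, b) and (a'b', b'), where it divides a'b' by b' and returns
    the conjugate of beta(b, a'). *)
Let j2E (p q : G2) u (p' q' : G2) v : h2 p q u -> h2 p' q' v ->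
  j2 u v = J p p' * (hcounit D2 u * hcounit D2 v).
Proof.
case: p q p' q' => [a b] [a2 c] [a' b'] [a2' c'] hu hv.
have bf := galg2_form_bil (C := C) (J2 beta).
rewrite /smash_cocycle (h2_pi hu) (h2_pi hv).
rewrite (linZ (bf.1 _)) (linZ (bf.2 _)) galg2_formE.
rewrite (_ : J2 beta _ _ = J (a, b) (a', b')); last first.
  by rewrite /J /J1 /J2 /= -mulgA mulgV mulg1.
by rewrite {1 2}/GRing.scale [LHS]/= mulrA mulrC.
Qed.

Lemma diag_cocycle_unitary : unitary_hopf_cocycle D1 j1.
Proof. exact: (bichar_cocycle hD1 bg1 JN JMl JMr bj1 j1E). Qed.

Lemma smash_cocycle_unitary : unitary_hopf_cocycle D2 j2.
Proof. exact: (bichar_cocycle hD2 bg2 JN JMl JMr bj2 j2E). Qed.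

Local Notation tw1 := (twist_ops D1 j1).
Local Notation tw2 := (twist_ops D2 j2).

Let h2_gen (a : qdual R T0) b c x : hom b c x ->
  h2 ((val a * b^-1)%g, b) ((val a * b^-1)%g, c) (gbase a ⊗ x).
Proof.
move=> hx; split => //; exists x; split=> //; first by rewrite val_Psi (Psi0E _ hx).
by left; rewrite /= -mulgA mulVg mulg1; exact: qdual_ann.
Qed.

Let tw2_mul_bil := twist_mul_bil hD2 bg2 JN bj2 j2E.
Let tw2_mulE := twist_mulE hD2 bg2 JN bj2 j2E.
Let tw2_anti_linear := twist_anti_linear hD2 bg2 JN JMr bj2 j2E.
Let tw2_antiE := twist_antiE hD2 bg2 JN JMr bj2 j2E.
Let tw2_star_linear := twist_star_antilinear hD2 bg2 JN JMr bj2 j2E.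
Let tw2_starE := twist_starE hD2 bg2 JN JMr bj2 j2E.
Let htw2 := twist_is_hopf_star hD2 bg2 JN JMl JMr bj2 j2E.
Let tw1_mul_bil := twist_mul_bil hD1 bg1 JN bj1 j1E.
Let tw1_mulE := twist_mulE hD1 bg1 JN bj1 j1E.
Let tw1_anti_linear := twist_anti_linear hD1 bg1 JN JMr bj1 j1E.
Let tw1_antiE := twist_antiE hD1 bg1 JN JMr bj1 j1E.
Let tw1_star_linear := twist_star_antilinear hD1 bg1 JN JMr bj1 j1E.
Let tw1_starE := twist_starE hD1 bg1 JN JMr bj1 j1E.
Let htw1 := twist_is_hopf_star hD1 bg1 JN JMl JMr bj1 j1E.

(** The parameter sits in the maps while x is fixed, so one finite set of degrees of x serves all
    parameters; vanishing at 0 discards the other terms. *)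
Let bilift_param_linear U (Y : lmodType C) (F : Y -> That -> That -> H -> U) x :
  (forall b c y, linear (fun v => F v b c y)) -> (forall v b c, F v b c 0 = 0) ->
  linear (fun v => bilift DH pi (F v) x).
Proof.
move=> lF F0; apply: (linear_fsum
  (F := fun bc v => F v bc.1 bc.2 (bicomp DH pi bc.1 bc.2 x))) => [bc|v].
  exact: lF.
have [[r1 hr1] [r2 hr2]] := (bicomp_suppl x, bicomp_suppr x).
exists [seq (b, c) | b <- r1, c <- r2] => -[b c] /= bcr.
have [br|br] := boolP (b \in r1); last by rewrite hr1// F0.
have [cr|cr] := boolP (c \in r2); last by rewrite hr2// F0.
by case/negP: bcr; apply/allpairsP; exists (b, c).
Qed.

(** * The bosonization as the twist of C[T/T_0] ⋉ H *)

Let trmul_arg b c x' y : H :=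
  bilift DH pi (fun d e y' => beta (b^-1 * c)%g d^-1%g *: hmul DH x' y') y.

Let trmul_arg_bil b c : bil (trmul_arg b c).
Proof.
apply: bilin => y.
- apply: bilift_param_linear => [d e z|v d e]; first by lin.
  by rewrite (lin0 (bH.2 _)) scaler0.
- by apply: bilift_linear => d e; lin.
Qed.

Let trmul_bil : bil (trmul DH pi beta).
Proof.
apply: bilin => y.
- by apply: bilift_linear => b c; exact: (trmul_arg_bil b c).1.
- apply: bilift_param_linear => [b c z|v b c]; first exact: (trmul_arg_bil b c).2.
  exact: (lin0 ((trmul_arg_bil b c).1 v)).
Qed.

Let trmulE b c x d e x' : hom b c x -> hom d e x' ->
  trmul DH pi beta x x' = beta (b^-1 * c)%g d^-1%g *: hmul DH x x'.
Proof.
move=> hx hx'; rewrite /trmul.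
rewrite (bilift_hom (F := fun a b x' => bilift DH pi (fun c d y' =>
    beta (a^-1 * b)%g c^-1%g *: hmul DH x' y') _) _ hx); last first.
  by move=> a' b'; exact: (lin0 ((trmul_arg_bil a' b').1 _)).
rewrite (bilift_hom (F := fun d e y' => beta (b^-1 * c)%g d^-1%g *: hmul DH x y') _ hx')//.
by move=> a' b'; rewrite (lin0 (bH.2 _)) scaler0.
Qed.

Let boson_arg (v : X) (a : qdual R T0) b c x : X :=
  tlift (fun f' x' => glin (fun a' : qdual R T0 =>
    beta (b^-1 * c)%g (val a') *: (gbase (a * a')%g ⊗ trmul DH pi beta x x')) f') v.

Let boson_arg_bil (a : qdual R T0) b c x : bil (fun (f' : CQ) x' =>
  glin (fun a' : qdual R T0 =>
    beta (b^-1 * c)%g (val a') *: ((gbase (a * a')%g : CQ) ⊗ trmul DH pi beta x x')) f').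
Proof.
have bt := trmul_bil; apply: bilin => z; first exact: glin_linear.
by apply: linear_glin => a'; lin.
Qed.

Let boson_arg_linear v (a : qdual R T0) b c : linear (boson_arg v a b c).
Proof.
have bt := trmul_bil; apply: linear_tlift => f' x'; apply: linear_glin => a'; lin.
Qed.

Let boson_mul_bil : bil (boson_mul DH pi (T0 := T0) beta).
Proof.
apply: bilin => v.
- exact: (smash_lift_linear (boson_arg_linear v)).
- apply: linear_tlift => f' x'; apply: linear_glin => a.
  apply: bilift_param_linear => [b c y|w b c].
    exact: (tlift_linear (boson_arg_bil a b c y)).
  exact: (lin0 (boson_arg_linear w a b c)).
Qed.

Let boson_mulZl (k : C) (u v : X) : boson_mul DH pi beta (k *: u) v = k *: boson_mul DH pi beta u v.
Proof. exact: (linZ (boson_mul_bil.1 v)). Qed.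

Let boson_mulE (a : qdual R T0) b c x (a' : qdual R T0) b' c' x' :
  hom b c x -> hom b' c' x' ->
  boson_mul DH pi beta (gbase a ⊗ x) (gbase a' ⊗ x')
  = (beta (b^-1 * c)%g (val a') * beta (b^-1 * c)%g b'^-1%g)
    *: (gbase (a * a')%g ⊗ hmul DH x x').
Proof.
move=> hx hx'; rewrite [LHS](smash_lift_hom (boson_arg_linear _) a hx).
rewrite /boson_arg (tlift_tens _ _ (boson_arg_bil a b c x)) glin_base (trmulE hx hx').
by rewrite tensZr scalerA.
Qed.

(** The twisting scalar is beta(b^-1 c, a' b'^-1): its a'-part is the commutation factor of the
    bosonization, its b'-part the factor of the transmuted product. *)
Let boson_mul_twist u v : boson_mul DH pi beta u v = hmul tw2 u v.
Proof.
move: u; apply: smash_ext; [exact: boson_mul_bil.1|exact: tw2_mul_bil.1|move=> a b c x hx].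
move: v; apply: smash_ext; [exact: boson_mul_bil.2|exact: tw2_mul_bil.2|].
move=> a' b' c' x' hx'; rewrite (boson_mulE _ _ hx hx').
rewrite (tw2_mulE (h2_gen _ hx) (h2_gen _ hx')) smash_mulE.
apply: (congr1 (fun k : C => k *: (gbase (a * a')%g ⊗ hmul DH x x' : X))).
rewrite /J /J1 /= !bC !bMl !bMr !bVl !bVr.
have := b0 b (val a'); have := b0 b b'; have := b0 c (val a'); have := b0 c b'.
by move=> *; field; repeat (apply/andP; split).
Qed.

Let tranti_linear : linear (tranti DH pi beta).
Proof. by apply: bilift_linear => b c; lin. Qed.

Let trantiE b c x : hom b c x ->
  tranti DH pi beta x = beta (b^-1 * c)%g c *: hanti DH x.
Proof.
move=> hx; apply: (bilift_hom (F := fun b c x => beta (b^-1 * c)%g c *: hanti DH x) _ hx).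
by move=> *; rewrite (lin0 (hopf_anti_linear hH)) scaler0.
Qed.

Let boson_anti_arg_linear (a : qdual R T0) b c : linear (fun x =>
  boson_mul DH pi beta (gbase (1%g : qdual R T0) ⊗ tranti DH pi beta x)
    (qbase T0 (val a * b^-1 * c)^-1%g ⊗ hone DH)).
Proof.
apply: (linear_comp (boson_mul_bil.1 _)).
exact: (linear_comp ((tens_bil _ _).2 _) tranti_linear).
Qed.

(** The transmuted antipode gives beta(b^-1 c, c) and the product with (ab^-1 c)^-1 gives beta(b^-1
    c, a^-1 b c^-1). Together they are beta(b^-1 c, a^-1 b), the scalar of the twisted antipode. *)
Let boson_anti_twist u : hanti (boson_ops DH pi T0 beta) u = hanti tw2 u.
Proof.
move: u; apply: smash_ext; [exact: smash_lift_linear boson_anti_arg_linear|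
  exact: tw2_anti_linear|move=> a b c x hx].
rewrite [LHS](smash_lift_hom boson_anti_arg_linear a hx).
rewrite (tw2_antiE (h2_gen _ hx)) (smash_antiE _ hx) (trantiE hx).
have [bc|->] := cocentral_or hx; last first.
  rewrite (lin0 (hopf_anti_linear hH)) scaler0 !tens0r scaler0.
  exact: (lin0 (boson_mul_bil.1 _)).
have [a0 va0 ->] := qbase_ann (annV (ann_shift a bc)).
rewrite [X in boson_mul DH pi beta X _]tensZr boson_mulZl.
rewrite (boson_mulE _ _ (bg_anti bg hx) (bg_one bg)) [LHS]scalerA mul1g (hopf_1mul hH) va0.
apply: (congr1 (fun k : C => k *: (gbase a0 ⊗ hanti DH x : X))).
rewrite /J /J1 /= !bC invg1 b1r mulr1 !invgM !invgK !bMl !bMr !bVl !bVr.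
have := b0 b (val a); have := b0 b b; have := b0 c (val a); have := b0 c b.
have := b0 b c; have := b0 c c.
by move=> *; field; repeat (apply/andP; split).
Qed.

Let trstar_linear : linear (trstar DH pi beta : H -> conjmod H).
Proof.
apply: (bilift_linear (U := conjmod H)) => b c.
exact: (antilinear_comp' (@linear_scale _ _ _ _ _ (@linear_id _ _)) lsH).
Qed.

Let trstarE b c x : hom b c x ->
  trstar DH pi beta x = beta (b^-1 * c)%g b^-1%g *: hstar DH x.
Proof.
move=> hx; apply: (bilift_hom (F := fun b c x => beta (b^-1 * c)%g b^-1%g *: hstar DH x) _ hx).
by move=> *; rewrite (lin0 lsH) scaler0.
Qed.

Let boson_star_arg (a : qdual R T0) b c x : X :=
  beta (b^-1 * c)%g (val a) *: (gbase a^-1%g ⊗ trstar DH pi beta x).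

Let boson_star_arg_linear (a : qdual R T0) b c :
  linear (boson_star_arg a b c : H -> conjmod X).
Proof.
apply: (antilinear_comp' (@linear_scale _ _ _ _ _ (@linear_id _ _))).
exact: (antilinear_comp' ((tens_bil _ _).2 _) trstar_linear).
Qed.

Let boson_star_bil : bil ((fun f x => gantilin (fun a : qdual R T0 =>
  bilift DH pi (boson_star_arg a) x) f) : CQ -> H -> conjmod X).
Proof.
apply: bilin => z; first exact: gantilin_linear.
apply: (linear_gantilin (F := fun a x => bilift DH pi (boson_star_arg a) x : conjmod X)) => a.
apply: (bilift_linear (U := conjmod X)) => b c; exact: boson_star_arg_linear.
Qed.

(** Both sides carry beta(b^-1 c, ab^-1): in the bosonization it splits into the commutation factor
    at a and the transmuted involution's factor at b^-1. *)
Let boson_star_twist u : hstar (boson_ops DH pi T0 beta) u = hstar tw2 u.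
Proof.
move: u; apply: (smash_ext (U := conjmod X));
  [exact: tlift_linear boson_star_bil|exact: tw2_star_linear|move=> a b c x hx].
rewrite [LHS](tlift_tens _ _ boson_star_bil) gantilin_base.
rewrite (bilift_hom _ hx); last by move=> b' c'; exact: (lin0 (boson_star_arg_linear a b' c')).
rewrite /boson_star_arg (trstarE hx) [in LHS]tensZr [LHS]scalerA.
rewrite (tw2_starE (h2_gen _ hx)) smash_starE.
apply: (congr1 (fun k : C => k *: (gbase a^-1%g ⊗ hstar DH x : X))).
rewrite /J /J1 /= !bC !bMl !bMr !bVl !bVr.
have := b0 b (val a); have := b0 b b; have := b0 c (val a); have := b0 c b.
by move=> *; field; repeat (apply/andP; split).
Qed.

Lemma boson_ops_twist : boson_ops DH pi T0 beta = tw2.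
Proof.
(* Unit, coproduct and counit of the two structures coincide by computation; [mk] isolates the three
   operations that have to be rewritten. *)
pose mk m s t : hopf_ops (C := C) X := HopfOps m (hone D2) (hcomul D2) (hcounit D2) s t.
have mE : boson_mul DH pi beta = hmul tw2.
  by apply/funext => u; apply/funext => v; exact: boson_mul_twist.
have sE : hanti (boson_ops DH pi T0 beta) = hanti tw2.
  by apply/funext => u; exact: boson_anti_twist.
have tE : hstar (boson_ops DH pi T0 beta) = hstar tw2.
  by apply/funext => u; exact: boson_star_twist.
transitivity (mk (boson_mul DH pi beta) (hanti (boson_ops DH pi T0 beta))
  (hstar (boson_ops DH pi T0 beta))); first by [].
by rewrite mE sE tE.
Qed.

Lemma smash_twist_iso : hopf_star_iso tw2 (boson_ops DH pi T0 beta) id.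
Proof.
have lid : linear (id : X -> X) := @linear_id C X.
rewrite boson_ops_twist; split; last exact: (Bijective (fun=> erefl) (fun=> erefl)).
exact: (HopfStarHom htw2 htw2 lid (fun _ _ => erefl) erefl
  (fun u => esym (tmap_id (hcomul D2 u))) (fun=> erefl) (fun=> erefl) (fun=> erefl)).
Qed.

(** * The isomorphism from the twisted diagonal invariants *)

Let f_one : f (hone D1) = hone D2. Proof. by rewrite -Psi_one PsiK. Qed.
Let f_mul z w : f (hmul D1 z w) = hmul D2 (f z) (f w).
Proof. by rewrite -[z in LHS]fK -[w in LHS]fK -Psi_mul PsiK. Qed.
Let f_anti z : f (hanti D1 z) = hanti D2 (f z).
Proof. by rewrite -[z in LHS]fK -Psi_anti PsiK. Qed.
Let f_star z : f (hstar D1 z) = hstar D2 (f z).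
Proof. by rewrite -[z in LHS]fK -Psi_star PsiK. Qed.
Let f_counit z : hcounit D2 (f z) = hcounit D1 z.
Proof. by rewrite -Psi_counit fK. Qed.

Let h1_f (p q : G2) z : h1 p q z -> h2 p q (f z).
Proof. by rewrite /h2 fK. Qed.

(** [f] preserves both the original product and the degrees, and the two twists use the same scalars
    on equal degrees. *)
Let f_twist_mul z w : f (hmul tw1 z w) = hmul tw2 (f z) (f w).
Proof.
move: z; apply: (bg_ext bg1); [exact: linear_comp lf (tw1_mul_bil.1 _)|
  exact: linear_comp (tw2_mul_bil.1 _) lf|move=> p q z hz].
move: w; apply: (bg_ext bg1); [exact: linear_comp lf (tw1_mul_bil.2 _)|
  exact: linear_comp (tw2_mul_bil.2 _) lf|move=> p' q' w hw].
by rewrite (tw1_mulE hz hw) (tw2_mulE (h1_f hz) (h1_f hw)) (linZ lf) f_mul.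
Qed.

Let f_twist_anti z : f (hanti tw1 z) = hanti tw2 (f z).
Proof.
move: z; apply: (bg_ext bg1); [exact: linear_comp lf tw1_anti_linear|
  exact: linear_comp tw2_anti_linear lf|move=> p q z hz].
by rewrite (tw1_antiE hz) (tw2_antiE (h1_f hz)) (linZ lf) f_anti.
Qed.

Let f_twist_star z : f (hstar tw1 z) = hstar tw2 (f z).
Proof.
move: z; apply: (bg_ext (U := conjmod X) bg1);
  [exact: antilinear_comp' lf tw1_star_linear|
  exact: antilinear_comp tw2_star_linear lf|move=> p q z hz].
by rewrite (tw1_starE hz) (tw2_starE (h1_f hz)) (linZ lf) f_star.
Qed.

Lemma diag_twist_iso : hopf_star_iso tw1 (boson_ops DH pi T0 beta) f.
Proof.
rewrite boson_ops_twist; split; last exact: (Bijective fK PsiK).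
exact: (HopfStarHom htw1 htw2 lf f_twist_mul f_one f_comul f_counit
  f_twist_anti f_twist_star).
Qed.

(** Ties [f] to the formula a pi(x_(1)) # x_(2). The comparison takes place in C[T] ⊗ H because the
    formula lands in C[T/T_0] ⊗ H only on invariants: for x in H_{b,c} it gives ab ⊗ x, with ab
    trivial on T_0. *)
Lemma incl_diag_map z :
  tmap (galg_incl (T0 := T0)) id (f z) = shift_map DH pi (val z).
Proof.
have lid : linear (id : H -> H) by [].
have bM := hopf_mul_bilinear hT.
have bs : bil (fun f x => sw2 DH (fun x1 x2 => hmul DT f (pi x1) ⊗ x2) x).
  have lp := lpi; apply: bilin => y; first by apply: linear_tlift => x1 x2; lin.
  by apply: (linear_sw2 hH); lin.
move: z; apply: diag_ext.
- exact: linear_comp (tmap_linear lincl lid) lf.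
- exact: linear_comp (tlift_linear bs) lval.
move=> a b c x z ab hx vz; rewrite /f vz (PhiE _ hx).
have [a0 va0 ->] := qbase_ann ab.
rewrite (tmap_tens _ _ lincl lid) [galg_incl _]glin_base va0.
rewrite /shift_map (tlift_tens _ _ bs).
have bm : bil (fun (g : CT) (x : H) => hmul DT (gbase a) g ⊗ x) by lin.
transitivity (tlift (fun (g : CT) (x : H) => hmul DT (gbase a) g ⊗ x)
    (tmap pi id (hcomul DH x))); last by rewrite tlift_tmap.
by rewrite hx.1 tlift_tens// galg_mulE.
Qed.

Lemma diag_twist_boson : exists f : V1 -> X,
  (forall z, tmap (galg_incl (T0 := T0)) id (f z) = shift_map DH pi (val z))
  /\ hopf_star_iso tw1 (boson_ops DH pi T0 beta) f.
Proof. by exists f; split; [exact: incl_diag_map|exact: diag_twist_iso]. Qed.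

End Subgroup.
End Constructions.

Theorem theorem2p5 (R : realType) (T : topologicalZmodType)
    (H : lmodType R[i]) (DH : hopf_ops (C := R[i]) H)
    (pi : H -> galg (C := R[i]) (dual R T))
    (beta : dual R T -> dual R T -> R[i]) (T0 : set T)
    (hT : compact [set: T]) (hT2 : hausdorff_space T)
    (hH : is_hopf_star DH)
    (hpi : hopf_star_hom DH (galg_ops (C := R[i]) (dual R T)) pi)
    (hbeta : is_bichar beta)
    (hT0 : closed_subgroup T0) (hcoc : cocentral DH pi T0) :
  let CT := galg_ops (C := R[i]) (dual R T) in
  let D1 := diag_inv_ops DH pi T0 in
  let D2 := smash_ops DH pi T0 in
  let B := boson_ops DH pi T0 beta in
  let j1 := diag_cocycle (DH := DH) (pi := pi) beta (T0 := T0) in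
  let j2 := smash_cocycle pi beta (T0 := T0) in
  [/\ hopf_star_hom D1 (tensor_ops CT DH) val,
      unitary_hopf_cocycle D1 j1,
      unitary_hopf_cocycle D2 j2,
      exists f : diag_inv DH pi T0 -> tensor (galg (C := R[i]) (qdual R T0)) H,
        (forall z, tmap (galg_incl (T0 := T0)) id (f z)
                   = shift_map DH pi (val z))
        /\ hopf_star_iso (twist_ops D1 j1) B f
    & hopf_star_iso (twist_ops D2 j2) B id].
Proof.
split.
- exact (diag_inv_hopf_star_hom hH hpi hcoc).
- exact (diag_cocycle_unitary hH hpi hcoc hbeta).
- exact (smash_cocycle_unitary hH hpi hcoc hbeta).
- exact (diag_twist_boson hH hpi hcoc hbeta).
- exact (smash_twist_iso hH hpi hcoc hbeta).
Qed.
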